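(* Let $r_0\ge3$, $s\ge0$ and $M\ge1$ be fixed. Assume that $P\in\mathcal P_{r_0}$ and that $\alpha_h$ satisfies $$\forall\,x\in\mathbb R,\qquad|\alpha_h(x)|\le\gamma h^\beta$$ for some constants $\gamma>0$ and $\beta\in(0,1)$. Then there exists a constant $h_0$ depending on $r_0$, $\|P\|$, $s$, $M$ and $\gamma$ such that for all $h\le h_0$ there exists a real polynomial Hamiltonian $H_h$ such that for all $z\in B^s_M$, $$\big\|\Phi_P^h\circ\Phi_{A_0}^1(z)-\Phi_{H_h}^h(z)\big\|_{\ell^1_s}\le h\exp\big(-(h_0/h)^\beta\big).$$
   Context: Phase space. Let $d\ge1$ and $\mathcal N=\mathbb Z^d$ or $\mathbb N^d$; for $a\in\mathcal N$ put $|a|^2=\max(1,a_1^2+\cdots+a_d^2)$. Let $\mathcal Z=\mathcal N\times\{\pm1\}$; for $j=(a,\delta)\in\mathcal Z$ put $|j|=|a|$ and $\overline j=(a,-\delta)$. A pair $(\xi,\eta)\in\mathbb C^{\mathcal N}\times\mathbb C^{\mathcal N}$ is identified with $z=(z_j)_{j\in\mathcal Z}$ by $z_{(a,1)}=\xi_a$, $z_{(a,-1)}=\eta_a$. For $s\ge0$, $\ell^1_s$ is the space of $z\in\mathbb C^{\mathcal Z}$ with $\|z\|_{\ell^1_s}=\sum_{j\in\mathcal Z}|j|^s|z_j|<\infty$, and $B^s_M=\{z\in\ell^1_s:\|z\|_{\ell^1_s}\le M\}$. $z$ is real if $z_{\overline j}=\overline{z_j}$ for all $j$; a function $H(z)$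 is real if $H(z)\in\mathbb R$ for all real $z$. The Hamiltonian vector field is $(X_H)_{(a,1)}=-i\,\partial H/\partial\eta_a$, $(X_H)_{(a,-1)}=i\,\partial H/\partial\xi_a$, and $\Phi_H^t$ is the flow at time $t$ of $\dot z=X_H(z)$. Polynomials. For $\boldsymbol j=(j_1,\dots,j_\ell)\in\mathcal Z^\ell$, $j_i=(a_i,\delta_i)$, put $z_{\boldsymbol j}=z_{j_1}\cdots z_{j_\ell}$, $\overline{\boldsymbol j}=(\overline{j_1},\dots,\overline{j_\ell})$, $\mathcal M(\boldsymbol j)=\sum_i\delta_ia_i$, and $\mathcal I_\ell=\{\boldsymbol j\in\mathcal Z^\ell:\mathcal M(\boldsymbol j)=0\}$. $\mathcal P_k$ is the set of real polynomial Hamiltonians of degree $k$, with a zero of order at least $2$ at $z=0$, of the form $P(z)=\sum_{\ell=2}^k\sum_{\boldsymbol j\in\mathcal I_\ell}a_{\boldsymbol j}z_{\boldsymbol j}$, with $a_{\overline{\boldsymbol j}}=\overline{a_{\boldsymbol j}}$ and bounded coefficients (the coefficients may be taken invariant under permutations of the entries of $\boldsymbol j$); $\|P\|=\sum_{\ell=2}^k\sup_{\boldsymbol j\in\mathcal I_\ell}|a_{\boldsymbol j}|$. Linear part. The frequencies $\omega_a\in\mathbb R$ ($a\in\mathcal N$) satisfy $|\omega_a|\le C|a|^m$ for some constants $C,m>0$. $h>0$ is the stepsize, $\alpha_h$ is a real function depending on $h$ with $\alpha_h(0)=0$ and $\alpha_h(x)\simeq x$ for small $x$, $\lambda_a=\alpha_h(h\omega_a)$,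 $A_0(z)=\sum_{a}\lambda_a\xi_a\eta_a$, and $\Phi_{A_0}^1$ is its time-one flow: $(\Phi_{A_0}^1(z))_j=\exp(-i\delta\lambda_a)z_j$ for $j=(a,\delta)$.
   Formalization: The constant h_0 is allowed to depend on β as well as on r_0, ‖P‖, s, M and γ; an h_0 uniform in β∈(0,1) is impossible, since for β→0 the bound γh^β with γ=4 permits the resonance λ_0=π. *)

(* Defs.v *)
(* MathComp-Analysis; complex numbers are [R[i]] over an arbitrary [R : realType]. *)
From HB Require Import structures.
From mathcomp Require Import all_boot all_order all_algebra.
From mathcomp Require Import complex.
From mathcomp Require Import all_classical all_reals all_analysis.
From mathcomp.analysis.showcase Require summability.

Set Implicit Arguments.
Unset Strict Implicit.
Unset Printing Implicit Defensive.

Import Order.TTheory GRing.Theory Num.Theory.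
Import numFieldNormedType.Exports.
Local Open Scope classical_set_scope.
Local Open Scope ring_scope.
Local Open Scope complex_scope.

(* N^d (with 0 in N) when [nonneg] holds, Z^d otherwise. *)
Definition in_lattice (nonneg : bool) (d : nat) (a : 'rV[int]_d) : bool :=
  nonneg ==> [forall i, 0 <= a ord0 i].

Notation mode nonneg d := {a : 'rV[int]_d | in_lattice nonneg a}.

(* (a, true) stands for (a, +1) and (a, false) for (a, -1). *)
Notation phase_index nonneg d := (mode nonneg d * bool)%type.

Section PhaseSpace.
Variable R : realType.

(* The modulus of a complex number as an element of [R]; MathComp's [`|x|] on
   [R[i]] takes its values in [R[i]]. *)
Definition modulus (x : R[i]) : R := ComplexField.Normc.normc x.

(* Sum of an unconditionally summable complex family: the limit of the finite
   partial sums. [R[i]^o] is what carries the normed topology of [R[i]]. *)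
Definition csum (I : choiceType) (x : I -> R[i]) : R[i] :=
  summability.sum (x : I -> R[i]^o).

Variables (nonneg : bool) (d : nat).
Local Notation N := (mode nonneg d).
Local Notation Z := (phase_index nonneg d).
Local Notation state := (Z -> R[i]).

Definition mode_abs (a : N) : R :=
  Num.sqrt (Num.max 1 (\sum_(i < d) ((val a ord0 i)%:~R) ^+ 2)).

Definition index_abs (j : Z) : R := mode_abs j.1.

Definition index_conj (j : Z) : Z := (j.1, ~~ j.2).

Definition index_sign (j : Z) : int := if j.2 then 1 else -1.

Definition l1norm (s : R) (z : state) : \bar R :=
  (\esum_(j in [set: Z]) (index_abs j `^ s * modulus (z j))%:E)%E.

Definition l1 (s : R) : set state := [set z | (l1norm s z < +oo)%E].

Definition l1ball (s M : R) : set state :=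
  [set z | l1 s z /\ (l1norm s z <= M%:E)%E].

Definition momentum (l : nat) (j : l.-tuple Z) : 'rV[int]_d :=
  \sum_(i < l) index_sign (tnth j i) *: val (tnth j i).1.

Local Notation zero_momentum l := {j : l.-tuple Z | momentum j == 0}.

Definition monomial (l : nat) (j : l.-tuple Z) (z : state) : R[i] :=
  \prod_(i < l) z (tnth j i).

Definition tuple_conj (l : nat) (j : l.-tuple Z) : l.-tuple Z :=
  [tuple of map index_conj j].

(* Only the values [a l j] with [momentum j = 0] are ever used. *)
Definition coeffs : Type := forall l : nat, l.-tuple Z -> R[i].

Definition poly_eval (k : nat) (a : coeffs) (z : state) : R[i] :=
  \sum_(2 <= l < k.+1)
    csum (fun j : zero_momentum l => a l (val j) * monomial (val j) z).

Definition coeff_moduli (a : coeffs) (l : nat) : set R :=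
  [set modulus (a l (val j)) | j in [set: zero_momentum l]].

Definition poly_norm (k : nat) (a : coeffs) : R :=
  \sum_(2 <= l < k.+1) sup (coeff_moduli a l).

(* The class P_k; the symmetry of the coefficients makes [poly_eval k a] real
   on real states. *)
Definition in_P (k : nat) (a : coeffs) : Prop :=
  forall l, (2 <= l <= k)%N ->
    has_ubound (coeff_moduli a l) /\
    (forall j : l.-tuple Z, momentum j = 0 -> a l (tuple_conj j) = (a l j)^*).

(* Complex partial derivative of [H] in the variable z_j. *)
Definition partial (H : state -> R[i]) (j : Z) (z : state) : R[i] :=
  derive1 (fun t : R[i]^o =>
             H (fun j' => z j' + (if j' == j then t else 0)) : R[i]^o) 0.

Definition vector_field (H : state -> R[i]) (z : state) : state := fun j =>
  if j.2 then - 'i%C * partial H (index_conj j) z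
  else 'i%C * partial H (index_conj j) z.

(* [u] solves the Cauchy problem z' = X_H(z), z(0) = z0 on [0, t], the
   derivative being taken in l^1_s (one-sided at the end points). *)
Definition solves (s : R) (H : state -> R[i]) (t : R) (z0 : state)
    (u : R -> state) : Prop :=
  u 0 = z0 /\
  forall tau, 0 <= tau <= t ->
    l1 s (u tau) /\ l1 s (vector_field H (u tau)) /\
    forall e : R, 0 < e -> \forall x \near tau, 0 <= x <= t ->
      (l1norm s (fun j => (u x j - u tau j
                          - (x - tau)%:C * vector_field H (u tau) j)%R)
         <= (e * `|x - tau|)%:E)%E.

(* [is_flow s H t z w]: Phi_H^t(z) is well defined in l^1_s and equals [w]. *)
Definition is_flow (s : R) (H : state -> R[i]) (t : R) (z w : state) : Prop :=
  (exists u, solves s H t z u) /\ (forall u, solves s H t z u -> u t = w).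

Definition linear_ham (lambda : N -> R) (z : state) : R[i] :=
  csum (fun a : N => (lambda a)%:C * z (a, true) * z (a, false)).

End PhaseSpace.

(* Main.v *)
Require Import Defs.
From HB Require Import structures.
From mathcomp Require Import all_boot all_order all_algebra.
From mathcomp Require Import complex finmap.
From mathcomp Require Import ring lra zify.
From mathcomp Require Import all_classical all_reals all_analysis.
From mathcomp.analysis.showcase Require summability.

(** Why the theorem is true.

    One step of the splitting method composes the time-one flows of two vector
    fields: [A], the field of the linear part, and [B], the field of [P]
    multiplied by [h].  On the ball of radius [rho = 2 M] both have size at most
    [eta], a constant times [h^beta]; for [A] this only uses that the symbol
    [alpha_h] is bounded by [gamma h^beta], whatever the frequencies are.  By the
    Baker-Campbell-Hausdorff formula the composition is formally the flow of
    [Z_1 + Z_2 + ...], where [Z_n] is homogeneous of degree [n] in [(A, B)], is a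
    combination of iterated brackets, and hence is Hamiltonian and polynomial.  The
    modified Hamiltonian is that of [(Z_1 + ... + Z_N) / h].

    The point of the estimates is that brackets are bounded at a fixed radius.
    Deriving a polynomial of degree [e] costs [e / rho] and no loss of domain, and
    a bracket of grade at most [N] has degree at most [N r], so that every bracket
    costs at most [c = N r / rho].  If [N] is a small multiple of [h^-beta] then
    [c eta] is a small constant, the terms [Z_n] decay like [tau^-n] with
    [tau = e^2] ([bch_bound], [picard_value]), and so do the terms of grade larger
    than [N] in both flows, where the factorials produced by iterating derivations
    are compensated by those of the exponential series ([bch_power_bound],
    [flow_difference]).  What is neglected is thus of the order of [tau^-N], which
    is exponentially small in [h^-beta] ([truncation_order]).

    Polynomials in infinitely many variables are represented by noncommutative
    coefficients, one for each word in the letters of the phase space ([array]).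
    A vector field acts on them as a derivation ([wderiv]).  Conservation of
    momentum leaves at most two letters for each slot of a word, so that all
    coefficients are finite sums and the commutator of two derivations is the
    derivation of the bracket without any convergence argument
    ([wderiv_commutator]).  The Baker-Campbell-Hausdorff formula becomes an identity
    between formal series over the algebra of operators on arrays: it is obtained
    from the differential equation of the exponential in the formal time
    ([exp_bch], [bch_exp]).

    Analysis enters with the evaluation [ev] of an array on a state.  Sizes are
    measured by majorants, polynomials in one variable with nonnegative
    coefficients ([nbound]).  The chain rule ([ev_wderiv]) and the computation of
    partial derivatives on coefficients ([partial_ev]) link arrays to the
    Hamiltonian vector fields of the statement; flows are Lie series
    ([lie_eval_flow], [lie_flow_is_flow]), and they are unique because fields are
    Lipschitz on balls ([solves_unique]).  Finally brackets of Hamiltonian fields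
    are Hamiltonian ([ev_poisson], [hamiltonian_bch]), and the polynomial
    Hamiltonians of the statement are exactly the values of real, momentum
    preserving arrays with bounded coefficients ([poly_eval_ev],
    [poly_eval_array], [linear_ham_ev]). *)

Set Implicit Arguments.
Unset Strict Implicit.
Unset Printing Implicit Defensive.
Set Warnings "-notation-overridden,-ambiguous-paths,-notation-incompatible-prefix".

Import Order.TTheory GRing.Theory Num.Theory.
Import numFieldNormedType.Exports.
Local Open Scope classical_set_scope.
Local Open Scope ring_scope.
Local Open Scope complex_scope.
Arguments modulus : simpl never.

(** * Moduli and finite partial sums *)

Section FiniteSums.
Variable R : realType.
Implicit Types (I J : eqType).

Lemma modulus_norm (x : R[i]) : `|x| = (modulus x)%:C.
Proof. by []. Qed.

Lemma modulus_ge0 (x : R[i]) : 0 <= modulus x.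
Proof. by rewrite -lecR -modulus_norm; exact: normr_ge0. Qed.

Lemma modulus0 : modulus (0 : R[i]) = 0.
Proof. by apply: complexI; rewrite -modulus_norm normr0. Qed.

Lemma modulus1 : modulus (1 : R[i]) = 1.
Proof. by apply: complexI; rewrite -modulus_norm normr1. Qed.

Lemma modulusN (x : R[i]) : modulus (- x) = modulus x.
Proof. by apply: complexI; rewrite -!modulus_norm normrN. Qed.

Lemma modulusM (x y : R[i]) : modulus (x * y) = modulus x * modulus y.
Proof. by apply: complexI; rewrite rmorphM /= -!modulus_norm normrM. Qed.

Lemma modulusD (x y : R[i]) : modulus (x + y) <= modulus x + modulus y.
Proof. by rewrite -lecR rmorphD /= -!modulus_norm ler_normD. Qed.

Lemma modulus_distC (x y : R[i]) : modulus (x - y) = modulus (y - x).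
Proof. by rewrite -modulusN opprB. Qed.

Lemma modulusV (x : R[i]) : modulus x^-1 = (modulus x)^-1.
Proof. by apply: complexI; rewrite fmorphV /= -!modulus_norm normfV. Qed.

Lemma modulus_real (r : R) : modulus r%:C = `|r|.
Proof. by rewrite /modulus /= expr0n /= addr0 sqrtr_sqr. Qed.

Lemma modulus_i : modulus ('i%C : R[i]) = 1.
Proof. by rewrite /modulus /= expr0n /= add0r expr1n sqrtr1. Qed.

Lemma modulus_nat n : modulus (n%:R : R[i]) = n%:R.
Proof. by apply: complexI; rewrite -modulus_norm normr_nat rmorph_nat. Qed.

Lemma modulus_eq0 (x : R[i]) : modulus x = 0 -> x = 0.
Proof.
by move=> h; apply/eqP; rewrite -normr_eq0 modulus_norm h.
Qed.

Lemma modulus_sum (T : Type) (A : seq T) (P : pred T) (x : T -> R[i]) :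
  modulus (\sum_(i <- A | P i) x i) <= \sum_(i <- A | P i) modulus (x i).
Proof.
elim/big_ind2: _ => [|x1 x2 y1 y2 h1 h2|//]; first by rewrite modulus0.
by rewrite (le_trans (modulusD _ _)) // lerD.
Qed.

Lemma modulus_real_imag (a b : R) : modulus (a +i* b) <= `|a| + `|b|.
Proof.
have -> : a +i* b = a%:C + 'i%C * b%:C by rewrite [LHS]complexE.
by rewrite (le_trans (modulusD _ _)) // modulusM modulus_i mul1r !modulus_real.
Qed.

Lemma Re_modulus (x : R[i]) : `|complex.Re x| <= modulus x.
Proof. by rewrite -lecR normc_ge_Re. Qed.

Lemma Im_modulus (x : R[i]) : `|complex.Im x| <= modulus x.
Proof.
have := Re_modulus (x * 'i%C).
by rewrite ReiNIm normrN modulusM modulus_i mulr1.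
Qed.

Lemma eq_modulus_eps (x y : R[i]) :
  (forall e : R, 0 < e -> modulus (x - y) <= e) -> x = y.
Proof.
move=> h; apply/eqP; rewrite -subr_eq0; apply/eqP/modulus_eq0.
apply/eqP; rewrite eq_le modulus_ge0 andbT leNgt; apply/negP => hp.
have := h (modulus (x - y) / 2); rewrite divr_gt0 // => /(_ isT).
by rewrite ler_pdivlMr // mulr_natr mulr2n leNgt ltrDl hp.
Qed.

(** All infinite sums are controlled through their finite partial sums, taken
    over duplicate-free lists: a real bound of this kind survives every
    rearrangement. *)
Definition sumle I (f : I -> R) (B : R) :=
  forall A : seq I, uniq A -> \sum_(i <- A) f i <= B.

Lemma sumle_ge0 I (f : I -> R) B : sumle f B -> 0 <= B.
Proof. by move=> /(_ [::] isT); rewrite big_nil. Qed.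

Lemma sumle_term I (f : I -> R) B i : sumle f B -> f i <= B.
Proof. by move=> /(_ [:: i] isT); rewrite big_seq1. Qed.

Lemma le_sumle I (f g : I -> R) B B' :
  (forall i, f i <= g i) -> B <= B' -> sumle g B -> sumle f B'.
Proof.
move=> fg BB h A uA; apply: le_trans BB; apply: le_trans (h A uA).
exact: ler_sum.
Qed.

Lemma sumleD I (f g : I -> R) B B' :
  sumle f B -> sumle g B' -> sumle (fun i => f i + g i) (B + B').
Proof. by move=> h h' A uA; rewrite big_split lerD ?h ?h'. Qed.

Lemma sumleZ I (f : I -> R) B c :
  0 <= c -> sumle f B -> sumle (fun i => c * f i) (c * B).
Proof. by move=> c0 h A uA; rewrite -mulr_sumr ler_wpM2l ?h. Qed.

Lemma sumle_sum I (T : Type) (s : seq T) (f : T -> I -> R) (B : T -> R) :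
  (forall t, sumle (f t) (B t)) ->
  sumle (fun i => \sum_(t <- s) f t i) (\sum_(t <- s) B t).
Proof. by move=> h A uA; rewrite exchange_big ler_sum // => t _; apply: h. Qed.

Lemma le_sum_subset I (f : I -> R) (A B : seq I) :
  (forall i, 0 <= f i) -> uniq A -> uniq B -> {subset A <= B} ->
  \sum_(i <- A) f i <= \sum_(i <- B) f i.
Proof.
move=> f0 uA uB AB.
rewrite [leRHS](bigID (mem A) predT f)/= -[leLHS]addr0 lerD ?sumr_ge0//.
rewrite -[leRHS]big_filter le_eqVlt; apply/orP; left; apply/eqP; apply: perm_big.
apply: uniq_perm => //; first exact: filter_uniq.
move=> i; rewrite mem_filter; case: (boolP (i \in A)) => //= iA.
by rewrite (AB _ iA).
Qed.

Lemma sum_subset_diff I (V : zmodType) (f : I -> V) (A B : seq I) :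
  uniq A -> uniq B -> {subset A <= B} ->
  \sum_(i <- B) f i - \sum_(i <- A) f i
    = \sum_(i <- [seq i <- B | i \notin A]) f i.
Proof.
move=> uA uB AB; rewrite (bigID (mem A) predT f)/= -big_filter.
have -> : \sum_(i <- [seq i <- B | i \in A]) f i = \sum_(i <- A) f i.
  apply: perm_big; apply: uniq_perm => //; first exact: filter_uniq.
  move=> i; rewrite mem_filter; case: (boolP (i \in A)) => //= iA.
  by rewrite (AB _ iA).
by rewrite addrAC subrr add0r big_filter.
Qed.

Lemma subset_undup_catl I (A B : seq I) : {subset A <= undup (A ++ B)}.
Proof. by move=> i iA; rewrite mem_undup mem_cat iA. Qed.

Lemma subset_undup_catr I (A B : seq I) : {subset B <= undup (A ++ B)}.
Proof. by move=> i iB; rewrite mem_undup mem_cat iB orbT. Qed.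

Lemma sumle_nonneg_limit I (f : I -> R) B : (forall i, 0 <= f i) -> sumle f B ->
  exists F, forall e : R, 0 < e -> exists2 A, uniq A &
    forall A', uniq A' -> {subset A <= A'} -> `|F - \sum_(i <- A') f i| <= e.
Proof.
move=> f0 fB; pose E : set R := [set y | exists2 A, uniq A & y = \sum_(i <- A) f i].
have hE : has_sup E.
  split; first by exists 0; exists [::] => //; rewrite big_nil.
  by exists B => y [A uA ->]; apply: fB.
exists (sup E) => e e0.
have [_ [A uA ->] hA] := sup_adherent e0 hE.
exists A => // A' uA' AA'.
have h1 : \sum_(i <- A') f i <= sup E.
  by apply: ub_le_sup; [case: hE|exists A'].
rewrite ger0_norm ?subr_ge0// lerBlDr -lerBlDl.
by rewrite (le_trans (ltW hA))// le_sum_subset.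
Qed.

Lemma sumle_real_limit I (f : I -> R) B : sumle (fun i => `|f i|) B ->
  exists F, forall e : R, 0 < e -> exists2 A, uniq A &
    forall A', uniq A' -> {subset A <= A'} -> `|F - \sum_(i <- A') f i| <= e.
Proof.
move=> fB; pose p i := (`|f i| + f i) / 2; pose n i := (`|f i| - f i) / 2.
have p0 i : 0 <= p i.
  by rewrite divr_ge0// -[X in X + _]opprK addrC subr_ge0 lerNl -normrN ler_norm.
have n0 i : 0 <= n i by rewrite divr_ge0// subr_ge0 ler_norm.
have pf i : p i <= `|f i|.
  by rewrite ler_pdivrMr// mulr_natr mulr2n lerD// ler_norm.
have nf i : n i <= `|f i|.
  by rewrite ler_pdivrMr// mulr_natr mulr2n lerD// -normrN ler_norm.
have [P hP] := sumle_nonneg_limit p0 (le_sumle pf (lexx _) fB).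
have [N hN] := sumle_nonneg_limit n0 (le_sumle nf (lexx _) fB).
exists (P - N) => e e0; have e20 : 0 < e / 2 by rewrite divr_gt0.
have [A uA hA] := hP _ e20; have [A' uA' hA'] := hN _ e20.
exists (undup (A ++ A')); first exact: undup_uniq.
move=> A'' uA'' AA''.
have -> : \sum_(i <- A'') f i = \sum_(i <- A'') p i - \sum_(i <- A'') n i.
  by rewrite -sumrB; apply: eq_bigr => i _; rewrite /p /n; field.
rewrite opprD addrACA -opprD (le_trans (ler_normB _ _))//.
rewrite [leRHS]splitr lerD//; [apply: hA|apply: hA'] => // i iA;
  apply: AA''; [exact: subset_undup_catl|exact: subset_undup_catr].
Qed.

Definition asummable I (x : I -> R[i]) :=
  exists B, sumle (fun i => modulus (x i)) B.

(** The positive and negative parts of the real and imaginary parts are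
    increasing nets of partial sums bounded above, so completeness of the reals
    gives the limit. *)
Lemma asummable_limit I (x : I -> R[i]) : asummable x ->
  exists S, forall e : R, 0 < e -> exists2 A, uniq A &
    forall A', uniq A' -> {subset A <= A'} ->
      modulus (S - \sum_(i <- A') x i) <= e.
Proof.
move=> [B xB].
have reB : sumle (fun i => `|complex.Re (x i)|) B.
  by apply: le_sumle xB => // i; apply: Re_modulus.
have imB : sumle (fun i => `|complex.Im (x i)|) B.
  by apply: le_sumle xB => // i; apply: Im_modulus.
have [P hP] := sumle_real_limit reB; have [N hN] := sumle_real_limit imB.
exists (P +i* N) => e e0; have e20 : 0 < e / 2 by rewrite divr_gt0.
have [A uA hA] := hP _ e20; have [A' uA' hA'] := hN _ e20.
exists (undup (A ++ A')); first exact: undup_uniq.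
move=> A'' uA'' AA''.
have -> : \sum_(i <- A'') x i
    = (\sum_(i <- A'') complex.Re (x i)) +i* (\sum_(i <- A'') complex.Im (x i)).
  elim: {AA'' uA''} A'' => [|a l IH]; first by rewrite !big_nil.
  by rewrite !big_cons IH; case: (x a).
apply: (le_trans (modulus_real_imag _ _)).
rewrite [leRHS]splitr lerD//; [apply: hA|apply: hA'] => // i iA;
  apply: AA''; [exact: subset_undup_catl|exact: subset_undup_catr].
Qed.

End FiniteSums.

Section ComplexSums.
Variable R : realType.
Implicit Types (I J : choiceType).

(** The sum is defined as a limit along a filter of finite sets in the normed
    topology of the complex numbers; this reduces it to estimates on finite sums. *)
Lemma csum_eq_limit I (x : I -> R[i]) S :
  (forall e : R, 0 < e -> exists2 A, uniq A &
    forall A', uniq A' -> {subset A <= A'} ->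
      modulus (S - \sum_(i <- A') x i) <= e) ->
  csum x = S.
Proof.
move=> h; rewrite /csum /summability.sum.
have totP := @summability.totally_filter I.
apply: (@cvg_lim (R[i]^o : normedModType R[i])).
  exact: (@norm_hausdorff R[i] (R[i]^o)).
apply/(@cvgrPdist_le R[i] (R[i]^o)) => e e0.
have [r [r0 re]] : exists r : R, 0 < r /\ r%:C = e.
  exists (complex.Re e); move: (e0); rewrite ltcE/= => /andP[/eqP im re]; split => //.
  by move: im re; case: e {e0} => a b /= ->.
have [A uA hA] := h _ r0.
exists [fset i in A]%fset => //= B AB.
rewrite -re.
have -> : summability.partial_sum (x : I -> R[i]^o) B = \sum_(i <- B) x i.
  by rewrite /summability.partial_sum -(big_seq_fsetE _ B xpredT x).
rewrite [X in X <= _](modulus_norm (S - _)) lecR; apply: hA; first exact: fset_uniq.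
move=> i iA; move/fsubsetP: AB; apply.
by rewrite !inE /=.
Qed.

Lemma csum_limit I (x : I -> R[i]) : asummable x ->
  forall e : R, 0 < e -> exists2 A, uniq A &
    forall A', uniq A' -> {subset A <= A'} ->
      modulus (csum x - \sum_(i <- A') x i) <= e.
Proof. by move=> /asummable_limit[S hS]; rewrite (csum_eq_limit hS). Qed.

End ComplexSums.

(** * Absolutely summable complex families *)

Section CsumAlgebra.
Variable R : realType.
Implicit Types (I J T : choiceType).

Lemma asummable_le I (x y : I -> R[i]) :
  (forall i, modulus (x i) <= modulus (y i)) -> asummable y -> asummable x.
Proof. by move=> xy [B hB]; exists B; apply: le_sumle hB. Qed.

Lemma asummableD I (x y : I -> R[i]) :
  asummable x -> asummable y -> asummable (fun i => x i + y i).
Proof.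
move=> [B hB] [B' hB']; exists (B + B').
by apply: le_sumle (sumleD hB hB') => // i; apply: modulusD.
Qed.

Lemma asummableZ I (x : I -> R[i]) c :
  asummable x -> asummable (fun i => c * x i).
Proof.
move=> [B hB]; exists (modulus c * B).
by apply: le_sumle (sumleZ (modulus_ge0 c) hB) => // i; rewrite modulusM.
Qed.

Lemma asummable0 I : asummable (fun _ : I => 0 : R[i]).
Proof. by exists 0 => A _; rewrite big1 // => i _; rewrite modulus0. Qed.

Lemma asummable_sum I (S : Type) (s : seq S) (x : S -> I -> R[i]) :
  (forall t, asummable (x t)) -> asummable (fun i => \sum_(t <- s) x t i).
Proof.
move=> h; elim: s => [|t s IH].
  apply: asummable_le (asummable0 I) => i; by rewrite big_nil.
by apply: asummable_le (asummableD (h t) IH) => i; rewrite big_cons.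
Qed.

Lemma eq_csum I (x y : I -> R[i]) : x =1 y -> csum x = csum y.
Proof. by move=> /funext ->. Qed.

Lemma csum_dist_le I (x : I -> R[i]) c e A0 : asummable x -> uniq A0 ->
  (forall A, uniq A -> {subset A0 <= A} -> modulus (c - \sum_(i <- A) x i) <= e) ->
  modulus (c - csum x) <= e.
Proof.
move=> sx uA0 h; apply/ler_addgt0Pr => d d0.
have [A uA hA] := csum_limit sx d0.
have uB := undup_uniq (A0 ++ A).
have h1 := h _ uB (@subset_undup_catl _ _ _).
have h2 := hA _ uB (@subset_undup_catr _ _ _).
rewrite -[c](subrK (\sum_(i <- undup (A0 ++ A)) x i)) -addrA.
rewrite (le_trans (modulusD _ _))// lerD//.
by rewrite modulus_distC.
Qed.

Lemma csum_le I (x : I -> R[i]) B :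
  sumle (fun i => modulus (x i)) B -> modulus (csum x) <= B.
Proof.
move=> h; have sx : asummable x by exists B.
rewrite -modulusN -sub0r; apply: (csum_dist_le sx (A0 := [::])) => // A uA _.
by rewrite sub0r modulusN (le_trans (modulus_sum _ _ _))//; apply: h.
Qed.

Lemma csumD I (x y : I -> R[i]) : asummable x -> asummable y ->
  csum (fun i => x i + y i) = csum x + csum y.
Proof.
move=> sx sy; apply: csum_eq_limit => e e0.
have e20 : 0 < e / 2 by rewrite divr_gt0.
have [A uA hA] := csum_limit sx e20; have [A' uA' hA'] := csum_limit sy e20.
exists (undup (A ++ A')); first exact: undup_uniq.
move=> B uB AB; rewrite big_split/= opprD addrACA.
rewrite (le_trans (modulusD _ _))// [leRHS]splitr lerD//.
  by apply: hA => // i iA; apply/AB/subset_undup_catl.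
by apply: hA' => // i iA; apply/AB/subset_undup_catr.
Qed.

Lemma csumZ I (x : I -> R[i]) c : asummable x ->
  csum (fun i => c * x i) = c * csum x.
Proof.
move=> sx; apply: csum_eq_limit => e e0.
have m0 : 0 < modulus c + 1 by rewrite ltr_wpDl ?modulus_ge0.
have [A uA hA] := csum_limit sx (divr_gt0 e0 m0); exists A => // B uB AB.
rewrite -mulr_sumr -mulrBr modulusM.
rewrite (@le_trans _ _ ((modulus c + 1) * (e / (modulus c + 1))))//.
  by rewrite ler_pM ?modulus_ge0 ?lerDl//; apply: hA.
by rewrite mulrC divfK// gt_eqF.
Qed.

Lemma csumN I (x : I -> R[i]) : asummable x ->
  csum (fun i => - x i) = - csum x.
Proof.
by move=> sx; rewrite -mulN1r -csumZ//; apply: eq_csum => i; rewrite mulN1r.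
Qed.

Lemma csumB I (x y : I -> R[i]) : asummable x -> asummable y ->
  csum (fun i => x i - y i) = csum x - csum y.
Proof.
move=> sx sy; rewrite -csumN// -csumD//.
by apply: asummable_le sy => i; rewrite modulusN.
Qed.

Lemma csum0 I (x : I -> R[i]) : (forall i, x i = 0) -> csum x = 0.
Proof.
move=> h; apply: csum_eq_limit => e e0; exists [::] => // A _ _.
by rewrite big1// subr0 modulus0 ltW.
Qed.

Lemma csum_finite I (x : I -> R[i]) (s : seq I) : uniq s ->
  (forall i, i \notin s -> x i = 0) -> csum x = \sum_(i <- s) x i.
Proof.
move=> us h; apply: csum_eq_limit => e e0; exists s => // A uA sA.
rewrite modulus_distC sum_subset_diff// big_seq big1 ?modulus0 ?ltW// => i.
by rewrite mem_filter => /andP[/h].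
Qed.

Lemma csum_single I (x : I -> R[i]) i0 :
  (forall i, i != i0 -> x i = 0) -> csum x = x i0.
Proof.
move=> h; rewrite (@csum_finite _ _ [:: i0])// ?big_seq1// => i.
by rewrite inE; apply: h.
Qed.

Lemma csum_sum I (S : Type) (s : seq S) (x : S -> I -> R[i]) :
  (forall t, asummable (x t)) ->
  csum (fun i => \sum_(t <- s) x t i) = \sum_(t <- s) csum (x t).
Proof.
move=> h; elim: s => [|t s IH].
  by rewrite big_nil csum0// => i; rewrite big_nil.
rewrite big_cons -IH -csumD//; last exact: asummable_sum.
by apply: eq_csum => i; rewrite big_cons.
Qed.

(** Index sets are changed by comparing finite partial sums only: enlarging two
    finite sets until they match replaces a bijection between the index sets. *)
Lemma csum_cofinal I J (x : I -> R[i]) (y : J -> R[i]) :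
  asummable x -> asummable y ->
  (forall (A : seq I) (B : seq J), uniq A -> uniq B -> exists A' B',
    [/\ uniq A', uniq B', {subset A <= A'}, {subset B <= B'} &
      \sum_(i <- A') x i = \sum_(j <- B') y j]) ->
  csum x = csum y.
Proof.
move=> sx sy h; apply: eq_modulus_eps => e e0.
have e20 : 0 < e / 2 by rewrite divr_gt0.
have [A uA hA] := csum_limit sx e20; have [B uB hB] := csum_limit sy e20.
have [A' [B' [uA' uB' AA' BB' eqAB]]] := h _ _ uA uB.
rewrite -(subrK (\sum_(i <- A') x i) (csum x)) -addrA.
rewrite (le_trans (modulusD _ _))// [leRHS]splitr lerD ?hA//.
by rewrite eqAB modulus_distC hB.
Qed.

(** The bound on rectangles is what justifies exchanging two sums. *)
Definition sumle2 I J (y : I -> J -> R[i]) (B : R) :=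
  forall A K, uniq A -> uniq K ->
    \sum_(i <- A) \sum_(k <- K) modulus (y i k) <= B.

Lemma sumle2_swap I J (y : I -> J -> R[i]) B :
  sumle2 y B -> sumle2 (fun j i => y i j) B.
Proof. by move=> h A K uA uK; rewrite exchange_big; apply: h. Qed.

Lemma sumle2_row I J (y : I -> J -> R[i]) B i : sumle2 y B ->
  sumle (fun k => modulus (y i k)) B.
Proof. by move=> h K uK; have := h [:: i] K isT uK; rewrite big_seq1. Qed.

Lemma sumle2_prod I J (y : I -> J -> R[i]) (f : I -> R) B :
  (forall i, sumle (fun k => modulus (y i k)) (f i)) -> sumle f B -> sumle2 y B.
Proof.
move=> h hf A K uA uK; apply: le_trans (hf _ uA).
by apply: ler_sum => i _; apply: h.
Qed.

Lemma csum_limit_seq I J (y : I -> J -> R[i]) (A : seq I) e :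
  0 < e -> (forall i, asummable (y i)) ->
  exists2 K, uniq K & forall i K', i \in A -> uniq K' -> {subset K <= K'} ->
    modulus (csum (y i) - \sum_(k <- K') y i k) <= e.
Proof.
move=> e0 sy; elim: A => [|a A [K uK hK]]; first by exists [::].
have [K1 uK1 hK1] := csum_limit (sy a) e0.
exists (undup (K1 ++ K)); first exact: undup_uniq.
move=> i K' /predU1P[->|iA] uK' KK'.
  by apply: hK1 => // k kK; apply/KK'/subset_undup_catl.
by apply: hK => // k kK; apply/KK'/subset_undup_catr.
Qed.

Lemma sumle_csum I J (y : I -> J -> R[i]) B : sumle2 y B ->
  sumle (fun i => modulus (csum (y i))) B.
Proof.
move=> h A uA; apply/ler_addgt0Pr => e e0.
have sy i : asummable (y i) by exists B; apply: sumle2_row.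
have c0 : 0 < e / ((size A).+1)%:R by rewrite divr_gt0.
have [K uK hK] := csum_limit_seq A c0 sy.
apply: (@le_trans _ _ (\sum_(i <- A) (\sum_(k <- K) modulus (y i k)
    + e / ((size A).+1)%:R))).
  rewrite big_seq [leRHS]big_seq; apply: ler_sum => i iA.
  rewrite -[csum _](subrK (\sum_(k <- K) y i k)) addrC.
  by rewrite (le_trans (modulusD _ _))// lerD ?modulus_sum// hK.
rewrite big_split/= lerD ?h//.
rewrite big_const_seq count_predT iter_addr addr0 -[_ *+ size A]mulr_natr -mulrA.
apply: ler_piMr; first exact: ltW.
by rewrite ler_pdivrMl// mulr1 ler_nat.
Qed.

Lemma asummable_csum I J (y : I -> J -> R[i]) B : sumle2 y B ->
  asummable (fun i => csum (y i)).
Proof. by move=> /sumle_csum h; exists B. Qed.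

(** Fubini: grouping an absolutely summable family along a bijection with a
    product of index sets; the rows are approximated simultaneously on a finite
    rectangle. *)
Lemma csum_pair I J T (phi : I -> J -> T) (p1 : T -> I) (p2 : T -> J)
    (x : T -> R[i]) B :
  (forall t, phi (p1 t) (p2 t) = t) ->
  (forall i j, p1 (phi i j) = i) -> (forall i j, p2 (phi i j) = j) ->
  sumle2 (fun i j => x (phi i j)) B ->
  csum x = csum (fun i => csum (fun j => x (phi i j))).
Proof.
move=> phiK p1K p2K h.
have uprod A K : uniq A -> uniq K -> uniq [seq phi i k | i <- A, k <- K].
  move=> uA uK; apply: allpairs_uniq => // -[a b] [a' b'] _ _ /= e.
  by rewrite -[a](p1K a b) e p1K -[b](p2K a b) e p2K.
have mprod A K t : (t \in [seq phi i k | i <- A, k <- K])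
    = (p1 t \in A) && (p2 t \in K).
  apply/allpairsP/andP => [[[a b] /= [aA bK ->]]|[a b]].
    by rewrite p1K p2K.
  by exists (p1 t, p2 t); rewrite phiK.
have sx : asummable x.
  exists B => S uS; set A := undup (map p1 S); set K := undup (map p2 S).
  apply: (@le_trans _ _ (\sum_(t <- [seq phi i k | i <- A, k <- K]) modulus (x t))).
    apply: le_sum_subset => // [t||t tS]; rewrite ?modulus_ge0 ?uprod ?undup_uniq//.
    by rewrite mprod !mem_undup !map_f.
  by rewrite big_allpairs_dep; apply: h; rewrite undup_uniq.
have srow i : asummable (fun j => x (phi i j)).
  by exists B; apply: (sumle2_row (y := fun i j => x (phi i j))).
have scol j : asummable (fun i => x (phi i j)).
  by exists B; apply: (sumle2_row (y := fun j i => x (phi i j))); apply: sumle2_swap.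
apply: eq_modulus_eps => e e0.
have [S uS hS] := csum_limit sx e0; set A := undup (map p1 S).
apply: (csum_dist_le (A0 := A)) => [|| A' uA' AA']; rewrite ?undup_uniq//.
  exact: (asummable_csum h).
rewrite -csum_sum//; set K := undup (map p2 S).
apply: (csum_dist_le (A0 := K)) => [|| K' uK' KK']; rewrite ?undup_uniq//.
  exact: asummable_sum.
rewrite exchange_big /= -big_allpairs_dep; apply: hS; first exact: uprod.
move=> t tS; rewrite mprod AA' ?KK'// mem_undup map_f//.
Qed.

Lemma csum_swap I J (y : I -> J -> R[i]) B : sumle2 y B ->
  csum (fun i => csum (y i)) = csum (fun j => csum (y^~ j)).
Proof.
move=> h; pose x (t : I * J) := y t.1 t.2.
rewrite -(@csum_pair I J _ (fun i j => (i, j)) fst snd x B)//; last by case.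
rewrite -(@csum_pair J I _ (fun j i => (i, j)) snd fst x B)//; first by case.
exact: sumle2_swap.
Qed.

End CsumAlgebra.

(** * Noncommutative power series and their derivations *)

Section Words.
Variables (K : comNzRingType) (M : zmodType) (T : eqType).
Variables (mom : T -> M) (J : M -> seq T).
Hypothesis J_mom : forall m j, (j \in J m) = (mom j == m).
Hypothesis J_uniq : forall m, uniq (J m).

Local Notation word := (seq T).
Local Notation array := (word -> K).

Definition momw (w : word) : M := \sum_(i <- w) mom i.

Lemma momwE w : momw w = \sum_(i <- w) mom i. Proof. by []. Qed.

Lemma momw_nil : momw [::] = 0. Proof. by rewrite /momw big_nil. Qed.

Lemma momw_cons k w : momw (k :: w) = mom k + momw w.
Proof. by rewrite /momw big_cons. Qed.

Lemma momw_cat u v : momw (u ++ v) = momw u + momw v.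
Proof. by rewrite /momw big_cat. Qed.

Definition conv (B : word -> word -> K) : array :=
  fun w => \sum_(p < (size w).+1) B (take p w) (drop p w).

Lemma conv_nil B : conv B [::] = B [::] [::].
Proof. by rewrite /conv big_ord1. Qed.

Lemma conv_cons B k w :
  conv B (k :: w) = B [::] (k :: w) + conv (fun u x => B (k :: u) x) w.
Proof. by rewrite /conv big_ord_recl. Qed.

Lemma eq_conv B B' w : (forall u x, u ++ x = w -> B u x = B' u x) ->
  conv B w = conv B' w.
Proof. by move=> h; apply: eq_bigr => p _; apply: h; rewrite cat_take_drop. Qed.

Lemma convD B B' w :
  conv (fun u x => B u x + B' u x) w = conv B w + conv B' w.
Proof. by rewrite /conv big_split. Qed.

Lemma convZ c B w : conv (fun u x => c * B u x) w = c * conv B w.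
Proof. by rewrite /conv mulr_sumr. Qed.

Lemma conv0 w : conv (fun _ _ => 0) w = 0.
Proof. by rewrite /conv big1. Qed.

(** Both sides sum over the cuts of [w] into three pieces. *)
Lemma convA (F : word -> word -> word -> K) w :
  conv (fun v y => conv (F v) y) w
    = conv (fun c b => conv (fun v a => F v a b) c) w.
Proof.
elim: w F => [|k w IH] F; first by rewrite !conv_nil.
rewrite !conv_cons conv_nil IH -addrA -convD; congr (_ + _).
by apply: eq_conv => u x _; rewrite conv_cons.
Qed.

(** The product sum_j (Y j) (g j).  An infinite sum over letters would need
    convergence; here momentum conservation, shifted by [nu], leaves only the
    letters of [J], so that every coefficient is a finite sum. *)
Definition star (nu : M) (Y g : T -> array) : array :=
  conv (fun u x => \sum_(j <- J (nu + momw u)) Y j u * g j x).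

Definition lquot (f : array) : T -> array := fun j x => f (j :: x).

(** The derivation of noncommutative power series that replaces each letter
    [j] in turn by the series [X j], coefficient by coefficient: either the
    inserted series covers the head of the word, or the derivation acts after
    the head.  [mu] is the momentum that the fields [X j] carry in excess of
    that of [j]; it is nonzero only for partial derivatives. *)
Fixpoint wderiv (mu : M) (X : T -> array) (f : array) (w : word) : K :=
  star mu X (lquot f) w
    + if w is k :: w' then wderiv mu X (lquot f k) w' else 0.

Lemma wderiv_nil mu X f :
  wderiv mu X f [::] = \sum_(j <- J mu) X j [::] * f [:: j].
Proof. by rewrite /= addr0 /star conv_nil momw_nil addr0. Qed.

Lemma wderiv_cons mu X f k w :
  wderiv mu X f (k :: w)
    = star mu X (lquot f) (k :: w) + wderiv mu X (lquot f k) w.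
Proof. by []. Qed.

Lemma eq_star nu Y Y' g g' w :
  (forall j u, Y j u = Y' j u) -> (forall j u, g j u = g' j u) ->
  star nu Y g w = star nu Y' g' w.
Proof.
by move=> h h'; apply: eq_conv => u x _; apply: eq_bigr => j _; rewrite h h'.
Qed.

Lemma star_addl nu Y Y' g w :
  star nu (fun j u => Y j u + Y' j u) g w = star nu Y g w + star nu Y' g w.
Proof.
rewrite /star -convD; apply: eq_conv => u x _.
by rewrite -big_split; apply: eq_bigr => j _; rewrite mulrDl.
Qed.

Lemma star_addr nu Y g g' w :
  star nu Y (fun j u => g j u + g' j u) w = star nu Y g w + star nu Y g' w.
Proof.
rewrite /star -convD; apply: eq_conv => u x _.
by rewrite -big_split; apply: eq_bigr => j _; rewrite mulrDr.
Qed.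

Lemma star_scalel nu c Y g w :
  star nu (fun j u => c * Y j u) g w = c * star nu Y g w.
Proof.
rewrite /star -convZ; apply: eq_conv => u x _.
by rewrite mulr_sumr; apply: eq_bigr => j _; rewrite mulrA.
Qed.

Lemma star_scaler nu c Y g w :
  star nu Y (fun j u => c * g j u) w = c * star nu Y g w.
Proof.
rewrite /star -convZ; apply: eq_conv => u x _.
by rewrite mulr_sumr; apply: eq_bigr => j _; rewrite mulrCA.
Qed.

Lemma eq_wderiv mu X X' f f' w :
  (forall j u, X j u = X' j u) -> (forall u, f u = f' u) ->
  wderiv mu X f w = wderiv mu X' f' w.
Proof.
move=> h; elim: w f f' => [|k w IH] f f' h'.
  by rewrite !wderiv_nil; apply: eq_bigr => j _; rewrite h h'.
rewrite !wderiv_cons (eq_star _ (g' := lquot f') _ h)// => [|j u]; last exact: h'.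
by congr (_ + _); apply: IH => u; apply: h'.
Qed.

Lemma wderiv_add mu X f g w :
  wderiv mu X (fun u => f u + g u) w = wderiv mu X f w + wderiv mu X g w.
Proof.
elim: w f g => [|k w IH] f g.
  rewrite !wderiv_nil -big_split; apply: eq_bigr => j _; by rewrite mulrDr.
by rewrite !wderiv_cons star_addr IH addrACA.
Qed.

Lemma wderiv_scale mu X c f w :
  wderiv mu X (fun u => c * f u) w = c * wderiv mu X f w.
Proof.
elim: w f => [|k w IH] f.
  by rewrite !wderiv_nil mulr_sumr; apply: eq_bigr => j _; rewrite mulrCA.
by rewrite !wderiv_cons star_scaler IH mulrDr.
Qed.

Lemma wderiv0 mu X w : wderiv mu X (fun=> 0) w = 0.
Proof.
rewrite -[RHS](mul0r (wderiv mu X (fun=> 0) w)) -wderiv_scale.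
by apply: eq_wderiv => // u; rewrite mul0r.
Qed.

Lemma wderiv_sum mu X (S : Type) (s : seq S) (f : S -> array) w :
  wderiv mu X (fun u => \sum_(t <- s) f t u) w
    = \sum_(t <- s) wderiv mu X (f t) w.
Proof.
elim: s => [|t s IH].
  rewrite big_nil -[RHS](wderiv0 mu X w); apply: eq_wderiv => // u.
  by rewrite big_nil.
rewrite big_cons -IH -wderiv_add; apply: eq_wderiv => // u.
by rewrite big_cons.
Qed.

Lemma wderiv_addl mu X Y f w :
  wderiv mu (fun j u => X j u + Y j u) f w = wderiv mu X f w + wderiv mu Y f w.
Proof.
elim: w f => [|k w IH] f.
  rewrite !wderiv_nil -big_split; apply: eq_bigr => j _; by rewrite mulrDl.
by rewrite !wderiv_cons star_addl IH addrACA.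
Qed.

Lemma wderiv_scalel mu c X f w :
  wderiv mu (fun j u => c * X j u) f w = c * wderiv mu X f w.
Proof.
elim: w f => [|k w IH] f.
  by rewrite !wderiv_nil mulr_sumr; apply: eq_bigr => j _; rewrite mulrA.
by rewrite !wderiv_cons star_scalel IH mulrDr.
Qed.

Lemma wderiv_const mu X f w : (forall k u, f (k :: u) = 0) ->
  wderiv mu X f w = 0.
Proof.
elim: w f => [|k w IH] f h.
  by rewrite wderiv_nil big1 // => j _; rewrite h mulr0.
rewrite wderiv_cons IH ?addr0 => [|i u]; last exact: h.
rewrite -[RHS](conv0 (k :: w)); apply: eq_conv => u x _; apply: big1 => j _.
by rewrite /lquot h mulr0.
Qed.

(** Leibniz rule: the inserted series falls either before or after the cut
    of the word. *)
Lemma wderiv_conv mu X B w :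
  wderiv mu X (conv B) w
    = conv (fun u x => wderiv mu X (B^~ x) u + wderiv mu X (B u) x) w.
Proof.
elim: w B => [|k w IH] B.
  rewrite conv_nil !wderiv_nil -big_split; apply: eq_bigr => j _ /=.
  by rewrite conv_cons conv_nil mulrDr addrC.
rewrite wderiv_cons conv_cons.
have -> : star mu X (lquot (conv B)) (k :: w)
  = star mu X (lquot (B [::])) (k :: w)
    + conv (fun c b => star mu X (lquot (B^~ b)) c) (k :: w).
  rewrite /star -[X in _ + X]convA -convD; apply: eq_conv => u x _.
  transitivity (\sum_(j <- J (mu + momw u)) (X j u * B [::] (j :: x)
      + X j u * conv (fun v a => B (j :: v) a) x)).
    by apply: eq_bigr => j _; rewrite /lquot conv_cons mulrDr.
  rewrite big_split; congr (_ + _) => /=.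
  rewrite /conv exchange_big; apply: eq_bigr => j _.
  by rewrite mulr_sumr.
have -> : wderiv mu X (lquot (conv B) k) w
  = wderiv mu X (lquot (B [::]) k) w
    + conv (fun u x => wderiv mu X (lquot (B^~ x) k) u + wderiv mu X (B (k :: u)) x) w.
  rewrite -IH -wderiv_add; apply: eq_wderiv => // u.
  by rewrite /lquot conv_cons.
rewrite conv_cons [in RHS]wderiv_cons wderiv_nil.
have -> : conv (fun u x => wderiv mu X (B^~ x) (k :: u) + wderiv mu X (B (k :: u)) x) w
  = conv (fun u x => star mu X (lquot (B^~ x)) (k :: u)) w
    + conv (fun u x => wderiv mu X (lquot (B^~ x) k) u + wderiv mu X (B (k :: u)) x) w.
  by rewrite -convD; apply: eq_conv => u x _; rewrite wderiv_cons addrA.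
rewrite {2}/star conv_nil momw_nil addr0 /lquot.
ring.
Qed.

(** A derivation shifts momenta by [mu], so a coefficient of the result only
    sees the coefficients of [f] of one momentum. *)
Lemma wderiv_momw mu X (G : M -> array) w :
  wderiv mu X (fun u => G (momw u) u) w = wderiv mu X (G (mu + momw w)) w.
Proof.
elim: w G => [|k w IH] G.
  rewrite !wderiv_nil momw_nil addr0 big_seq [RHS]big_seq; apply: eq_bigr => j.
  by rewrite J_mom momw_cons momw_nil addr0 => /eqP ->.
rewrite !wderiv_cons momw_cons; congr (_ + _).
  apply: eq_conv => u x uxw; rewrite big_seq [RHS]big_seq; apply: eq_bigr => j.
  rewrite J_mom /lquot momw_cons => /eqP ->; rewrite -addrA -momw_cat uxw.
  by rewrite momw_cons.
transitivity (wderiv mu X (fun u => lquot (G (mom k + momw u)) k u) w).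
  by apply: eq_wderiv => // u; rewrite /lquot momw_cons.
rewrite (IH (fun m => lquot (G (mom k + m)) k)).
by apply: eq_wderiv => // u; rewrite /lquot addrCA.
Qed.

Lemma wderiv_star mu nu X Y g w :
  wderiv mu X (star nu Y g) w
    = star (nu + mu) (fun j => wderiv mu X (Y j)) g w
      + star nu Y (fun j => wderiv mu X (g j)) w.
Proof.
rewrite /star wderiv_conv -convD; apply: eq_conv => u x _; congr (_ + _).
  rewrite (wderiv_momw mu X (fun m u => \sum_(j <- J (nu + m)) Y j u * g j x)).
  rewrite addrA wderiv_sum; apply: eq_bigr => j _.
  rewrite mulrC -wderiv_scale; apply: eq_wderiv => // v; exact: mulrC.
by rewrite wderiv_sum; apply: eq_bigr => j _; rewrite wderiv_scale.
Qed.

Lemma wderiv_split mu X f w :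
  wderiv mu X f w = star mu X (lquot f) w
    + (if w is k :: w' then wderiv mu X (lquot f k) w' else 0).
Proof. by case: w. Qed.

(** The second order terms, with two distinct letters replaced, are
    symmetric in the two fields and cancel.  No convergence or support condition
    is needed, because the letters summed over are fixed by momentum
    conservation alone. *)
Lemma wderiv_commutator mu nu X Y f w :
  wderiv mu X (wderiv nu Y f) w - wderiv nu Y (wderiv mu X f) w
    = wderiv (mu + nu) (fun j u => wderiv mu X (Y j) u - wderiv nu Y (X j) u) f w.
Proof.
have step a b U V g v : wderiv a U (wderiv b V g) v
    = star (b + a) (fun j => wderiv a U (V j)) (lquot g) v
      + star b V (fun j => wderiv a U (lquot g j)) v
      + star a U (fun j => wderiv b V (lquot g j)) v
      + (if v is k :: v' then wderiv a U (wderiv b V (lquot g k)) v' else 0).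
  pose h u := if u is k :: u' then wderiv b V (lquot g k) u' else 0.
  rewrite (eq_wderiv a (X' := U) (f' := fun u => star b V (lquot g) u + h u))//;
    last by move=> u; rewrite wderiv_split.
  rewrite wderiv_add wderiv_star -!addrA; congr (_ + (_ + _)).
  by rewrite wderiv_split.
have comb g v : star (mu + nu) (fun j u => wderiv mu X (Y j) u - wderiv nu Y (X j) u) g v
    = star (mu + nu) (fun j => wderiv mu X (Y j)) g v
      - star (mu + nu) (fun j => wderiv nu Y (X j)) g v.
  rewrite -mulN1r -star_scalel -star_addl.
  by apply: eq_star => // j u; rewrite mulN1r.
elim: w f => [|k w IH] f; rewrite (step mu nu X Y f) (step nu mu Y X f) [RHS]wderiv_split comb
  (addrC nu mu).
  by ring.
rewrite -IH; cbv beta iota; ring.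
Qed.

(** The field whose derivation is the partial derivative in the letter [k]:
    it replaces [k] by the empty word and every other letter by zero. *)
Definition unit_field (k : T) : T -> array :=
  fun j v => ((j == k) && (v == [::]))%:R.

Definition partial_word (k : T) (f : array) : array :=
  wderiv (mom k) (unit_field k) f.

Definition coordinate (j : T) : array := fun v => (v == [:: j])%:R.

Lemma sum_J_single (m : M) (k : T) (F : T -> K) :
  mom k = m -> (forall j, j != k -> F j = 0) -> \sum_(j <- J m) F j = F k.
Proof.
move=> km h; rewrite (bigD1_seq k)//= ?J_mom ?km//.
by rewrite big1 ?addr0// => j /h.
Qed.

Lemma star_unit_field k g w : star (mom k) (unit_field k) g w = g k w.
Proof.
transitivity (conv (fun u x => (u == [::])%:R * g k x) w).
  apply: eq_conv => u x _; case: (eqVneq u [::]) => [->|uN].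
    rewrite momw_nil addr0 (sum_J_single erefl); first by rewrite /unit_field !eqxx.
    by move=> j jk; rewrite /unit_field (negbTE jk) mul0r.
  by rewrite mul0r big1// => j _; rewrite /unit_field (negbTE uN) andbF mul0r.
case: w => [|i w]; first by rewrite conv_nil mul1r.
rewrite conv_cons mul1r -[RHS]addr0; congr (_ + _).
by rewrite -[RHS](conv0 w); apply: eq_conv => u x _; rewrite mul0r.
Qed.

Lemma partial_word_nil k f : partial_word k f [::] = f [:: k].
Proof. by rewrite /partial_word wderiv_split star_unit_field addr0. Qed.

Lemma partial_word_cons k f i w :
  partial_word k f (i :: w) = f (k :: i :: w) + partial_word k (lquot f i) w.
Proof. by rewrite /partial_word wderiv_cons star_unit_field. Qed.

Lemma partial_wordC j k f w :
  partial_word j (partial_word k f) w = partial_word k (partial_word j f) w.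
Proof.
apply/eqP; rewrite -subr_eq0 wderiv_commutator; apply/eqP.
rewrite (@eq_wderiv _ _ (fun i u => 0 * unit_field j i u) _ f)//.
  by rewrite wderiv_scalel mul0r.
by move=> i u; rewrite !wderiv_const ?subrr ?mul0r// => a v;
  rewrite /unit_field andbF.
Qed.

(** The commutator with a constant field. *)
Lemma partial_wderiv k Y f w :
  partial_word k (wderiv 0 Y f) w
    = wderiv 0 Y (partial_word k f) w
      + wderiv (mom k) (fun j => partial_word k (Y j)) f w.
Proof.
rewrite -[LHS](subrK (wderiv 0 Y (partial_word k f) w)) addrC; congr (_ + _).
rewrite wderiv_commutator addr0; apply: eq_wderiv => // j u.
by rewrite [X in _ - X]wderiv_const ?subr0// => a v; rewrite /unit_field andbF.
Qed.

Lemma star_coordinate g w :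
  star 0 coordinate g w = if w is k :: w' then g k w' else 0.
Proof.
transitivity (conv (fun u x => if u is [:: k] then g k x else 0) w).
  apply: eq_conv => u x _; case: u => [|k [|i u]].
  - by rewrite big1// => j _; rewrite /coordinate mul0r.
  - rewrite add0r momw_cons momw_nil addr0 (sum_J_single erefl).
      by rewrite /coordinate eqxx mul1r.
    move=> j jk; rewrite /coordinate; case: eqP => [[kj]|_]; last exact: mul0r.
    by rewrite kj eqxx in jk.
  - by rewrite big1// => j _; rewrite /coordinate eqseq_cons andbF mul0r.
case: w => [|k [|i w]]; first by rewrite conv_nil.
  by rewrite conv_cons conv_nil add0r.
rewrite !conv_cons add0r -[RHS]addr0; congr (_ + _).
by rewrite -[RHS](conv0 w).
Qed.

Lemma wderiv_coordinate mu X j w :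
  wderiv mu X (coordinate j) w = if mom j == mu + momw w then X j w else 0.
Proof.
have h0 : star mu X (lquot (coordinate j)) w
    = if mom j == mu + momw w then X j w else 0.
  have -> : star mu X (lquot (coordinate j)) w
     = conv (fun u x => (x == [::])%:R
         * (if mom j == mu + momw u then X j u else 0)) w.
    apply: eq_conv => u x _; case: (eqVneq x [::]) => [->|xN]; last first.
      rewrite mul0r big1// => i _; rewrite /lquot /coordinate.
      by rewrite eqseq_cons (negbTE xN) andbF mulr0.
    rewrite mul1r; case: eqP => [jm|jm].
      rewrite (sum_J_single jm); first by rewrite /lquot /coordinate eqxx mulr1.
      move=> i ij; rewrite /lquot /coordinate eqseq_cons (negbTE ij) mulr0//.
    rewrite big_seq big1// => i; rewrite J_mom => /eqP im.
    rewrite /lquot /coordinate eqseq_cons; case: eqP => [ij|_]; last by rewrite mulr0.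
    by rewrite -ij im in jm.
  rewrite /conv big_ord_recr/= take_size drop_size mul1r big1 ?add0r// => i _.
  have /negbTE -> : drop i w != [::]; last by rewrite mul0r.
  by rewrite -size_eq0 size_drop subn_eq0 -ltnNge.
rewrite wderiv_split h0; case: w {h0} => [|k w]; first by rewrite addr0.
by rewrite wderiv_const ?addr0// => i u; rewrite /lquot /coordinate eqseq_cons andbF.
Qed.

End Words.

(** * The Baker-Campbell-Hausdorff identity in an algebra *)

Section SumLemmas.
Variable S : nmodType.

Lemma sum_pascal (X : nat -> S) n :
  \sum_(i < n.+2) X i *+ 'C(n.+1, i)
    = \sum_(i < n.+1) X i *+ 'C(n, i) + \sum_(i < n.+1) X i.+1 *+ 'C(n, i).
Proof.
rewrite big_ord_recl bin0 mulr1n.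
under eq_bigr => i _ do rewrite lift0 binS mulrnDr.
rewrite big_split addrA; congr (_ + _).
rewrite big_ord_recr /= bin_small // mulr0n addr0.
by rewrite [RHS]big_ord_recl bin0 mulr1n.
Qed.

Lemma sum_pascal_shift (Y : nat -> S) n :
  \sum_(i < n.+1) Y i *+ 'C(n.+1, i.+1)
    = Y 0%N + \sum_(i < n) Y i *+ 'C(n, i.+1) + \sum_(i < n) Y i.+1 *+ 'C(n, i.+1).
Proof.
under eq_bigr => i _ do rewrite binS mulrnDr.
rewrite big_split /= big_ord_recr /= bin_small // mulr0n addr0.
by rewrite [X in _ + X = _]big_ord_recl bin0 mulr1n addrA [Y 0%N + _]addrC.
Qed.

Lemma sum_triangle_sub (G : nat -> nat -> S) K :
  \sum_(k < K) \sum_(i < k.+1) G i (k - i)%N = \sum_(i < K) \sum_(l < K - i) G i l.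
Proof.
elim: K => [|K IH]; first by rewrite !big_ord0.
rewrite big_ord_recr IH /=.
have -> : \sum_(i < K) \sum_(l < K - i) G i l = \sum_(i < K.+1) \sum_(l < K - i) G i l.
  by rewrite big_ord_recr/= subnn big_ord0 addr0.
rewrite -big_split /=; apply: eq_bigr => i _.
by rewrite subSn ?big_ord_recr// -ltnS.
Qed.

Lemma sum_triangle (G : nat -> nat -> S) K :
  (forall i l, (K <= i + l)%N -> G i l = 0) ->
  \sum_(k < K) \sum_(i < k.+1) G i (k - i)%N = \sum_(i < K) \sum_(l < K) G i l.
Proof.
move=> G0; rewrite sum_triangle_sub; apply: eq_bigr => i _.
rewrite -(big_mkord xpredT (G i)) -[RHS](big_mkord xpredT (G i)).
rewrite [RHS](@big_cat_nat _ _ _ (K - i))//= ?leq_subr//.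
rewrite [X in _ = _ + X]big1_seq ?addr0// => l; rewrite mem_index_iota.
by move=> /andP[_ /andP[Kil _]]; rewrite G0// -leq_subLR.
Qed.

End SumLemmas.

Section AdjointExpansion.
Variable S : nzRingType.

Definition adpow (z : S) (k : nat) (w : S) : S :=
  iter k (fun p => z * p - p * z) w.

Lemma adpowS z k w : adpow z k.+1 w = z * adpow z k w - adpow z k w * z.
Proof. by []. Qed.

Lemma mul_adpow z k w : z * adpow z k w = adpow z k.+1 w + adpow z k w * z.
Proof. by rewrite adpowS subrK. Qed.

(** Left multiplication by [z] is the sum of [ad z] and right
    multiplication by [z], which commute: this is their binomial formula. *)
Lemma exp_mul_adpow z b n :
  z ^+ n * b = \sum_(i < n.+1) (adpow z i b * z ^+ (n - i)) *+ 'C(n, i).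
Proof.
elim: n => [|n IH]; first by rewrite big_ord1 mul1r mulr1.
rewrite exprS -mulrA IH mulr_sumr.
rewrite (sum_pascal (fun i => adpow z i b * z ^+ (n.+1 - i))) addrC -big_split.
apply: eq_bigr => i _; rewrite mulrnAr mulrA mul_adpow mulrDl mulrnDl subSS.
by rewrite -mulrA -exprS subSn// -ltnS.
Qed.

End AdjointExpansion.

(** The noncommutative form of the derivative of a power; divided by [n!] and
    summed, it is the formula for the derivative of the exponential map. *)
Lemma deriv_exp_adpow (S : nzRingType) (z : {poly S}) n :
  (z ^+ n)^`()
    = \sum_(i < n) (adpow z i z^`() * z ^+ (n.-1 - i)) *+ 'C(n, i.+1).
Proof.
elim: n => [|n IH]; first by rewrite big_ord0 expr0 derivC.
rewrite exprS derivM IH mulr_sumr.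
rewrite (sum_pascal_shift (fun i => adpow z i z^`() * z ^+ (n - i))) subn0.
rewrite -addrA; congr (_ + _); rewrite addrC -big_split.
apply: eq_bigr => i _; rewrite mulrnAr mulrA mul_adpow mulrDl mulrnDl /=.
rewrite -mulrA -exprS; congr (_ *+ _ + _ *+ _).
  by case: n i {IH} => [[]//|n] i; rewrite subSS.
by case: n i {IH} => [[]//|n] i; rewrite /= subSn// -ltnS.
Qed.

Section FormalBCH.
Variables (F : numFieldType) (E : algType F).

Definition invfact (k : nat) : F := (k`!)%:R^-1.

Lemma fact_neq0 k : (k`!)%:R != 0 :> F.
Proof. by rewrite pnatr_eq0 -lt0n fact_gt0. Qed.

Lemma invfact_bin i l : invfact (i + l) * ('C(i + l, i))%:R = invfact i * invfact l.
Proof.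
rewrite /invfact.
have -> : ((i + l)`!)%:R = ('C(i + l, i))%:R * ((i`!)%:R * (l`!)%:R) :> F.
  by rewrite -!natrM -{3}(addKn i l) bin_fact ?leq_addr.
field; rewrite !fact_neq0 /= ?andbT.
by rewrite pnatr_eq0 -lt0n bin_gt0 leq_addr.
Qed.

Lemma invfactS k : (k.+1)%:R * invfact k.+1 = invfact k.
Proof. by rewrite /invfact factS natrM invfM mulrA mulfV ?mul1r// pnatr_eq0. Qed.

Definition low_order (p : {poly E}) (m : nat) := forall n, (n < m)%N -> p`_n = 0.

Lemma low_orderM p q m m' :
  low_order p m -> low_order q m' -> low_order (p * q) (m + m').
Proof.
move=> hp hq n nm; rewrite coefM big1// => -[i /= ilt] _.
case: (ltnP i m) => im; first by rewrite hp// mul0r.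
rewrite hq ?mulr0//; lia.
Qed.

Lemma low_orderB p q m : low_order p m -> low_order q m -> low_order (p - q) m.
Proof. by move=> hp hq n nm; rewrite coefB hp// hq// subr0. Qed.

Variables (A B : E) (z : {poly E}) (N : nat).
Hypothesis z0 : low_order z 1.

Let a : {poly E} := 'X * A%:P.
Let b : {poly E} := 'X * B%:P.
Let theta : {poly E} := 'X * z^`().

Hypothesis flow_eq : forall n, (0 < n <= N)%N ->
  \sum_(k < n) invfact k.+1 *: (adpow z k theta)`_n
    = a`_n + \sum_(k < n) invfact k *: (adpow z k b)`_n.

Lemma low_order_adpow w k : low_order w 1 -> low_order (adpow z k w) k.+1.
Proof.
move=> hw; elim: k => [|k IH]; first exact: hw.
rewrite adpowS -[k.+2]addn1 addnC; apply: low_orderB; first exact: low_orderM.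
by rewrite addnC; apply: low_orderM.
Qed.

Lemma low_order_X p : low_order ('X * p) 1.
Proof. by case=> // _; rewrite coefXM. Qed.

Lemma low_order_exp k : low_order (z ^+ k) k.
Proof.
elim: k => [|k IH]; first by case.
by rewrite exprS -[k.+1]add1n; apply: low_orderM.
Qed.

Let W g : E := \sum_(k < g.+1) invfact k *: (z ^+ k)`_g.

Lemma conv_exp (u : nat -> {poly E}) (s : nat -> F) g :
  (forall k, low_order (u k) k.+1) ->
  \sum_(i < g.+1) \sum_(l < g.+1) (s i * invfact l) *: (u i * z ^+ l)`_g
    = \sum_(n < g.+1) (\sum_(i < n) s i *: (u i)`_n) * W (g - n)%N.
Proof.
move=> hu.
under eq_bigr => i _ do under eq_bigr => l _ do rewrite coefM scaler_sumr.
under eq_bigr => i _ do rewrite exchange_big.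
rewrite exchange_big; apply: eq_bigr => n _ /=.
rewrite mulr_suml.
transitivity (\sum_(i < g.+1) (s i *: (u i)`_n) * W (g - n)%N).
  apply: eq_bigr => i _; rewrite /W mulr_sumr.
  transitivity (\sum_(l < (g - n).+1) (s i * invfact l) *: ((u i)`_n * (z ^+ l)`_(g - n))).
    rewrite -(big_mkord xpredT (fun l => (s i * invfact l) *: ((u i)`_n * (z ^+ l)`_(g - n)))).
    rewrite (@big_cat_nat _ _ _ (g - n).+1)//= ?ltnS ?leq_subr// big_mkord.
    rewrite [X in _ + X]big1_seq ?addr0// => l.
    rewrite mem_index_iota => /andP[_ /andP[h _]].
    by rewrite low_order_exp// mulr0 scaler0.
  by apply: eq_bigr => l _; rewrite -scalerAl -scalerAr scalerA.
rewrite -(big_mkord xpredT (fun i => s i *: (u i)`_n * W (g - n)%N)).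
rewrite (@big_cat_nat _ _ _ n)//= ?big_mkord; last by rewrite ltnW.
rewrite [X in _ + X]big1_seq ?addr0// => i.
rewrite mem_index_iota => /andP[_ /andP[h _]].
by rewrite hu// scaler0 mul0r.
Qed.

Lemma exp_rec g : (0 < g <= N)%N ->
  g%:R *: W g = A * W g.-1 + W g.-1 * B.
Proof.
move=> gN; have /andP[g0 _] := gN.
pose Wth := \sum_(i < g.+1) \sum_(l < g.+1)
  (invfact i.+1 * invfact l) *: (adpow z i theta * z ^+ l)`_g.
have step1 : g%:R *: W g = Wth.
  rewrite /W scaler_sumr big_ord_recl/= expr0 coef1 gtn_eqF// !scaler0 add0r.
  transitivity (\sum_(k < g.+1) \sum_(i < k.+1)
      (invfact i.+1 * invfact (k - i)) *: (adpow z i theta * z ^+ (k - i))`_g).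
    rewrite [RHS]big_ord_recr /= [X in _ = _ + X]big1 ?addr0; last first.
      move=> i _; rewrite (low_orderM (low_order_adpow (k := i) (low_order_X _)) (@low_order_exp
        (g - i)))//.
        by rewrite scaler0.
      by rewrite addSn subnKC// -ltnS.
    apply: eq_bigr => k _; rewrite scalerA mulrC -scalerA scaler_nat.
    have -> : (z ^+ bump 0 k)`_g *+ g = ('X * (z ^+ k.+1)^`())`_g.
      by rewrite coefXM (gtn_eqF g0) coef_deriv prednK.
    rewrite deriv_exp_adpow mulr_sumr coef_sum scaler_sumr; apply: eq_bigr => i _.
    have -> : adpow z i theta = 'X * adpow z i z^`().
      elim: (i : nat) => [//|j IH]; rewrite !adpowS IH mulrBr !mulrA.
      by rewrite commr_polyX.
    rewrite !mulrnAr mulrA coefMn -scaler_nat scalerA.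
    congr (_ *: _).
    have e : (k.+1 = i.+1 + (k - i))%N by rewrite addSn subnKC// -ltnS.
    by rewrite (_ : bump 0 k = k.+1)//; have := invfact_bin i.+1 (k - i); rewrite -e.
  rewrite (sum_triangle (G := fun i l => (invfact i.+1 * invfact l) *: (adpow z i theta * z ^+
    l)`_g))//.
  move=> i l gil; rewrite (low_orderM (low_order_adpow (k := i) (low_order_X _)) (@low_order_exp
    l)) ?scaler0//.
  by rewrite addSn ltnS ltnW.
rewrite step1 /Wth (conv_exp (u := fun k => adpow z k theta) (fun i => invfact i.+1));
  last by move=> k; apply/low_order_adpow/low_order_X.
transitivity (\sum_(n < g.+1) (a`_n + \sum_(i < n) invfact i *: (adpow z i b)`_n) * W (g - n)%N).
  apply: eq_bigr => -[[|n] nlt] _ /=; first by rewrite !big_ord0 /a coefXM/= addr0.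
  by rewrite flow_eq//; move: gN nlt; lia.
under eq_bigr => n _ do rewrite mulrDl.
rewrite big_split /=; congr (_ + _).
  rewrite big_ord_recl/= /a coefXM/= mul0r add0r.
  case: g g0 {gN Wth step1} => // g _; rewrite big_ord_recl/= coefXM coefC/= subSS subn0.
  rewrite big1 ?addr0// => i _; by rewrite coefXM coefC/= mul0r.
rewrite -(conv_exp (u := fun k => adpow z k b) invfact);
  last by move=> k; apply/low_order_adpow/low_order_X.
rewrite -(sum_triangle (G := fun i l => (invfact i * invfact l) *: (adpow z i b * z ^+ l)`_g));
  last first.
  move=> i l gil; rewrite (low_orderM (low_order_adpow (k := i) (low_order_X _)) (@low_order_exp
    l)) ?scaler0//.
  by rewrite addSn ltnS ltnW.
transitivity (\sum_(k < g.+1) invfact k *: (z ^+ k * b)`_g).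
  apply: eq_bigr => k _; rewrite exp_mul_adpow coef_sum scaler_sumr.
  apply: eq_bigr => i _; rewrite coefMn -scaler_nat scalerA; congr (_ *: _).
  have := invfact_bin i (k - i).
  by rewrite (subnKC (ltn_ord i : (i <= k)%N)).
rewrite /b; case: g g0 {gN Wth step1} => // g _; rewrite big_ord_recr/=.
rewrite [X in _ + X](_ : _ = 0) ?addr0; last first.
  rewrite (low_orderM (@low_order_exp g.+1) (@low_order_X B%:P)) ?scaler0//.
  by rewrite addn1.
rewrite /W mulr_suml; apply: eq_bigr => k _.
by rewrite mulrA commr_polyX -mulrA coefXM/= coefMC scalerAl.
Qed.

(** Let [W] be the exponential of [z], a formal series in the time [t].  The
    assumption on [z] says that [W' = A W + W B] up to order [N]; the product of
    the exponentials of [tA] and [tB] solves the same recursion with the same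
    initial value, hence the coefficients agree. *)
Lemma exp_bch g : (g <= N)%N ->
  \sum_(k < g.+1) invfact k *: (z ^+ k)`_g
    = \sum_(m < g.+1) (invfact m * invfact (g - m)) *: (A ^+ m * B ^+ (g - m)).
Proof.
elim: g => [_|g IH gN].
  by rewrite !big_ord1 expr0 coef1 subn0 expr0 !mulr1 /invfact fact0 invr1 mulr1.
apply: (@scalerI _ _ (g.+1)%:R); first by rewrite pnatr_eq0.
rewrite -/(W _) exp_rec// /= /W IH ?(ltnW gN)//.
rewrite mulr_sumr mulr_suml scaler_sumr.
transitivity (\sum_(m < g.+2) ((m%:R * invfact m) * invfact (g.+1 - m)) *: (A ^+ m * B ^+ (g.+1 -
  m))
  + \sum_(m < g.+2) (invfact m * ((g.+1 - m)%:R * invfact (g.+1 - m))) *: (A ^+ m * B ^+ (g.+1 -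
    m))).
  congr (_ + _).
    rewrite [RHS]big_ord_recl !mul0r scale0r add0r; apply: eq_bigr => m _.
    by rewrite lift0 subSS invfactS exprS -scalerAr mulrA.
  rewrite [RHS]big_ord_recr /= subnn mul0r mulr0 scale0r addr0; apply: eq_bigr => m _.
  rewrite subSn; last by rewrite -ltnS.
  by rewrite invfactS exprSr -scalerAl mulrA.
rewrite -big_split; apply: eq_bigr => m _ /=.
rewrite scalerA -scalerDl; congr (_ *: _).
have -> : (g.+1)%:R = m%:R + (g.+1 - m)%:R :> F.
  by rewrite -natrD (subnKC (ltn_ord m : (m <= g.+1)%N)).
ring.
Qed.

End FormalBCH.

(** * The graded recursion for vector fields *)

Section OperatorAlgebra.
Variables (K : fieldType) (T : eqType).
Local Notation array := (seq T -> K).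

(** Linear operators on power series, as an algebra: the recursion is formal in
    this algebra, while fields are only the operators of first order in it. *)
Record endo := Endo {
  endo_fun :> array -> array;
  endo_linear : forall c f g w,
    endo_fun (fun u => c * f u + g u) w = c * endo_fun f w + endo_fun g w }.

Lemma endo_eq (a b : endo) : (forall f w, a f w = b f w) -> a = b.
Proof.
case: a b => [a ha] [b hb] /= h.
have ab : a = b by apply/funext => f; apply/funext => w; apply: h.
subst b; congr Endo; exact: Prop_irrelevance.
Qed.

HB.instance Definition _ := gen_eqMixin endo.
HB.instance Definition _ := gen_choiceMixin endo.

Lemma endoD (a : endo) f g w : a (fun u => f u + g u) w = a f w + a g w.
Proof.
rewrite -[X in _ = X + _]mul1r -endo_linear; congr (a _ w).
by apply/funext => u; rewrite mul1r.
Qed.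

Lemma endo0 (a : endo) w : a (fun=> 0) w = 0.
Proof.
have := endoD a (fun=> 0) (fun=> 0) w.
have -> : (fun=> 0 + 0) = (fun=> 0) :> array by apply/funext => u; rewrite addr0.
by move/eqP; rewrite -subr_eq subrr => /eqP <-.
Qed.

Lemma endoZ (a : endo) c f w : a (fun u => c * f u) w = c * a f w.
Proof.
rewrite -[RHS]addr0 -[X in _ = _ + X](endo0 a w) -endo_linear; congr (a _ w).
by apply/funext => u; rewrite addr0.
Qed.

Fact endo_zero_subproof c (f g : array) (w : seq T) : (0 : K) = c * 0 + 0.
Proof. by rewrite mulr0 addr0. Qed.
Definition endo_zero := Endo endo_zero_subproof.

Fact endo_one_subproof c (f g : array) (w : seq T) :
  c * f w + g w = c * f w + g w.
Proof. by []. Qed.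
Definition endo_one := @Endo id endo_one_subproof.

Fact endo_opp_subproof (a : endo) c f g w :
  - a (fun u => c * f u + g u) w = c * - a f w + - a g w.
Proof. by rewrite endo_linear; ring. Qed.
Definition endo_opp (a : endo) := @Endo (fun f w => - a f w) (endo_opp_subproof a).

Fact endo_add_subproof (a b : endo) c f g w :
  a (fun u => c * f u + g u) w + b (fun u => c * f u + g u) w
    = c * (a f w + b f w) + (a g w + b g w).
Proof. by rewrite !endo_linear; ring. Qed.
Definition endo_add (a b : endo) := @Endo (fun f w => a f w + b f w) (endo_add_subproof a b).

Fact endo_mul_subproof (a b : endo) c f g w :
  a (b (fun u => c * f u + g u)) w = c * a (b f) w + a (b g) w.
Proof.
by rewrite -endo_linear; congr (a _ w); apply/funext => u; rewrite endo_linear.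
Qed.
Definition endo_mul (a b : endo) := @Endo (fun f => a (b f)) (endo_mul_subproof a b).

Fact endo_scale_subproof d (a : endo) c f g w :
  d * a (fun u => c * f u + g u) w = c * (d * a f w) + d * a g w.
Proof. by rewrite endo_linear; ring. Qed.
Definition endo_scale d (a : endo) := @Endo (fun f w => d * a f w) (endo_scale_subproof d a).

Fact endo_addA : associative endo_add.
Proof. by move=> a b c; apply: endo_eq => f w; apply: addrA. Qed.
Fact endo_addC : commutative endo_add.
Proof. by move=> a b; apply: endo_eq => f w; apply: addrC. Qed.
Fact endo_add0 : left_id endo_zero endo_add.
Proof. by move=> a; apply: endo_eq => f w; apply: add0r. Qed.
Fact endo_addN : left_inverse endo_zero endo_opp endo_add.
Proof. by move=> a; apply: endo_eq => f w; apply: addNr. Qed.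
HB.instance Definition _ :=
  GRing.isZmodule.Build endo endo_addA endo_addC endo_add0 endo_addN.

Fact endo_mulA : associative endo_mul.
Proof. by move=> a b c; apply: endo_eq. Qed.
Fact endo_mul1 : left_id endo_one endo_mul.
Proof. by move=> a; apply: endo_eq. Qed.
Fact endo_mulr1 : right_id endo_one endo_mul.
Proof. by move=> a; apply: endo_eq. Qed.
Fact endo_mulDl : left_distributive endo_mul +%R.
Proof. by move=> a b c; apply: endo_eq. Qed.
Fact endo_mulDr : right_distributive endo_mul +%R.
Proof. by move=> a b c; apply: endo_eq => f w /=; rewrite endoD. Qed.
Fact endo_oner_neq0 : endo_one != 0.
Proof.
apply/eqP => h; have : endo_one (fun=> 1) [::] = 0 by rewrite h.
by move/eqP; rewrite oner_eq0.
Qed.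
HB.instance Definition _ := GRing.Zmodule_isNzRing.Build endo
  endo_mulA endo_mul1 endo_mulr1 endo_mulDl endo_mulDr endo_oner_neq0.

Fact endo_scaleA c d (a : endo) : endo_scale c (endo_scale d a) = endo_scale (c * d) a.
Proof. by apply: endo_eq => f w /=; rewrite mulrA. Qed.
Fact endo_scale1 : left_id 1 endo_scale.
Proof. by move=> a; apply: endo_eq => f w /=; rewrite mul1r. Qed.
Fact endo_scaleDr : right_distributive endo_scale +%R.
Proof. by move=> c a b; apply: endo_eq => f w /=; rewrite mulrDr. Qed.
Fact endo_scaleDl (a : endo) : {morph endo_scale^~ a : c d / c + d}.
Proof. by move=> c d; apply: endo_eq => f w /=; rewrite mulrDl. Qed.
HB.instance Definition _ := GRing.Zmodule_isLmodule.Build K endo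
  endo_scaleA endo_scale1 endo_scaleDr endo_scaleDl.

Fact endo_scaleAl c (a b : endo) : c *: (a * b) = (c *: a) * b.
Proof. by apply: endo_eq. Qed.
HB.instance Definition _ := GRing.Lmodule_isLalgebra.Build K endo endo_scaleAl.
Fact endo_scaleAr c (a b : endo) : c *: (a * b) = a * (c *: b).
Proof. by apply: endo_eq => f w /=; rewrite endoZ. Qed.
HB.instance Definition _ := GRing.Lalgebra_isAlgebra.Build K endo endo_scaleAr.

Lemma endoDE (a b : endo) f w : (a + b) f w = a f w + b f w. Proof. by []. Qed.
Lemma endoME (a b : endo) f : (a * b) f = a (b f). Proof. by []. Qed.
Lemma endo_sumE (S : Type) (s : seq S) (P : pred S) (a : S -> endo) f w :
  (\sum_(t <- s | P t) a t) f w = \sum_(t <- s | P t) a t f w.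
Proof. by elim/big_ind2: _ => // x1 x2 y1 y2; rewrite endoDE => -> ->. Qed.

Lemma endo_exprS (a : endo) n f : (a ^+ n.+1) f = a ((a ^+ n) f).
Proof. by rewrite exprS. Qed.

End OperatorAlgebra.

Section GradedRecursion.
Variables (K : numFieldType) (M : zmodType) (T : eqType).
Variables (mom : T -> M) (J : M -> seq T).
Hypothesis J_mom : forall m j, (j \in J m) = (mom j == m).

Local Notation field := (T -> seq T -> K).

Fact op_subproof (X : field) c f g w :
  wderiv mom J 0 X (fun u => c * f u + g u) w
    = c * wderiv mom J 0 X f w + wderiv mom J 0 X g w.
Proof. by rewrite wderiv_add wderiv_scale. Qed.

Definition op (X : field) : endo K T := Endo (op_subproof X).

Definition bracket (X Y : field) : field :=
  fun j u => wderiv mom J 0 X (Y j) u - wderiv mom J 0 Y (X j) u.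

Definition fzero : field := fun _ _ => 0.
Definition fadd (X Y : field) : field := fun j u => X j u + Y j u.
Definition fscale c (X : field) : field := fun j u => c * X j u.
Definition fsum n (X : nat -> field) : field := fun j u => \sum_(i < n) X i j u.

Lemma op_bracket X Y : op (bracket X Y) = op X * op Y - op Y * op X.
Proof.
apply: endo_eq => f w.
by rewrite [RHS](wderiv_commutator J_mom) addr0.
Qed.

Lemma op0 : op fzero = 0.
Proof.
apply: endo_eq => f w /=; transitivity (wderiv mom J 0 (fun j u => 0 * (0 : K)) f w).
  by apply: eq_wderiv => // j u; rewrite mul0r.
by rewrite (wderiv_scalel _ _ _ 0 (fun _ _ => 0)) mul0r.
Qed.

Lemma op_add X Y : op (fadd X Y) = op X + op Y.
Proof. by apply: endo_eq => f w; apply: wderiv_addl. Qed.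

Lemma op_scale c X : op (fscale c X) = c *: op X.
Proof. by apply: endo_eq => f w; apply: wderiv_scalel. Qed.

Lemma op_sum n X : op (fsum n X) = \sum_(i < n) op (X i).
Proof.
elim: n => [|n IH].
  rewrite big_ord0 -op0; congr op; apply/funext => j; apply/funext => u.
  by rewrite /fsum big_ord0.
rewrite big_ord_recr /= -IH -op_add; congr op.
by apply/funext => j; apply/funext => u; rewrite /fsum /fadd big_ord_recr.
Qed.

(** The part of grade [n] of the [k]-th iterated bracket with [Z], applied to
    [W]. *)
Fixpoint gad (Z : nat -> field) (k : nat) (W : nat -> field) (n : nat) : field :=
  if k is k'.+1 then fsum n.+1 (fun i => bracket (Z i) (gad Z k' W (n - i)))
  else W n.

Definition at_grade1 (X : field) (n : nat) : field := if n == 1%N then X else fzero.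

(** The grading operator, that is [t d/dt] when grades are powers of [t]. *)
Definition euler (Z : nat -> field) (n : nat) : field := fscale n%:R (Z n).

(** One step of the recursion: the part of grade [n] of the equation
    [sum_k ad_Z^k (t Z') / (k+1)! = t A + sum_k ad_Z^k (t B) / k!], solved
    for the term [n Z_n] coming from [k = 0] on the left. *)
Definition bch_step (A B : field) (Z : nat -> field) (n : nat) : field :=
  fscale n%:R^-1 (fadd (fadd (at_grade1 A n)
    (fsum n (fun k => fscale (invfact K k) (gad Z k (at_grade1 B) n))))
    (fscale (-1) (fsum n.-1 (fun k =>
      fscale (invfact K k.+2) (gad Z k.+1 (euler Z) n))))).

(** Iterating from zero fixes one more grade each time, so that [bch A B m]
    solves the recursion in grades at most [m].  Iteration on all grades at once
    is what makes a majorant argument possible. *)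
Fixpoint bch (A B : field) (m : nat) : nat -> field :=
  if m is m'.+1 then bch_step A B (bch A B m') else fun=> fzero.

Lemma wderiv_fzero f w : wderiv mom J 0 fzero f w = 0.
Proof. exact: (congr1 (fun e : endo K T => e f w) op0). Qed.

Lemma bracket0l Y : bracket fzero Y = fzero.
Proof.
apply/funext => j; apply/funext => u.
by rewrite /bracket wderiv_fzero sub0r /fzero wderiv0 oppr0.
Qed.

Lemma bracket0r X : bracket X fzero = fzero.
Proof.
apply/funext => j; apply/funext => u.
by rewrite /bracket wderiv_fzero subr0 /fzero wderiv0.
Qed.

Lemma gad_at0 Z k W : W 0%N = fzero -> gad Z k W 0 = fzero.
Proof.
move=> W0; elim: k => [|k IH] //=; apply/funext => j; apply/funext => u.
by rewrite /fsum big_ord1 IH bracket0r.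
Qed.

Lemma eq_gad_lt Z Z' W W' n : (forall i, (i < n)%N -> Z i = Z' i) ->
  (forall i, (i < n)%N -> W i = W' i) ->
  forall k n', (n' < n)%N -> gad Z k W n' = gad Z' k W' n'.
Proof.
move=> hZ hW; elim=> [|k IH] n' n'n /=; first exact: hW.
apply/funext => j; apply/funext => u; apply: eq_bigr => -[i /= ilt] _.
by rewrite hZ ?IH//; lia.
Qed.

(** The bracket raises the order, so grade [n] of an iterated bracket does not
    see grade [n] of its arguments: the recursion is triangular. *)
Lemma eq_gad Z Z' W W' n k : Z 0%N = fzero -> Z' 0%N = fzero ->
  W 0%N = fzero -> W' 0%N = fzero ->
  (forall i, (i < n)%N -> Z i = Z' i) ->
  (forall i, (i < n)%N -> W i = W' i) -> gad Z k.+1 W n = gad Z' k.+1 W' n.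
Proof.
move=> Z0 Z'0 W0 W'0 hZ hW /=.
apply/funext => j; apply/funext => u; apply: eq_bigr => -[i /= ilt] _.
have [->|i0] := eqVneq i 0%N; first by rewrite Z0 Z'0 !bracket0l.
have [->|ni] := eqVneq i n; first by rewrite subnn !gad_at0// !bracket0r.
by rewrite hZ ?(eq_gad_lt hZ hW)//; lia.
Qed.

Lemma bch_at0 A B m : bch A B m 0 = fzero.
Proof.
case: m => [//|m]; apply/funext => j; apply/funext => u.
by rewrite /= /bch_step /fscale invr0 mul0r.
Qed.

Lemma bch_stable A B m n : (n <= m)%N -> bch A B m.+1 n = bch A B m n.
Proof.
elim: m n => [|m IH] n nm.
  by move: nm; rewrite leqn0 => /eqP ->; rewrite !bch_at0.
have hZ i : (i < n)%N -> bch A B m.+1 i = bch A B m i by move=> ?; apply: IH; lia.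
have e0 Z : euler Z 0 = fzero.
  by apply/funext => j; apply/funext => u; rewrite /euler /fscale mul0r.
change (bch_step A B (bch A B m.+1) n = bch_step A B (bch A B m) n).
rewrite /bch_step; congr (fscale _ (fadd (fadd _ _) (fscale _ _))).
  apply/funext => j; apply/funext => u; apply: eq_bigr => -[[|k] klt] _ //.
  by congr (fscale _ _ _ _); apply: (eq_gad _ (bch_at0 _ _ m.+1) (bch_at0 _ _ m)).
apply/funext => j; apply/funext => u; apply: eq_bigr => -[k klt] _.
congr (fscale _ _ _ _).
apply: (eq_gad _ (bch_at0 _ _ m.+1) (bch_at0 _ _ m)) => // i ilt.
by rewrite /euler hZ.
Qed.

Lemma bch_fixpoint A B N n : (n <= N)%N ->
  bch A B N n = bch_step A B (bch A B N) n.
Proof. by move=> nN; rewrite -(bch_stable A B nN). Qed.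

Lemma coef_adpow (Z W : nat -> field) (w : {poly endo K T}) N k n :
  (forall i, (i <= N)%N -> w`_i = op (W i)) -> (n <= N)%N ->
  (adpow (\poly_(i < N.+1) op (Z i)) k w)`_n = op (gad Z k W n).
Proof.
move=> hw; elim: k n => [|k IH] n nN; first exact: hw.
rewrite adpowS coefB coefM coefMr -sumrB /= op_sum.
apply: eq_bigr => -[i /= ilt] _.
by rewrite coef_poly ifT ?IH ?op_bracket//; lia.
Qed.

Definition bch_poly A B N : {poly endo K T} := \poly_(i < N.+1) op (bch A B N i).

Lemma bch_exp A B N g : (g <= N)%N ->
  \sum_(k < g.+1) invfact K k *: (bch_poly A B N ^+ k)`_g
    = \sum_(m < g.+1) (invfact K m * invfact K (g - m))
        *: (op A ^+ m * op B ^+ (g - m)).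
Proof.
apply: exp_bch.
  by move=> n; rewrite ltnS leqn0 => /eqP ->; rewrite coef_poly bch_at0 op0.
move=> n /andP[n0 nN].
have hth i : (i <= N)%N -> ('X * (bch_poly A B N)^`())`_i = op (euler (bch A B N) i).
  rewrite coefXM; case: i => [|i] iN /=; first by rewrite op_scale scale0r.
  by rewrite coef_deriv coef_poly ltnS iN op_scale scaler_nat.
have hb X i : ('X * (op X)%:P)`_i = op (at_grade1 X i).
  rewrite coefXM /at_grade1; case: i => [|[|i]] /=; rewrite ?op0 ?coefC//.
case: n n0 nN => // n _ nN.
rewrite hb big_ord_recl [in X in X + _]/= hth// /euler (bch_fixpoint _ _ nN).
under eq_bigr => k _ do rewrite lift0 (coef_adpow (bch A B N) _ hth nN) -op_scale.
under [in RHS]eq_bigr => k _ do rewrite (coef_adpow (bch A B N) _ (fun i _ => hb B i) nN)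
  -op_scale.
rewrite /invfact invr1 scale1r /bch_step !op_scale scalerA mulfV ?pnatr_eq0//.
by rewrite scale1r !op_add op_scale !op_sum scaleN1r subrK.
Qed.

End GradedRecursion.

(** * Momenta, weights and majorants *)

Section Letters.
Variables (R : realType) (nonneg : bool) (d : nat).
Local Notation letter := (phase_index nonneg d).
Local Notation mode := (mode nonneg d).
Implicit Types (j : letter) (m : 'rV[int]_d).

Definition lmom j : 'rV[int]_d := index_sign j *: val j.1.

(** Two letters at most carry a given momentum [m]: the mode [m] with sign
    plus and the mode [-m] with sign minus, when they belong to the lattice. *)
Definition letters_of m : seq letter :=
  [seq (a, true) | a <- pmap insub [:: m]] ++
  [seq (a, false) | a <- pmap insub [:: - m]].

Lemma lmom_letters m j : (j \in letters_of m) = (lmom j == m).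
Proof.
case: j => a b; rewrite mem_cat /lmom /index_sign /=.
have mem c m' : ((a, b) \in [seq (a, c) | a <- pmap (insub : _ -> option mode) [:: m']])
    = (b == c) && (val a == m').
  apply/mapP/andP => [[a' + [-> ->]]|[/eqP -> am]].
    by rewrite mem_pmap_sub inE => ->.
  by exists a => //; rewrite mem_pmap_sub inE.
rewrite !mem; case: b {mem} => /=; rewrite ?orbF ?andbF ?scale1r ?scaleN1r//.
by rewrite eqr_oppLR.
Qed.

Lemma letters_of_uniq m : uniq (letters_of m).
Proof.
rewrite cat_uniq !map_inj_uniq ?pmap_sub_uniq//=; try by move=> a b [].
by rewrite andbT; apply/hasPn => _ /mapP[a _ ->]; apply/mapP => -[].
Qed.

Lemma size_letters_of m : (size (letters_of m) <= 2)%N.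
Proof.
rewrite size_cat !size_map !size_pmap_sub/=.
by case: (in_lattice _ m); case: (in_lattice _ (- m)).
Qed.

Lemma lmom_conj j : lmom (index_conj j) = - lmom j.
Proof.
by case: j => a [] /=; rewrite /lmom /index_sign /= ?scale1r scaleN1r ?opprK.
Qed.

Lemma index_conjK : involutive (@index_conj nonneg d).
Proof. by case=> a b; rewrite /index_conj /= negbK. Qed.

Definition vabs m : R := Num.sqrt (Num.max 1 (\sum_(i < d) ((m ord0 i)%:~R) ^+ 2)).

Lemma vabs_ge1 m : 1 <= vabs m.
Proof. by rewrite -[leLHS]sqrtr1 ler_wsqrtr// le_max lexx. Qed.

Lemma vabs_sqr m : vabs m ^+ 2 = Num.max 1 (\sum_(i < d) ((m ord0 i)%:~R) ^+ 2).
Proof. by rewrite sqr_sqrtr// le_max ler01. Qed.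

Lemma vabs_opp m : vabs (- m) = vabs m.
Proof.
rewrite /vabs; congr (Num.sqrt (Num.max 1 _)); apply: eq_bigr => i _.
by rewrite mxE rmorphN /= sqrrN.
Qed.

(** Since the norm is at least one, a product can replace the sum in the
    triangle inequality; this makes weights submultiplicative along words. *)
Lemma vabs_add m m' : vabs (m + m') <= 2 * (vabs m * vabs m').
Proof.
have a1 := vabs_ge1 m; have b1 := vabs_ge1 m'.
have a0 := le_trans ler01 a1; have b0 := le_trans ler01 b1.
rewrite -(@ler_pXn2r _ 2)// ?nnegrE ?sqrtr_ge0 ?mulr_ge0//.
rewrite vabs_sqr ge_max; apply/andP; split.
  by apply: exprn_ege1; nra.
apply: (@le_trans _ _ (2 * (vabs m ^+ 2 + vabs m' ^+ 2))).
  apply: (@le_trans _ _ (\sum_(i < d) 2 * ((m ord0 i)%:~R ^+ 2 + (m' ord0 i)%:~R ^+ 2))).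
    apply: ler_sum => i _; rewrite mxE rmorphD /=.
    by rewrite -subr_ge0 (_ : _ - _ = ((m ord0 i)%:~R - (m' ord0 i)%:~R) ^+ 2) ?sqr_ge0//; ring.
  rewrite -mulr_sumr big_split /= ler_pM2l// lerD// vabs_sqr le_max lexx orbT//.
rewrite exprMn exprMn (_ : 2 ^+ 2 = 2 * 2 :> R)// -mulrA ler_pM2l//.
have A1 : 1 <= vabs m ^+ 2 by apply: exprn_ege1.
have B1 : 1 <= vabs m' ^+ 2 by apply: exprn_ege1.
nra.
Qed.

Lemma index_abs_vabs j : index_abs R j = vabs (lmom j).
Proof.
case: j => a b; rewrite /index_abs /mode_abs /lmom /index_sign /=.
by case: b; rewrite ?scale1r// scaleN1r vabs_opp.
Qed.

End Letters.

Section Weights.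
Variables (R : realType) (nonneg : bool) (d : nat) (s : R).
Hypothesis s0 : 0 <= s.
Local Notation letter := (phase_index nonneg d).
Local Notation mom := (@lmom nonneg d).
Local Notation J := (@letters_of nonneg d).
Local Notation momw := (momw mom).

Definition lwt (j : letter) : R := index_abs R j `^ s.

Definition wt (w : seq letter) : R := \prod_(i <- w) lwt i.

Lemma lwt_ge1 j : 1 <= lwt j.
Proof.
have v1 := vabs_ge1 R (lmom j).
have -> : 1 = 1 `^ s :> R by rewrite powR1.
by rewrite /lwt index_abs_vabs ge0_ler_powR ?nnegrE// (le_trans _ v1).
Qed.

Lemma lwt_gt0 j : 0 < lwt j.
Proof. exact: lt_le_trans ltr01 (lwt_ge1 j). Qed.

Lemma lwt_ge0 j : 0 <= lwt j.
Proof. exact: ltW (lwt_gt0 j). Qed.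

Lemma wt_nil : wt [::] = 1. Proof. by rewrite /wt big_nil. Qed.

Lemma wt_cons k w : wt (k :: w) = lwt k * wt w.
Proof. by rewrite /wt big_cons. Qed.

Lemma wt_cat u w : wt (u ++ w) = wt u * wt w.
Proof. by rewrite /wt big_cat. Qed.

Lemma wt_ge1 w : 1 <= wt w.
Proof.
elim: w => [|k w IH]; first by rewrite wt_nil.
by rewrite wt_cons mulr_ege1// lwt_ge1.
Qed.

Lemma wt_gt0 w : 0 < wt w.
Proof. exact: lt_le_trans ltr01 (wt_ge1 w). Qed.

Lemma wt_ge0 w : 0 <= wt w.
Proof. exact: ltW (wt_gt0 w). Qed.

(** The momentum of a letter produced by a word is the sum of the momenta of
    its letters, so its weight is controlled by the product of their weights.  The
    constant depends on the length of the word and on [s] only. *)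
Lemma lwt_momw j w : w != [::] -> lmom j = momw w ->
  lwt j <= 2 `^ (s * (size w).-1%:R) * wt w.
Proof.
move=> wN jw.
have key : w != [::] -> vabs R (momw w) <= 2 ^+ (size w).-1 * \prod_(i <- w) index_abs R i.
  elim: w {wN jw} => // k [|i w] IH _.
    by rewrite momw_cons momw_nil addr0 big_seq1 mul1r index_abs_vabs.
  rewrite momw_cons (le_trans (vabs_add _ _ _))// big_cons /= exprS -mulrA.
  rewrite ler_pM2l// mulrCA index_abs_vabs ler_pM2l ?IH//.
  exact: lt_le_trans ltr01 (vabs_ge1 _ _).
have p0 i : 0 <= index_abs R i.
  by rewrite index_abs_vabs (le_trans _ (vabs_ge1 _ _)).
rewrite /lwt index_abs_vabs jw.
apply: (@le_trans _ _ ((2 ^+ (size w).-1 * \prod_(i <- w) index_abs R i) `^ s)).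
  rewrite ge0_ler_powR ?nnegrE ?key//; first by rewrite (le_trans _ (vabs_ge1 _ _)).
  by rewrite mulr_ge0 ?exprn_ge0// prodr_ge0.
rewrite powRM ?exprn_ge0 ?prodr_ge0//.
have -> : (2 ^+ (size w).-1) `^ s = 2 `^ (s * (size w).-1%:R) :> R.
  by rewrite -powR_mulrn// -powRrM mulrC.
rewrite ler_pM2l ?powR_gt0//.
elim: w {wN jw key} => [|k w IH]; first by rewrite !big_nil wt_nil powR1.
by rewrite big_cons wt_cons powRM ?prodr_ge0// ler_wpM2l// powR_ge0.
Qed.

(** The coefficient of degree [l] of [b] bounds, relatively to the weight of
    the word, the sum over the letters compatible with the momentum of the word.
    That sum rather than a supremum is what the norm of a vector field needs. *)
Definition majorant (I : Type) (Js : 'rV[int]_d -> seq I) (om : I -> R)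
    (F : I -> seq letter -> R[i]) (b : {poly R}) :=
  forall v, \sum_(i <- Js (momw v)) om i * modulus (F i v) <= b`_(size v) * wt v.

Definition nonneg_poly (b : {poly R}) := forall n, 0 <= b`_n.

(** A word of length [l] arises from a cut into a piece of length [p] coming
    from [X] and a rest of length [l - p + 1] in [f], with [l - p + 1] possible
    positions for the replaced letter. *)
Lemma wderiv_coefficient_bound (I : Type) (Js : 'rV[int]_d -> seq I) (om : I -> R)
    (mu : 'rV[int]_d) (X : letter -> seq letter -> R[i]) (F : I -> seq letter -> R[i])
    (c beta : nat -> R) w :
  (forall i, 0 <= om i) -> (forall n, 0 <= c n) -> (forall n, 0 <= beta n) ->
  (forall v, \sum_(j <- J (mu + momw v)) lwt j * modulus (X j v) <= c (size v) * wt v) ->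
  (forall v, \sum_(i <- Js (momw v)) om i * modulus (F i v) <= beta (size v) * wt v) ->
  \sum_(i <- Js (mu + momw w)) om i * modulus (wderiv mom J mu X (F i) w)
    <= (\sum_(p < (size w).+1) (size w - p).+1%:R * (c p * beta (size w - p).+1)) * wt w.
Proof.
move=> om0 c0 + hX.
have hstar (Js' : 'rV[int]_d -> seq I) (F' : I -> seq letter -> R[i]) (beta' : nat -> R) v :
    (forall n, 0 <= beta' n) ->
    (forall v, \sum_(i <- Js' (momw v)) om i * modulus (F' i v) <= beta' (size v) * wt v) ->
    \sum_(i <- Js' (mu + momw v)) om i * modulus (star mom J mu X (lquot (F' i)) v)
    <= (\sum_(p < (size v).+1) (c p * beta' (size v - p).+1)) * wt v.
  move=> b0 hF.
  apply: (@le_trans _ _ (\sum_(i <- Js' (mu + momw v)) \sum_(p < (size v).+1)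
     \sum_(j <- J (mu + momw (take p v))) modulus (X j (take p v)) * (om i * modulus (F' i (j ::
       drop p v))))).
    apply: ler_sum => i _.
    apply: (@le_trans _ _ (om i * \sum_(p < (size v).+1) \sum_(j <- J (mu + momw (take p v)))
        modulus (X j (take p v) * F' i (j :: drop p v)))).
      rewrite ler_wpM2l// (le_trans (modulus_sum _ _ _))//.
      by apply: ler_sum => p _; rewrite modulus_sum.
    rewrite mulr_sumr; apply: ler_sum => p _; rewrite mulr_sumr; apply: ler_sum => j _.
    by rewrite modulusM mulrCA.
  rewrite exchange_big /= mulr_suml; apply: ler_sum => p _.
  rewrite exchange_big /=.
  apply: (@le_trans _ _ (\sum_(j <- J (mu + momw (take p v)))
     modulus (X j (take p v)) * (beta' (size v - p).+1 * (lwt j * wt (drop p v))))).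
    rewrite big_seq [leRHS]big_seq; apply: ler_sum => j.
    rewrite lmom_letters => /eqP jm; rewrite -mulr_sumr ler_wpM2l ?modulus_ge0//.
    have := hF (j :: drop p v).
    by rewrite momw_cons jm -addrA -momw_cat cat_take_drop /= size_drop wt_cons.
  rewrite (_ : \sum_(j <- _) _ = (\sum_(j <- J (mu + momw (take p v))) lwt j * modulus (X j (take
    p v)))
     * (beta' (size v - p).+1 * wt (drop p v))); last first.
    by rewrite mulr_suml; apply: eq_bigr => j _; ring.
  have -> : wt v = wt (take p v) * wt (drop p v) by rewrite -wt_cat cat_take_drop.
  apply: (@le_trans _ _ ((c (size (take p v)) * wt (take p v)) * (beta' (size v - p).+1 * wt
    (drop p v)))).
    by rewrite ler_wpM2r// mulr_ge0 ?wt_ge0.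
  rewrite size_takel; last by rewrite -ltnS.
  by rewrite le_eqVlt; apply/orP; left; apply/eqP; ring.
elim: w Js F beta => [|k w IH] Js F beta b0 hF.
  apply: (@le_trans _ _ (\sum_(i <- Js (mu + momw [::])) om i * modulus (star mom J mu X (lquot
    (F i)) [::]))).
    by apply: ler_sum => i _; rewrite wderiv_split addr0.
  apply: le_trans (hstar Js F beta [::] b0 hF) _.
  by rewrite !big_ord1 mul1r.
apply: (@le_trans _ _ (\sum_(i <- Js (mu + momw (k :: w))) om i * modulus (star mom J mu X (lquot
  (F i)) (k :: w))
   + \sum_(i <- Js (mom k + (mu + momw w))) om i * modulus (wderiv mom J mu X (lquot (F i) k)
     w))).
  rewrite momw_cons addrCA -big_split; apply: ler_sum => i _ /=.
  by rewrite -mulrDr ler_wpM2l// modulusD.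
have h1 := hstar Js F beta (k :: w) b0 hF.
have h2 := IH (fun m => Js (mom k + m)) (fun i => lquot (F i) k) (fun n => lwt k * beta n.+1).
rewrite (le_trans (lerD h1 (h2 _ _)))//.
- by move=> n; rewrite mulr_ge0 ?lwt_ge0.
- move=> v; have := hF (k :: v); rewrite momw_cons wt_cons /=.
  by rewrite mulrCA mulrA.
- rewrite wt_cons !mulr_suml [X in _ + X](_ : _ = \sum_(p < (size w).+2) (((size w).+1 - p)%:R
      * (c p * beta ((size w).+1 - p).+1)) * (lwt k * wt w)); last first.
    rewrite [RHS]big_ord_recr /= subnn mul0r mul0r addr0; apply: eq_bigr => p _.
    rewrite subSn; last by rewrite -ltnS.
    by ring.
  rewrite -big_split /=; apply: ler_sum => p _.
  by rewrite -mulrDl -{1}[c p * _]mul1r -mulrDl -natr1 [1 + _]addrC.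
Qed.

Local Notation wderiv := (wderiv mom J 0).

(** Derivations act on majorants as the one-dimensional vector field [c d/dx]:
    the previous count is the coefficient of [b' c]. *)
Lemma majorant_wderiv (I : Type) (Js : 'rV[int]_d -> seq I) (om : I -> R)
    (X : letter -> seq letter -> R[i]) (F : I -> seq letter -> R[i]) (b c : {poly R}) :
  (forall i, 0 <= om i) -> nonneg_poly b -> nonneg_poly c ->
  majorant J lwt X c -> majorant Js om F b ->
  majorant Js om (fun i => wderiv X (F i)) (b^`() * c).
Proof.
move=> om0 b0 c0 hX hF w.
have hX0 v : \sum_(j <- J (0 + momw v)) lwt j * modulus (X j v) <= c`_(size v) * wt v.
  by rewrite add0r; apply: hX.
have := wderiv_coefficient_bound w om0 c0 b0 hX0 hF; rewrite add0r => /le_trans; apply.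
rewrite ler_wpM2r ?wt_ge0// coefMr; apply: ler_sum => p _.
by rewrite coef_deriv mulrCA mulrC mulr_natl mulrnAl.
Qed.

Lemma nonneg_polyM b c : nonneg_poly b -> nonneg_poly c -> nonneg_poly (b * c).
Proof. by move=> hb hc n; rewrite coefM sumr_ge0// => i _; rewrite mulr_ge0. Qed.

Lemma nonneg_polyD b c : nonneg_poly b -> nonneg_poly c -> nonneg_poly (b + c).
Proof. by move=> hb hc n; rewrite coefD addr_ge0. Qed.

Lemma nonneg_polyZ a b : 0 <= a -> nonneg_poly b -> nonneg_poly (a *: b).
Proof. by move=> ha hb n; rewrite coefZ mulr_ge0. Qed.

Lemma nonneg_deriv b : nonneg_poly b -> nonneg_poly b^`().
Proof. by move=> hb n; rewrite coef_deriv mulrn_wge0. Qed.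

Lemma nonneg_horner b x : 0 <= x -> nonneg_poly b -> 0 <= b.[x].
Proof.
by move=> x0 hb; rewrite horner_coef sumr_ge0// => i _; rewrite mulr_ge0 ?exprn_ge0.
Qed.

Variable rho : R.
Hypothesis rho0 : 0 < rho.

(** For polynomials with nonnegative coefficients a derivative costs only the
    degree over the radius, at the same radius: no shrinking of the domain. *)
Lemma deriv_horner_le b e : nonneg_poly b -> (size b <= e.+1)%N ->
  (b^`()).[rho] <= e%:R / rho * b.[rho].
Proof.
move=> hb sb; rewrite mulrAC ler_pdivlMr// horner_coef mulr_suml.
rewrite (@horner_coef_wide _ e.+1)// mulr_sumr.
have sd : (size b^`() <= e)%N.
  by apply: leq_trans (size_poly _ _) _; move: sb; case: (size b).
apply: (@le_trans _ _ (\sum_(i < e) b^`()`_i * rho ^+ i * rho)).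
  rewrite -(big_mkord xpredT (fun i => b^`()`_i * rho ^+ i * rho)).
  rewrite -[leRHS](big_mkord xpredT (fun i => b^`()`_i * rho ^+ i * rho)).
  rewrite [leRHS](@big_cat_nat _ _ _ (size b^`()))//= lerDl sumr_ge0// => i _.
  by rewrite !mulr_ge0 ?exprn_ge0 ?nonneg_deriv// ltW.
rewrite [leRHS]big_ord_recl /= -[leLHS]add0r lerD//.
  by rewrite !mulr_ge0.
apply: ler_sum => i _; rewrite coef_deriv (_ : bump 0 i = i.+1)//.
rewrite exprSr -mulrA -[b`_i.+1 *+ _]mulr_natl -mulrA ler_wpM2r//.
  by rewrite !mulr_ge0 ?exprn_ge0 ?hb// ltW.
by rewrite ler_nat.
Qed.

(** The size of a family on the ball of radius [rho] is the value of a majorant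
    at [rho]. *)
Definition nbound (I : Type) (Js : 'rV[int]_d -> seq I) (om : I -> R)
    (F : I -> seq letter -> R[i]) (C : R) (e : nat) :=
  exists b, [/\ nonneg_poly b, majorant Js om F b, (size b <= e.+1)%N & b.[rho] <= C].

Section NBound.
Variables (I : Type) (Js : 'rV[int]_d -> seq I) (om : I -> R).
Hypothesis om0 : forall i, 0 <= om i.
Local Notation nb := (nbound Js om).

Lemma nbound_ge0 F C e : nb F C e -> 0 <= C.
Proof. by case=> b [b0 _ _]; apply: le_trans; apply: nonneg_horner => //; apply: ltW. Qed.

Lemma nbound_le F C C' e e' : C <= C' -> (e <= e')%N -> nb F C e -> nb F C' e'.
Proof.
move=> CC ee [b [b0 hb sb Cb]]; exists b; split => //; last exact: le_trans CC.
exact: leq_trans sb _.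
Qed.

Lemma eq_nbound F F' C e : (forall i v, F i v = F' i v) -> nb F C e -> nb F' C e.
Proof.
move=> h [b [b0 hb sb Cb]]; exists b; split => // v.
by apply: le_trans (hb v); apply: ler_sum => i _; rewrite h.
Qed.

Lemma nbound0 e : nb (fun _ _ => 0) 0 e.
Proof.
exists 0; split; rewrite ?horner0 ?size_poly0//; first by move=> n; rewrite coef0.
by move=> v; rewrite coef0 mul0r big1// => i _; rewrite modulus0 mulr0.
Qed.

Lemma nboundD F G C D e : nb F C e -> nb G D e ->
  nb (fun i v => F i v + G i v) (C + D) e.
Proof.
move=> [b [b0 hb sb Cb]] [c [c0 hc sc Dc]]; exists (b + c); split.
- exact: nonneg_polyD.
- move=> v; rewrite coefD mulrDl; apply: le_trans (lerD (hb v) (hc v)).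
  rewrite -big_split; apply: ler_sum => i _ /=.
  by rewrite -mulrDr ler_wpM2l// modulusD.
- by rewrite (leq_trans (size_polyD _ _))// geq_max sb.
- by rewrite hornerD lerD.
Qed.

Lemma nboundZ c F C e : nb F C e -> nb (fun i v => c * F i v) (modulus c * C) e.
Proof.
move=> [b [b0 hb sb Cb]]; exists (modulus c *: b); split.
- exact: nonneg_polyZ (modulus_ge0 _) b0.
- move=> v; rewrite coefZ -mulrA; apply: (@le_trans _ _ (modulus c * \sum_(i <- Js (momw v)) om i
  * modulus (F i v))).
    by rewrite mulr_sumr; apply: ler_sum => i _; rewrite modulusM mulrCA.
  by rewrite ler_wpM2l ?modulus_ge0.
- by rewrite (leq_trans (size_scale_leq _ _)).
- by rewrite hornerZ ler_wpM2l ?modulus_ge0.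
Qed.

Lemma nbound_sum (T : Type) (r : seq T) (F : T -> I -> seq letter -> R[i]) C e :
  (forall t, nb (F t) (C t) e) ->
  nb (fun i v => \sum_(t <- r) F t i v) (\sum_(t <- r) C t) e.
Proof.
move=> h; elim: r => [|t r IH].
  by rewrite big_nil; apply: eq_nbound (nbound0 e) => i v; rewrite big_nil.
rewrite big_cons; apply: eq_nbound (nboundD (h t) IH) => i v.
by rewrite big_cons.
Qed.

Lemma nbound_wderiv X F C D e f :
  nbound J lwt X D f -> nb F C e ->
  nb (fun i => wderiv X (F i)) (e%:R / rho * C * D) (e + f).
Proof.
move=> [c [c0 hc sc Dc]] [b [b0 hb sb Cb]]; exists (b^`() * c); split.
- by apply: nonneg_polyM => //; apply: nonneg_deriv.
- exact: majorant_wderiv.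
- have sd : (size b^`() <= e)%N.
    by apply: leq_trans (size_poly _ _) _; move: sb; case: (size b).
  by apply: leq_trans (size_polyMleq _ _) _; move: sd sc; lia.
- rewrite hornerM ler_pM//; first by apply: nonneg_horner; [apply: ltW|apply: nonneg_deriv].
    by apply: nonneg_horner => //; apply: ltW.
  rewrite (le_trans (deriv_horner_le b0 sb))// ler_wpM2l// divr_ge0//.
  exact: ltW.
Qed.

End NBound.

Lemma nbound_coordinate :
  nbound J lwt (fun j => coordinate R[i] j) rho 1.
Proof.
exists 'X; split; rewrite ?size_polyX ?hornerX//.
  by move=> n; rewrite coefX ler0n.
move=> [|k [|i v]]; rewrite coefX/=.
- rewrite mul0r big1// => j _; rewrite [X in _ * X](_ : _ = 0) ?mulr0//.
  exact: modulus0.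
- rewrite mul1r momw_cons momw_nil addr0 wt_cons wt_nil mulr1.
  rewrite (sum_J_single (@lmom_letters _ _) (@letters_of_uniq _ _) (k := k))//.
    by rewrite /coordinate eqxx modulus1 mulr1.
  move=> j jk; rewrite /coordinate eqseq_cons andbT eq_sym (negbTE jk).
  by rewrite modulus0 mulr0.
- rewrite mul0r big1// => j _; rewrite /coordinate eqseq_cons andbF.
  by rewrite modulus0 mulr0.
Qed.

End Weights.

Lemma lwt0 (R : realType) nonneg d j : @lwt R nonneg d 0 j = 1.
Proof. exact: powRr0. Qed.

Lemma wt0 (R : realType) nonneg d w : @wt R nonneg d 0 w = 1.
Proof. by rewrite /wt big1// => j _; rewrite lwt0. Qed.

(** * Evaluation of power series on the phase space *)

Lemma sum_csum_le (R : realType) (I : eqType) (L : choiceType) (y : I -> L -> R[i])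
    (A : seq I) (B : R) :
  (forall i, asummable (y i)) ->
  (forall K, uniq K -> \sum_(i <- A) \sum_(k <- K) modulus (y i k) <= B) ->
  \sum_(i <- A) modulus (csum (y i)) <= B.
Proof.
move=> sy h; apply/ler_addgt0Pr => e e0.
have c0 : 0 < e / ((size A).+1)%:R by rewrite divr_gt0.
set c := e / _ in c0.
have [K uK hK] : exists2 K, uniq K & forall i K', i \in A -> uniq K' ->
    {subset K <= K'} -> modulus (csum (y i) - \sum_(k <- K') y i k) <= c.
  elim: (A) => [|a A' [K uK hK]]; first by exists [::].
  have [K1 uK1 hK1] := csum_limit (sy a) c0.
  exists (undup (K1 ++ K)); first exact: undup_uniq.
  move=> i K' /predU1P[->|iA] uK' KK'.
    by apply: hK1 => // k kK; apply/KK'/subset_undup_catl.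
  by apply: hK => // k kK; apply/KK'/subset_undup_catr.
apply: (@le_trans _ _ (\sum_(i <- A) (\sum_(k <- K) modulus (y i k) + c))).
  rewrite big_seq [leRHS]big_seq; apply: ler_sum => i iA.
  rewrite -[csum _](subrK (\sum_(k <- K) y i k)) addrC.
  by rewrite (le_trans (modulusD _ _))// lerD ?modulus_sum// hK.
rewrite big_split/= lerD ?h//.
rewrite big_const_seq count_predT iter_addr addr0 -[_ *+ size A]mulr_natr /c -mulrA.
apply: ler_piMr; first exact: ltW.
by rewrite ler_pdivrMl// mulr1 ler_nat.
Qed.

Section Evaluation.
Variables (R : realType) (nonneg : bool) (d : nat) (s : R).
Hypothesis s0 : 0 <= s.
Local Notation letter := (phase_index nonneg d).
Local Notation mom := (@lmom nonneg d).
Local Notation J := (@letters_of nonneg d).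
Local Notation momw := (momw mom).
Local Notation lwt := (@lwt R nonneg d s).
Local Notation wt := (@wt R nonneg d s).
Local Notation array := (seq letter -> R[i]).
Local Notation state := (letter -> R[i]).

(** Values are defined by summing letter by letter, which matches the recursive
    definition of derivations. *)
Fixpoint evd (e : nat) (f : array) (z : state) : R[i] :=
  if e is e'.+1 then f [::] + csum (fun j => z j * evd e' (lquot f j) z) else 0.

Definition deg_lt (f : array) (e : nat) := forall w, (e <= size w)%N -> f w = 0.

(** The degree is chosen by a description operator, so that evaluation is a
    function of the array alone; it is only meaningful for arrays of finite
    degree. *)
Definition ev (f : array) (z : state) : R[i] := evd (xget 0%N [set e | deg_lt f e]) f z.

Definition zbound (z : state) (r : R) := sumle (fun j => lwt j * modulus (z j)) r.

(** A bound uniform in the degree, weaker than a majorant but sufficient for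
    summability. *)
Definition fbound (I : eqType) (om : I -> R) (F : I -> array) (C : R) (e : nat) :=
  [/\ 0 <= C, (forall A, uniq A -> forall w, \sum_(i <- A) om i * modulus (F i w) <= C * wt w)
    & forall i, deg_lt (F i) e].

Definition abound (f : array) (C : R) (e : nat) :=
  [/\ 0 <= C, (forall w, modulus (f w) <= C * wt w) & deg_lt f e].

Definition geom (e : nat) (r : R) : R := \sum_(l < e) r ^+ l.

Lemma geom_ge0 e r : 0 <= r -> 0 <= geom e r.
Proof. by move=> r0; rewrite sumr_ge0// => i _; rewrite exprn_ge0. Qed.

Lemma geomS e r : geom e.+1 r = 1 + r * geom e r.
Proof.
rewrite /geom big_ord_recl expr0 mulr_sumr; congr (_ + _).
by apply: eq_bigr => i _; rewrite -exprS.
Qed.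

Lemma zbound_ge0 z r : zbound z r -> 0 <= r.
Proof. exact: sumle_ge0. Qed.

Lemma lquot_abound f C e k : abound f C e.+1 -> abound (lquot f k) (lwt k * C) e.
Proof.
move=> [C0 hf df]; split; first by rewrite mulr_ge0 ?lwt_ge0.
  by move=> w; rewrite (le_trans (hf _))// wt_cons mulrCA mulrA.
by move=> w ew; apply: df.
Qed.

Lemma abound_weaken f C C' e e' : C <= C' -> (e <= e')%N ->
  abound f C e -> abound f C' e'.
Proof.
move=> CC ee [C0 hf df]; split; first exact: le_trans CC.
  by move=> w; rewrite (le_trans (hf w))// ler_wpM2r ?wt_ge0.
by move=> w ew; apply: df; apply: leq_trans ew.
Qed.

Lemma lquot_abound' f C e k : abound f C e -> abound (lquot f k) (lwt k * C) e.
Proof.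
move=> hf; apply: lquot_abound; exact: abound_weaken hf.
Qed.

Lemma abound0 e : abound (fun=> 0) 0 e.
Proof.
split; [exact: lexx| |by []].
by move=> w; rewrite modulus0 mul0r.
Qed.

Lemma evd0 e z : evd e (fun=> 0) z = 0.
Proof.
elim: e => //= e IH; rewrite csum0 ?addr0// => j.
by rewrite [evd _ _ _]IH mulr0.
Qed.

Lemma evd_le e f C z r :
  (forall w, modulus (f w) <= C * wt w) -> 0 <= C -> zbound z r ->
  modulus (evd e f z) <= C * geom e r.
Proof.
move=> hf C0 hz; have r0 := zbound_ge0 hz.
elim: e f C C0 hf => [|e IH] f C C0 hf /=.
  by rewrite modulus0 mulr_ge0 ?geom_ge0.
rewrite (le_trans (modulusD _ _))// geomS mulrDr mulr1 lerD//.
  by rewrite (le_trans (hf _))// wt_nil mulr1.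
have g0 := geom_ge0 e r0.
apply: csum_le; apply: (@le_sumle _ _ _ (fun j => (C * geom e r) * (lwt j * modulus (z j))) ((C *
  geom e r) * r)).
- move=> j; rewrite modulusM (le_trans (ler_wpM2l (modulus_ge0 _) (IH _ (lwt j * C) _ _)))//.
  + by rewrite mulr_ge0 ?lwt_ge0.
  + by move=> w; rewrite (le_trans (hf _))// wt_cons mulrCA mulrA.
  + by rewrite le_eqVlt; apply/orP; left; apply/eqP; ring.
- by rewrite mulrAC mulrA.
- by apply: sumleZ => //; rewrite mulr_ge0.
Qed.

(** The dual of the weighted l1 norm is a weighted supremum. *)
Lemma asummable_weighted z r (x : state) D : zbound z r -> 0 <= D ->
  (forall j, modulus (x j) <= D * lwt j) ->
  sumle (fun j => modulus (z j * x j)) (D * r).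
Proof.
move=> hz D0 hx; apply: le_sumle (sumleZ D0 hz) => // j.
by rewrite modulusM mulrC (le_trans (ler_wpM2r (modulus_ge0 _) (hx j)))// mulrA.
Qed.

Lemma evd_lquot_le e f C z r k : (forall w, modulus (f w) <= C * wt w) ->
  0 <= C -> zbound z r ->
  modulus (evd e (lquot f k) z) <= (C * geom e r) * lwt k.
Proof.
move=> hf C0 hz; rewrite mulrAC [C * _]mulrC; apply: evd_le => //.
  by move=> w; rewrite (le_trans (hf _))// wt_cons mulrCA mulrA.
by rewrite mulr_ge0 ?lwt_ge0.
Qed.

Lemma asummable_evd e f C z r : (forall w, modulus (f w) <= C * wt w) ->
  0 <= C -> zbound z r -> asummable (fun j => z j * evd e (lquot f j) z).
Proof.
move=> hf C0 hz; exists ((C * geom e r) * r); apply: asummable_weighted => //.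
  by rewrite mulr_ge0 ?geom_ge0 ?(zbound_ge0 hz).
by move=> j; apply: evd_lquot_le.
Qed.

Lemma evd_stable e f z : deg_lt f e -> forall e', (e <= e')%N -> evd e' f z = evd e f z.
Proof.
elim: e f => [|e IH] f df e'.
  by rewrite (_ : f = fun=> 0) ?evd0//; apply/funext => w; apply: df.
case: e' => // e' ee /=; congr (_ + _); apply: eq_csum => j.
by rewrite IH// => w ew; apply: df.
Qed.

Lemma ev_evd f e z : deg_lt f e -> ev f z = evd e f z.
Proof.
move=> df; rewrite /ev; case: xgetP => [e' _ df'|h]; last by have := h e df.
case: (leqP e e') => ee; first by rewrite (evd_stable _ df ee).
by rewrite (evd_stable _ df' (ltnW ee)).
Qed.

Lemma eq_ev f g z : f =1 g -> ev f z = ev g z.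
Proof. by move=> /funext ->. Qed.

Lemma ev0 z : ev (fun=> 0) z = 0.
Proof. by rewrite (@ev_evd _ 0%N). Qed.

Lemma deg_ltW f e e' : (e <= e')%N -> deg_lt f e -> deg_lt f e'.
Proof. by move=> ee h w ew; apply: h; apply: leq_trans ew. Qed.

Lemma deg_lt_lquot f e k : deg_lt f e -> deg_lt (lquot f k) e.
Proof. by move=> h w ew; apply: h => /=; apply: leqW. Qed.

Lemma ev_rec f e z : deg_lt f e ->
  ev f z = f [::] + csum (fun j => z j * ev (lquot f j) z).
Proof.
move=> df; rewrite (@ev_evd f e.+1); last exact: deg_ltW (leqnSn e) df.
rewrite /=; congr (_ + _).
by apply: eq_csum => j; rewrite (@ev_evd _ e)//; apply: deg_lt_lquot.
Qed.

Lemma ev_le f C e z r : abound f C e -> zbound z r ->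
  modulus (ev f z) <= C * geom e r.
Proof. by move=> [C0 hf df] hz; rewrite (@ev_evd f e)//; apply: evd_le. Qed.

Lemma ev_lquot_le f C e z r k : abound f C e -> zbound z r ->
  modulus (ev (lquot f k) z) <= (C * geom e r) * lwt k.
Proof.
move=> [C0 hf df] hz; rewrite (@ev_evd _ e); last exact: deg_lt_lquot.
exact: evd_lquot_le.
Qed.

Lemma sumle_ev_lquot f C e z r : abound f C e -> zbound z r ->
  sumle (fun j => modulus (z j * ev (lquot f j) z)) ((C * geom e r) * r).
Proof.
move=> hf hz; have [C0 _ _] := hf; apply: asummable_weighted => //.
  by rewrite mulr_ge0 ?geom_ge0 ?(zbound_ge0 hz).
by move=> j; apply: ev_lquot_le.
Qed.

Lemma asummable_ev f C e z r : abound f C e -> zbound z r ->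
  asummable (fun j => z j * ev (lquot f j) z).
Proof. by move=> hf hz; eexists; apply: sumle_ev_lquot hf hz. Qed.

Lemma aboundD f g C D e : abound f C e -> abound g D e ->
  abound (fun w => f w + g w) (C + D) e.
Proof.
move=> [C0 hf df] [D0 hg dg]; split; first by rewrite addr_ge0.
  by move=> w; rewrite mulrDl (le_trans (modulusD _ _))// lerD.
by move=> w ew; rewrite df// dg// addr0.
Qed.

Lemma aboundZ c f C e : abound f C e -> abound (fun w => c * f w) (modulus c * C) e.
Proof.
move=> [C0 hf df]; split; first by rewrite mulr_ge0 ?modulus_ge0.
  by move=> w; rewrite modulusM -mulrA ler_wpM2l ?modulus_ge0.
by move=> w ew; rewrite df// mulr0.
Qed.

Lemma evD f g C D e z r : abound f C e -> abound g D e -> zbound z r ->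
  ev (fun w => f w + g w) z = ev f z + ev g z.
Proof.
elim: e f g C D => [|e IH] f g C D hf hg hz.
  have [_ _ df] := hf; have [_ _ dg] := hg; have [_ _ dfg] := aboundD hf hg.
  by rewrite !(@ev_evd _ 0%N)//= addr0.
have [_ _ df] := hf; have [_ _ dg] := hg; have [_ _ dfg] := aboundD hf hg.
rewrite !(@ev_rec _ e.+1)// addrACA.
rewrite -csumD; [|exact: asummable_ev hf hz|exact: asummable_ev hg hz].
congr (_ + _); apply: eq_csum => j; rewrite -mulrDr.
by rewrite -(IH _ _ (lwt j * C) (lwt j * D))//; apply: lquot_abound.
Qed.

Lemma evZ c f C e z r : abound f C e -> zbound z r ->
  ev (fun w => c * f w) z = c * ev f z.
Proof.
elim: e f C => [|e IH] f C hf hz.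
  have [_ _ df] := hf; have [_ _ dcf] := aboundZ c hf.
  by rewrite !(@ev_evd _ 0%N)//= mulr0.
have [_ _ df] := hf; have [_ _ dcf] := aboundZ c hf.
rewrite !(@ev_rec _ e.+1)// mulrDr -csumZ; last exact: asummable_ev hf hz.
congr (_ + _); apply: eq_csum => j; rewrite mulrCA.
by rewrite -(IH _ (lwt j * C))//; apply: lquot_abound.
Qed.

Lemma abound_sum (T : Type) (l : seq T) (F : T -> array) (C : T -> R) e :
  (forall t, abound (F t) (C t) e) ->
  abound (fun w => \sum_(t <- l) F t w) (\sum_(t <- l) C t) e.
Proof.
move=> h; elim: l => [|t l IH].
  rewrite big_nil (_ : (fun w => _) = fun=> 0); first exact: abound0.
  by apply/funext => w; rewrite big_nil.
rewrite big_cons (_ : (fun w => _) = fun w => F t w + \sum_(t <- l) F t w).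
  exact: aboundD.
by apply/funext => w; rewrite big_cons.
Qed.

Lemma ev_sum (T : Type) (l : seq T) (F : T -> array) (C : T -> R) e z r :
  (forall t, abound (F t) (C t) e) -> zbound z r ->
  ev (fun w => \sum_(t <- l) F t w) z = \sum_(t <- l) ev (F t) z.
Proof.
move=> h hz; elim: l => [|t l IH].
  rewrite [RHS]big_nil; transitivity (ev (fun=> 0) z); last exact: ev0.
  by apply: eq_ev => w; rewrite big_nil.
rewrite big_cons -IH -(evD (h t) (abound_sum l h) hz).
by apply: eq_ev => w; rewrite big_cons.
Qed.

Section Families.
Variables (I : eqType) (om : I -> R).
Hypothesis om0 : forall i, 0 < om i.

Lemma fbound_abound F C e i : fbound om F C e -> abound (F i) (C / om i) e.
Proof.
move=> [C0 hF dF]; split; [by rewrite divr_ge0// ltW| |exact: dF].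
move=> w; have := hF [:: i] isT w; rewrite big_seq1 mulrAC ler_pdivlMr//.
by rewrite mulrC.
Qed.

(** The word of length [l] contributes at most [beta l] times the [l]-th power
    of the norm of [z]: majorants bound values. *)
Lemma evd_family_le e (A : seq I) (F : I -> array) (beta : nat -> R) C z r :
  (forall i w, modulus (F i w) <= C i * wt w) -> (forall i, 0 <= C i) ->
  (forall n, 0 <= beta n) ->
  (forall w, \sum_(i <- A) om i * modulus (F i w) <= beta (size w) * wt w) ->
  zbound z r ->
  \sum_(i <- A) om i * modulus (evd e (F i) z) <= \sum_(l < e) beta l * r ^+ l.
Proof.
move=> + + + + hz; have r0 := zbound_ge0 hz.
elim: e F beta C => [|e IH] F beta C hC C0 b0 hF /=.
  by rewrite big_ord0 big1// => i _; rewrite modulus0 mulr0.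
have sy i : asummable (fun j => (om i)%:C * (z j * evd e (lquot (F i) j) z)).
  by apply: asummableZ; apply: asummable_evd hz; [apply: hC|apply: C0].
rewrite big_ord_recl expr0 mulr1.
apply: (@le_trans _ _ (\sum_(i <- A) om i * modulus (F i [::])
   + \sum_(i <- A) modulus (csum (fun j => (om i)%:C * (z j * evd e (lquot (F i) j) z))))).
  rewrite -big_split; apply: ler_sum => i _ /=; rewrite csumZ; last first.
    by apply: asummable_evd hz; [apply: hC|apply: C0].
  rewrite modulusM modulus_real ger0_norm ?(ltW (om0 i))// -mulrDr.
  by rewrite ler_wpM2l ?modulusD// ltW.
apply: lerD; first by have := hF [::]; rewrite wt_nil mulr1.
apply: sum_csum_le => // K uK; rewrite exchange_big /=.
apply: (@le_trans _ _ (\sum_(k <- K) (\sum_(l < e) beta l.+1 * r ^+ l) * (lwt k * modulus (z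
  k)))).
  apply: ler_sum => k _.
  rewrite (_ : \sum_(i <- A) _ = modulus (z k) * \sum_(i <- A) om i * modulus (evd e (lquot (F i)
    k) z)).
    apply: (@le_trans _ _ (modulus (z k) * \sum_(l < e) (lwt k * beta l.+1) * r ^+ l)).
      rewrite ler_wpM2l ?modulus_ge0//.
      apply: (IH (fun i => lquot (F i) k) (fun n => lwt k * beta n.+1) (fun i => lwt k * C i)).
      - by move=> i w; rewrite (le_trans (hC _ _))// wt_cons mulrCA mulrA.
      - by move=> i; rewrite mulr_ge0 ?lwt_ge0.
      - by move=> n; rewrite mulr_ge0 ?lwt_ge0.
      - by move=> w; have := hF (k :: w); rewrite wt_cons /= mulrCA mulrA.
    rewrite le_eqVlt; apply/orP; left; apply/eqP.
    rewrite mulr_suml mulr_sumr; apply: eq_bigr => l _; ring.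
  rewrite mulr_sumr; apply: eq_bigr => i _.
  by rewrite !modulusM modulus_real ger0_norm ?(ltW (om0 i))//; ring.
rewrite -mulr_sumr [leRHS](_ : _ = (\sum_(l < e) beta l.+1 * r ^+ l) * r).
  by rewrite ler_wpM2l ?hz// sumr_ge0// => l _; rewrite mulr_ge0 ?exprn_ge0.
rewrite mulr_suml; apply: eq_bigr => l _; rewrite (_ : bump 0 l = l.+1)// exprSr; ring.
Qed.

Lemma fbound_ev_le F C e z r : fbound om F C e -> zbound z r ->
  sumle (fun i => om i * modulus (ev (F i) z)) (C * geom e r).
Proof.
move=> hF hz A uA; have [C0 hb dF] := hF.
under eq_bigr => i _ do rewrite (ev_evd _ (dF i)).
rewrite /geom mulr_sumr.
apply: (@evd_family_le e A F (fun=> C) (fun i => C / om i)) => //.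
- by move=> i w; have [] := fbound_abound i hF.
- by move=> i; rewrite divr_ge0// ltW.
- exact: hb.
Qed.

Lemma lquot_fbound F C e k : fbound om F C e.+1 ->
  fbound om (fun i => lquot (F i) k) (lwt k * C) e.
Proof.
move=> [C0 hF dF]; split; first by rewrite mulr_ge0 ?lwt_ge0.
  by move=> A uA w; rewrite (le_trans (hF A uA _))// wt_cons mulrCA mulrA.
by move=> i w ew; apply: dF.
Qed.

(** Replacing the letters of a word one after the other: the first letter
    contributes the difference, the others are treated by induction. *)
Lemma fbound_ev_lipschitz e r : 0 <= r -> exists2 L, 0 <= L &
  forall F C z z' del, fbound om F C e -> zbound z r -> zbound z' r ->
    sumle (fun j => lwt j * modulus (z j - z' j)) del ->
    sumle (fun i => om i * modulus (ev (F i) z - ev (F i) z')) (C * (L * del)).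
Proof.
move=> r0; elim: e => [|e [L L0 IH]].
  exists 0 => // F C z z' del [_ _ dF] _ _ _ A uA; rewrite mul0r mulr0 big1// => i _.
  by rewrite !(ev_evd _ (dF i)) subrr modulus0 mulr0.
have g0 := geom_ge0 e r0.
exists (geom e r + r * L); first by rewrite addr_ge0// mulr_ge0.
move=> F C z z' del hF hz hz' hdel A uA; have [C0 _ dF] := hF.
have del0 := sumle_ge0 hdel.
have hq i k : abound (lquot (F i) k) (lwt k * (C / om i)) e.
  by apply: lquot_abound; apply: fbound_abound.
have hbd y i : zbound y r -> forall k, modulus (ev (lquot (F i) k) y) <= (C / om i * geom e r) *
  lwt k.
  move=> hy k; rewrite mulrAC [_ * lwt k]mulrC; exact: ev_le (hq i k) hy.
have hsum y i : zbound y r -> asummable (fun j => y j * ev (lquot (F i) j) y).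
  by move=> hy; apply: asummable_ev (fbound_abound i hF) hy.
pose y i j := (om i)%:C * ((z j - z' j) * ev (lquot (F i) j) z
     + z' j * (ev (lquot (F i) j) z - ev (lquot (F i) j) z')).
have yE i j : y i j = (om i)%:C * (z j * ev (lquot (F i) j) z - z' j * ev (lquot (F i) j) z').
  by rewrite /y; congr (_ * _); ring.
have sy i : asummable (y i).
  apply: (@asummable_le _ _ _ (fun j => (om i)%:C * (z j * ev (lquot (F i) j) z + (-1) * (z' j *
    ev (lquot (F i) j) z')))).
    by move=> j; rewrite yE mulN1r.
  by apply: asummableZ; apply: asummableD; [|apply: asummableZ]; apply: hsum.
have -> : \sum_(i <- A) om i * modulus (ev (F i) z - ev (F i) z') = \sum_(i <- A) modulus (csum
  (y i)).
  apply: eq_bigr => i _; rewrite !(ev_rec _ (dF i)).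
  rewrite opprD addrACA subrr add0r -csumB; [|exact: hsum|exact: hsum].
  rewrite (eq_csum (yE i)) csumZ.
    by rewrite modulusM modulus_real ger0_norm// ltW.
  apply: (@asummable_le _ _ _ (fun j => z j * ev (lquot (F i) j) z + (-1) * (z' j * ev (lquot (F
    i) j) z'))).
    by move=> j; rewrite mulN1r.
  by apply: asummableD; [|apply: asummableZ]; apply: hsum.
apply: sum_csum_le => // K uK; rewrite exchange_big /=.
apply: (@le_trans _ _ (\sum_(k <- K) ((C * geom e r) * (lwt k * modulus (z k - z' k))
    + (C * (L * del)) * (lwt k * modulus (z' k))))).
  apply: ler_sum => k _.
  apply: (@le_trans _ _ (modulus (z k - z' k) * (\sum_(i <- A) om i * modulus (ev (lquot (F i) k)
    z))
     + modulus (z' k) * (\sum_(i <- A) om i * modulus (ev (lquot (F i) k) z - ev (lquot (F i) k)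
       z')))).
    rewrite !mulr_sumr -big_split; apply: ler_sum => i _ /=.
    rewrite /y modulusM modulus_real ger0_norm ?(ltW (om0 i))//.
    rewrite [X in _ <= X + _]mulrCA [X in _ <= _ + X]mulrCA -mulrDr -!modulusM.
    by rewrite ler_wpM2l ?modulusD// ltW.
  apply: lerD.
    apply: (@le_trans _ _ (modulus (z k - z' k) * (lwt k * C * geom e r))).
      rewrite ler_wpM2l ?modulus_ge0//.
      by apply: (fbound_ev_le (lquot_fbound k hF) hz).
    by rewrite le_eqVlt; apply/orP; left; apply/eqP; ring.
  apply: (@le_trans _ _ (modulus (z' k) * (lwt k * C * (L * del)))).
    rewrite ler_wpM2l ?modulus_ge0//.
    by apply: (IH _ _ _ _ _ (lquot_fbound k hF) hz hz' hdel).
  by rewrite le_eqVlt; apply/orP; left; apply/eqP; ring.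
rewrite big_split -!mulr_sumr /= [leRHS](_ : _ = C * geom e r * del + C * (L * del) * r).
  by apply: lerD; rewrite ler_wpM2l ?mulr_ge0//; [apply: hdel|apply: hz'].
ring.
Qed.

End Families.

End Evaluation.

(** * Products, chain rule and partial derivatives *)

Section Calculus.
Variables (R : realType) (nonneg : bool) (d : nat) (s : R).
Hypothesis s0 : 0 <= s.
Local Notation letter := (phase_index nonneg d).
Local Notation mom := (@lmom nonneg d).
Local Notation J := (@letters_of nonneg d).
Local Notation momw := (momw mom).
Local Notation lwt := (@lwt R nonneg d s).
Local Notation wt := (@wt R nonneg d s).
Local Notation array := (seq letter -> R[i]).
Local Notation state := (letter -> R[i]).
Local Notation fbd := (@fbound R nonneg d s _).
Local Notation abd := (@abound R nonneg d s).
Local Notation zbd := (@zbound R nonneg d s).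
Local Notation zstar := (star mom J).
Local Notation zderiv := (wderiv mom J).
Local Notation zpartial := (partial_word mom J).

(** [Y j] only contains words of the momentum of [j], up to the shift [nu]. *)
Definition msupp (nu : 'rV[int]_d) (Y : letter -> array) :=
  forall j w, Y j w != 0 -> mom j = nu + momw w.

Lemma fbound_unit f C e : abd f C e <-> fbd (fun _ : unit => 1) (fun=> f) C e.
Proof.
split=> [[C0 hf df]|[C0 hf df]]; split => //.
- case=> [|[] [|[] A]]//= _ w; last by rewrite big_seq1 mul1r.
  by rewrite big_nil mulr_ge0 ?wt_ge0.
- by move=> w; have := hf [:: tt] isT w; rewrite big_seq1 mul1r.
- exact: df tt.
Qed.

Lemma sumle_dual (a b : state) B D : sumle (fun j => lwt j * modulus (a j)) B ->
  0 <= D -> (forall j, modulus (b j) <= D * lwt j) ->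
  sumle (fun j => modulus (a j * b j)) (B * D).
Proof. by move=> ha D0 hb; rewrite mulrC; apply: asummable_weighted ha D0 hb. Qed.

Lemma abound_star nu Y g C D e f : fbd lwt Y C e -> 0 <= D ->
  (forall j, abd (g j) (D * lwt j) f) ->
  abd (zstar nu Y g) ((e + f)%:R * (C * D)) (e + f).
Proof.
move=> [C0 hY dY] D0 hg.
have deg0 : deg_lt (zstar nu Y g) (e + f).
  move=> w ew; rewrite /star /conv big1// => -[p plt] _; rewrite big1//= => j _.
  case: (leqP e p) => ep.
    by rewrite dY ?mul0r// size_takel// -ltnS.
  have [_ _ ->] := hg j; rewrite ?mulr0// size_drop; lia.
split => //; first by rewrite !mulr_ge0.
move=> w; case: (leqP (e + f) (size w)) => ew.
  by rewrite deg0// modulus0 !mulr_ge0 ?wt_ge0.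
rewrite (le_trans (modulus_sum _ _ _))//.
apply: (@le_trans _ _ (\sum_(p < (size w).+1) (C * D) * wt w)).
  apply: ler_sum => p _; rewrite (le_trans (modulus_sum _ _ _))//.
  apply: (@le_trans _ _ (\sum_(j <- J (nu + momw (take p w))) (D * wt (drop p w)) * (lwt j *
    modulus (Y j (take p w))))).
    apply: ler_sum => j _; rewrite modulusM mulrC.
    have [_ h _] := hg j; rewrite (le_trans (ler_wpM2r (modulus_ge0 _) (h _)))//.
    by rewrite le_eqVlt; apply/orP; left; apply/eqP; ring.
  rewrite -mulr_sumr (le_trans (ler_wpM2l _ (hY _ (letters_of_uniq _ _) _)))//.
    by rewrite mulr_ge0 ?wt_ge0.
  have -> : wt w = wt (take p w) * wt (drop p w) by rewrite -wt_cat cat_take_drop.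
  by rewrite le_eqVlt; apply/orP; left; apply/eqP; ring.
rewrite sumr_const card_ord -[_ *+ (size w).+1]mulr_natl mulrA ler_wpM2r ?wt_ge0//.
by rewrite ler_wpM2r ?mulr_ge0// ler_nat.
Qed.

Section FamilyDerivative.
Variables (I : eqType) (om : I -> R).
Hypothesis om0 : forall i, 0 < om i.

Lemma fbound_wderiv mu X F C D e f : fbd lwt X D f -> fbd om F C e ->
  fbd om (fun i => zderiv mu X (F i)) ((f * e)%:R * (D * C)) (f + e).
Proof.
move=> [D0 hX dX] [C0 hF dF].
pose c n := if (n < f)%N then D else 0; pose beta n := if (n < e)%N then C else 0.
have key A : uniq A -> forall w, \sum_(i <- A) om i * modulus (zderiv mu X (F i) w)
    <= (\sum_(p < (size w).+1) (size w - p).+1%:R * (c p * beta (size w - p).+1)) * wt w.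
  move=> uA w; apply: (@wderiv_coefficient_bound R nonneg d s s0 I (fun=> A) om mu X F c beta w).
  - by move=> i; apply: ltW.
  - by move=> n; rewrite /c; case: ifP.
  - by move=> n; rewrite /beta; case: ifP.
  - move=> v; rewrite /c; case: ltnP => fv; first exact: hX (letters_of_uniq _ _) v.
    by rewrite mul0r big1// => j _; rewrite dX// modulus0 mulr0.
  - move=> v; rewrite /beta; case: ltnP => fv; first exact: hF.
    by rewrite mul0r big1// => j _; rewrite dF// modulus0 mulr0.
split; first by rewrite !mulr_ge0.
- move=> A uA w; apply: le_trans (key A uA w) _.
  rewrite ler_wpM2r ?wt_ge0//.
  apply: (@le_trans _ _ (\sum_(p < (size w).+1) (if (p < f)%N then e%:R * (D * C) else 0))).
    apply: ler_sum => p _; rewrite /c /beta; case: ltnP => pf; last by rewrite mul0r mulr0.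
    case: ltnP => pe; last by rewrite !mulr0 !mulr_ge0.
    by rewrite ler_wpM2r ?mulr_ge0// ler_nat ltnW.
  have count_lt m : \sum_(p < m) (if (p < f)%N then e%:R * (D * C) else 0)
      = (minn m f)%:R * (e%:R * (D * C)).
    elim: m => [|m IH]; first by rewrite big_ord0 min0n mul0r.
    rewrite big_ord_recr /= IH; case: (boolP (m < f)%N) => mf.
      by rewrite (minn_idPl mf) (minn_idPl (ltnW mf)) -natr1 mulrDl mul1r.
    by rewrite -leqNgt in mf; rewrite addr0 (minn_idPr mf) (minn_idPr (leqW mf)).
  rewrite count_lt natrM -[leRHS]mulrA ler_wpM2r ?mulr_ge0// ler_nat.
  exact: geq_minr.
- move=> i w ew; apply: modulus_eq0; apply/eqP; rewrite eq_le modulus_ge0 andbT.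
  rewrite -(pmulr_rle0 _ (om0 i)).
  have := key [:: i] isT w; rewrite big_seq1 big1 ?mul0r// => -[p plt] _ /=.
  rewrite /c /beta; case: ltnP => pf; last by rewrite mul0r mulr0.
  by case: ltnP => pe; rewrite ?mulr0//; exfalso; move: ew pf pe plt => /=; lia.
Qed.

End FamilyDerivative.

Lemma abound_wderiv mu X f C D e e' : fbd lwt X D e' -> abd f C e ->
  abd (zderiv mu X f) ((e' * e)%:R * (D * C)) (e' + e).
Proof.
by move=> hX /fbound_unit hf; apply/fbound_unit; apply: fbound_wderiv.
Qed.

Lemma fbound_unit_field k : fbd lwt (unit_field _ k) (lwt k) 1.
Proof.
split; first exact: lwt_ge0.
  move=> A uA [|i w]; last first.
    rewrite big1 ?mulr_ge0 ?lwt_ge0 ?wt_ge0// => j _.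
    by rewrite /unit_field andbF modulus0 mulr0.
  rewrite wt_nil mulr1; case: (boolP (k \in A)) => kA.
    rewrite (bigD1_seq k)//= /unit_field !eqxx modulus1 mulr1 big1 ?addr0// => j jk.
    by rewrite (negbTE jk) modulus0 mulr0.
  rewrite big_seq big1 ?lwt_ge0// => j jA.
  by rewrite /unit_field; case: eqP => [jk|_]; [rewrite jk (negbTE kA) in jA|rewrite modulus0
    mulr0].
by move=> j [|i w]//= _; rewrite /unit_field andbF.
Qed.

Lemma abound_partial k f C e : abd f C e ->
  abd (zpartial k f) ((e%:R * C) * lwt k) e.+1.
Proof.
move=> hf; have := abound_wderiv (mom k) (fbound_unit_field k) hf.
by rewrite mul1n [lwt k * C]mulrC mulrA.
Qed.

Lemma fbound_partial k (I : eqType) (om : I -> R) F C e : (forall i, 0 < om i) ->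
  fbd om F C e ->
  fbd om (fun i => zpartial k (F i)) ((e%:R * C) * lwt k) e.+1.
Proof.
move=> om0 hF; have := fbound_wderiv om0 (mom k) (fbound_unit_field k) hF.
by rewrite mul1n [lwt k * C]mulrC mulrA.
Qed.

Lemma ev_abound_dual g D f z r : (forall j, abd (g j) (D * lwt j) f) ->
  zbd z r -> forall j, modulus (ev (g j) z) <= (D * geom f r) * lwt j.
Proof. by move=> hg hz j; rewrite mulrAC; exact: (ev_le s0 (hg j) hz). Qed.

Lemma lquot_star nu (Y g : letter -> array) k w : lquot (zstar nu Y g) k w
  = \sum_(j <- J nu) Y j [::] * g j (k :: w)
    + zstar (nu + mom k) (fun j => lquot (Y j) k) g w.
Proof.
rewrite /lquot /star conv_cons momw_nil addr0; congr (_ + _).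
by apply: eq_conv => u x _; rewrite momw_cons addrA.
Qed.

(** Products of values are sums over pairs of words; regrouping them by the
    concatenated word is Fubini, and the support condition [msupp] makes the
    restriction to the letters of [J] harmless. *)
Lemma ev_star nu Y g C D e f z r : fbd lwt Y C e -> 0 <= D ->
  (forall j, abd (g j) (D * lwt j) f) -> msupp nu Y -> zbd z r ->
  ev (zstar nu Y g) z = csum (fun j => ev (Y j) z * ev (g j) z).
Proof.
move=> + D0 hg + hz; have hgz := ev_abound_dual hg hz.
have r0 := zbound_ge0 hz.
have E0 : 0 <= D * geom f r by rewrite mulr_ge0 ?geom_ge0.
elim: e nu Y C => [|e IH] nu Y C hY mY.
  have [C0 _ dY] := hY.
  have Y0 j w : Y j w = 0 by apply: dY.
  rewrite csum0 => [|j]; last by rewrite (ev_evd _ (dY j)) /= mul0r.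
  rewrite -[RHS](ev0 z); apply: eq_ev => w.
  by rewrite /star /conv big1// => p _; rewrite big1// => j _; rewrite Y0 mul0r.
have [C0 hYb dY] := hY; have [_ _ dg] := abound_star nu hY D0 hg.
have dgj j : deg_lt (g j) f by case: (hg j).
have hq k := lquot_fbound s0 k hY.
have mq k : msupp (nu + mom k) (fun j => lquot (Y j) k).
  by move=> j w /mY ->; rewrite momw_cons addrA.
rewrite (ev_rec _ dg).
have evq k : ev (lquot (zstar nu Y g) k) z
    = \sum_(j <- J nu) Y j [::] * ev (lquot (g j) k) z
      + csum (fun j => ev (lquot (Y j) k) z * ev (g j) z).
  rewrite -(IH _ _ _ (hq k) (mq k)).
  have hs j : abd (fun w => Y j [::] * lquot (g j) k w) _ (e + f) :=
    aboundZ (Y j [::]) (abound_weaken s0 (lexx _) (leq_addl _ _) (lquot_abound' s0 k (hg j))).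
  rewrite -(@eq_ev _ _ _ (fun w => \sum_(j <- J nu) Y j [::] * lquot (g j) k w
     + zstar (nu + mom k) (fun j => lquot (Y j) k) g w)); last first.
    by move=> w; rewrite lquot_star.
  rewrite (evD s0 (abound_sum _ hs) (abound_star _ (hq k) D0 hg) hz).
  congr (_ + _); rewrite (ev_sum s0 _ hs hz); apply: eq_bigr => j _.
  by rewrite (evZ s0 _ (lquot_abound' s0 k (hg j)) hz).
have sgj j : asummable (fun k => z k * ev (lquot (g j) k) z).
  exact: (asummable_ev s0 (hg j) hz).
have sw2 : sumle2 (fun k j => z k * (ev (lquot (Y j) k) z * ev (g j) z))
    ((C * geom e r * (D * geom f r)) * r).
  apply: (sumle2_prod (f := fun k => (C * geom e r * (D * geom f r)) * (lwt k * modulus (z k)))).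
    move=> k A uA; under eq_bigr => j _ do rewrite modulusM.
    rewrite -mulr_sumr.
    have := sumle_dual (fbound_ev_le s0 (lwt_gt0 s0) (hq k) hz) E0 hgz uA.
    move=> /(ler_wpM2l (modulus_ge0 (z k))) /le_trans; apply.
    by rewrite le_eqVlt; apply/orP; left; apply/eqP; ring.
  by apply: sumleZ => //; rewrite !mulr_ge0 ?geom_ge0.
rewrite (eq_csum (y := fun k => \sum_(j <- J nu) Y j [::] * (z k * ev (lquot (g j) k) z)
   + csum (fun j => z k * (ev (lquot (Y j) k) z * ev (g j) z)))); last first.
  move=> k; rewrite evq mulrDr; congr (_ + _).
    by rewrite mulr_sumr; apply: eq_bigr => j _; rewrite mulrCA.
  rewrite csumZ//; eexists.
  exact: sumle_dual (fbound_ev_le s0 (lwt_gt0 s0) (hq k) hz) E0 hgz.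
rewrite csumD; [|by apply: asummable_sum => j; apply: asummableZ|exact: asummable_csum sw2].
rewrite csum_sum; last by move=> j; apply: asummableZ.
have -> : zstar nu Y g [::] = \sum_(j <- J nu) Y j [::] * g j [::].
  by rewrite /star conv_nil momw_nil addr0.
rewrite addrA -big_split /=.
have -> : \sum_(i <- J nu) (Y i [::] * g i [::] + csum (fun k => Y i [::] * (z k * ev (lquot (g
  i) k) z)))
   = csum (fun j => Y j [::] * ev (g j) z).
  rewrite (csum_finite (s := J nu)) ?letters_of_uniq//; last first.
    move=> j; rewrite lmom_letters => jn; case: (eqVneq (Y j [::]) 0) => [->|/mY]; first by
      rewrite mul0r.
    by rewrite momw_nil addr0 => e1; rewrite e1 eqxx in jn.
  by apply: eq_bigr => j _; rewrite csumZ// (ev_rec _ (dgj j)) mulrDr.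
rewrite (csum_swap sw2) -csumD.
- apply: eq_csum => j; rewrite (ev_rec _ (dY j)) mulrDl; congr (_ + _).
  rewrite mulrC -csumZ; last exact: (asummable_ev s0 (fbound_abound (lwt_gt0 s0) j hY) hz).
  by apply: eq_csum => k; rewrite [RHS]mulrC mulrA.
- eexists; apply: (sumle_dual (a := fun j => Y j [::])); last exact: hgz; last exact: E0.
  by move=> A uA; have := hYb A uA [::]; rewrite wt_nil mulr1; apply.
- exact: asummable_csum (sumle2_swap sw2).
Qed.

Lemma lquot_partial j (f : array) k w : lquot (zpartial j f) k w
  = lquot (lquot f j) k w + zpartial j (lquot f k) w.
Proof. by rewrite {1}/lquot (partial_word_cons (@lmom_letters _ _) (@letters_of_uniq _ _)). Qed.

Lemma ev_partial_rec j f C e z r : abd f C e -> zbd z r ->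
  ev (zpartial j f) z = ev (lquot f j) z
    + csum (fun k => z k * ev (zpartial j (lquot f k)) z).
Proof.
move=> hf hz; have hp := abound_partial j hf; have [_ _ dp] := hp.
have hq := lquot_abound' s0 j hf; have [_ _ dq] := hq.
have hpk k := abound_partial j (lquot_abound' s0 k hf).
have spk : asummable (fun k => z k * ev (zpartial j (lquot f k)) z).
  eexists; apply: (asummable_weighted hz (D := (e%:R * C * lwt j) * geom e.+1 r)).
    by have [? _ _] := hf; rewrite !mulr_ge0 ?lwt_ge0 ?geom_ge0 ?(zbound_ge0 hz).
  move=> k; have := ev_le s0 (hpk k) hz => /le_trans; apply.
  by rewrite le_eqVlt; apply/orP; left; apply/eqP; ring.
rewrite (ev_rec _ dp) [X in _ = X + _](ev_rec _ dq) -[RHS]addrA; congr (_ + _).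
  by rewrite (partial_word_nil (@lmom_letters _ _) (@letters_of_uniq _ _)).
rewrite -csumD//; last exact: (asummable_ev s0 hq hz).
apply: eq_csum => k; rewrite -mulrDr; congr (_ * _).
rewrite (eq_ev _ (lquot_partial j f k)).
have hqk := abound_weaken s0 (lexx _) (leqnSn _) (lquot_abound' s0 k hq).
by rewrite (evD s0 hqk (hpk k) hz).
Qed.

(** Chain rule.  Splitting off the first letter of the words of [f] turns the
    recursive definition of the derivation into the product rule for
    [z_j * ev (lquot f j)], and Fubini collects the partial derivatives. *)
Lemma ev_wderiv mu X f C D e e' z r : fbd lwt X D e' -> msupp mu X ->
  abd f C e -> zbd z r ->
  ev (zderiv mu X f) z = csum (fun j => ev (X j) z * ev (zpartial j f) z).
Proof.
move=> hX mX + hz; have r0 := zbound_ge0 hz.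
elim: e f C => [|e IH] f C hf; have [C0 hfb df] := hf.
  have f0 : f = fun=> 0 by apply/funext => w; apply: df.
  rewrite csum0 => [|j]; first by rewrite -[RHS](ev0 z); apply: eq_ev => w; rewrite f0 wderiv0.
  rewrite [X in _ * X](_ : _ = 0) ?mulr0// -[RHS](ev0 z); apply: eq_ev => w.
  by rewrite f0 /partial_word wderiv0.
have [D0 _ _] := hX.
have hg j : abd (lquot f j) (C * lwt j) e by rewrite mulrC; apply: lquot_abound.
have hst := abound_star mu hX C0 hg.
have hD := abound_wderiv mu hX hf.
pose h w := if w is k :: w' then zderiv mu X (lquot f k) w' else 0.
have hE w : zderiv mu X f w = zstar mu X (lquot f) w + h w by rewrite wderiv_split.
have [Ch [eh hh]] : exists Ch eh, abd h Ch eh.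
  exists ((e' * e.+1)%:R * (D * C) + modulus (-1) * ((e' + e)%:R * (D * C))), (e' + e.+1)%N.
  rewrite (_ : h = fun w => zderiv mu X f w + (-1) * zstar mu X (lquot f) w).
    apply: aboundD; [exact: hD|apply: aboundZ].
    by apply: abound_weaken hst; rewrite ?lexx ?leq_add2l.
  by apply/funext => w; rewrite hE mulN1r addrAC subrr add0r.
have [_ _ dh] := hh.
rewrite [LHS](_ : _ = ev (fun w => zstar mu X (lquot f) w + h w) z); last exact: eq_ev.
rewrite (evD s0 (e := (e' + e + eh)%N) (abound_weaken s0 (lexx _) (leq_addr _ _) hst)
   (abound_weaken s0 (lexx _) (leq_addl _ _) hh) hz).
rewrite (ev_star hX C0 hg mX hz) (ev_rec _ dh) add0r.
have sw2 : sumle2 (fun k j => z k * (ev (X j) z * ev (zpartial j (lquot f k)) z))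
    ((D * geom e' r * (e%:R * C * geom e.+1 r)) * r).
  apply: (sumle2_prod (f := fun k => (D * geom e' r * (e%:R * C * geom e.+1 r)) * (lwt k *
    modulus (z k)))).
    move=> k A uA; under eq_bigr => j _ do rewrite modulusM.
    rewrite -mulr_sumr.
    have hb j : modulus (ev (zpartial j (lquot f k)) z) <= (e%:R * C * geom e.+1 r * lwt k) * lwt
      j.
      have := ev_le s0 (abound_partial j (lquot_abound s0 k hf)) hz => /le_trans; apply.
      by rewrite le_eqVlt; apply/orP; left; apply/eqP; ring.
    have b0 : 0 <= e%:R * C * geom e.+1 r * lwt k by rewrite !mulr_ge0 ?geom_ge0 ?lwt_ge0.
    have := sumle_dual (fbound_ev_le s0 (lwt_gt0 s0) hX hz) b0 hb uA.
    move=> /(ler_wpM2l (modulus_ge0 (z k))) /le_trans; apply.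
    by rewrite le_eqVlt; apply/orP; left; apply/eqP; ring.
  by apply: sumleZ => //; rewrite !mulr_ge0 ?geom_ge0.
have sk k : asummable (fun j => ev (X j) z * ev (zpartial j (lquot f k)) z).
  eexists; apply: sumle_dual (fbound_ev_le s0 (lwt_gt0 s0) hX hz) _ _; last first.
    move=> j; have := ev_le s0 (abound_partial j (lquot_abound s0 k hf)) hz => /le_trans.
    by apply; rewrite mulrAC.
  by rewrite !mulr_ge0 ?geom_ge0 ?lwt_ge0.
rewrite [X in _ + X = _](eq_csum (y := fun k => csum (fun j => z k * (ev (X j) z * ev (zpartial j
  (lquot f k)) z)))); last first.
  move=> k; rewrite csumZ; last exact: sk.
  by rewrite -(IH _ _ (lquot_abound s0 k hf)).
rewrite (csum_swap sw2) -csumD.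
- apply: eq_csum => j; rewrite (ev_partial_rec j hf hz) mulrDr; congr (_ + _).
  rewrite -csumZ; first by apply: eq_csum => k; rewrite mulrCA.
  eexists; apply: (asummable_weighted hz (D := (e%:R * C * lwt j) * geom e.+1 r)).
    by rewrite !mulr_ge0 ?lwt_ge0 ?geom_ge0.
  move=> k; have := ev_le s0 (abound_partial j (lquot_abound s0 k hf)) hz => /le_trans; apply.
  by rewrite le_eqVlt; apply/orP; left; apply/eqP; ring.
- eexists; apply: sumle_dual (fbound_ev_le s0 (lwt_gt0 s0) hX hz) _ (ev_abound_dual hg hz).
  by rewrite mulr_ge0 ?geom_ge0.
- exact: asummable_csum (sumle2_swap sw2).
Qed.

Definition zshift (z : state) (i : letter) (t : R[i]) : state :=
  fun j => z j + (if j == i then t else 0).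

Lemma zshift_bound z i t r : zbd z r -> modulus t <= 1 ->
  zbd (zshift z i t) (r + lwt i) /\
  sumle (fun j => lwt j * modulus (zshift z i t j - z j)) (modulus t * lwt i).
Proof.
move=> hz t1.
have hd : sumle (fun j => lwt j * modulus (zshift z i t j - z j)) (modulus t * lwt i).
  move=> A uA; case: (boolP (i \in A)) => iA.
    rewrite (bigD1_seq i)//= big1 ?addr0 => [|j ji]; first by rewrite /zshift eqxx addrAC subrr
      add0r mulrC.
    by rewrite /zshift (negbTE ji) addr0 subrr modulus0 mulr0.
  rewrite big_seq big1 ?mulr_ge0 ?modulus_ge0 ?lwt_ge0// => j jA.
  rewrite /zshift; case: eqP => [ji|_]; first by rewrite ji (negbTE iA) in jA.
  by rewrite addr0 subrr modulus0 mulr0.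
split => //; apply: le_sumle (sumleD hz hd).
  move=> j; rewrite -mulrDr ler_wpM2l ?lwt_ge0//.
  by rewrite -{1}[zshift z i t j](subrK (z j)) addrC modulusD.
by rewrite lerD2l ler_piMl// lwt_ge0.
Qed.

(** First-order Taylor expansion in one coordinate, by induction on the degree;
    the induction on the first letter needs the remainder uniform in [f]. *)
Lemma ev_zshift e z r i : zbd z r -> exists2 K, 0 <= K &
  forall f C t, abd f C e -> modulus t <= 1 ->
    modulus (ev f (zshift z i t) - ev f z - t * ev (zpartial i f) z)
      <= C * K * modulus t ^+ 2.
Proof.
move=> hz; have r0 := zbound_ge0 hz.
elim: e => [|e [K K0 IH]].
  exists 0 => // f C t [_ _ df] _; have f0 : f = fun=> 0 by apply/funext => w; apply: df.
  have -> : zpartial i f = fun=> 0.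
    by apply/funext => w; rewrite f0 /partial_word wderiv0.
  by rewrite f0 !ev0 mulr0 !subr0 modulus0 mulr0 mul0r.
have rp : 0 <= r + lwt i by rewrite addr_ge0 ?lwt_ge0.
have [L L0 hL] := @fbound_ev_lipschitz R nonneg d s s0 unit (fun=> 1) (fun=> ltr01) e _ rp.
exists (r * K + lwt i ^+ 2 * L); first by rewrite addr_ge0 ?mulr_ge0 ?exprn_ge0 ?lwt_ge0.
move=> f C t hf t1; have [C0 hfb df] := hf.
have [hz' hd] := zshift_bound i hz t1.
have hzr : zbd z (r + lwt i) by apply: le_sumle hz; rewrite ?lerDl ?lwt_ge0.
have hq j := lquot_abound s0 j hf.
have hpq j := abound_partial i (hq j).
have sz : asummable (fun j => z j * ev (lquot f j) z) by apply: (asummable_ev s0 hf hz).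
have sz' : asummable (fun j => z j * ev (lquot f j) (zshift z i t)).
  eexists; apply: (asummable_weighted hz (D := C * geom e.+1 (r + lwt i))) => [|j];
    last exact: (ev_lquot_le s0 j hf hz').
  by rewrite mulr_ge0 ?geom_ge0.
have sp : asummable (fun j => z j * ev (zpartial i (lquot f j)) z).
  eexists; apply: (asummable_weighted hz (D := (e%:R * C * lwt i) * geom e.+1 r)).
    by rewrite !mulr_ge0 ?lwt_ge0 ?geom_ge0.
  move=> k; have := ev_le s0 (hpq k) hz => /le_trans; apply.
  by rewrite le_eqVlt; apply/orP; left; apply/eqP; ring.
have -> : ev f (zshift z i t) - ev f z - t * ev (zpartial i f) z
  = csum (fun j => z j * (ev (lquot f j) (zshift z i t) - ev (lquot f j) z
        - t * ev (zpartial i (lquot f j)) z))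
    + t * (ev (lquot f i) (zshift z i t) - ev (lquot f i) z).
  rewrite (ev_partial_rec i hf hz) (ev_rec _ df) (ev_rec z df).
  have -> : csum (fun j => zshift z i t j * ev (lquot f j) (zshift z i t))
      = csum (fun j => z j * ev (lquot f j) (zshift z i t)) + t * ev (lquot f i) (zshift z i t).
    have single : csum (fun j => (if j == i then t else 0) * ev (lquot f j) (zshift z i t))
        = t * ev (lquot f i) (zshift z i t).
      rewrite (csum_single (i0 := i)) ?eqxx// => j /negbTE ->; exact: mul0r.
    rewrite -single -csumD//.
      by apply: eq_csum => j; rewrite -mulrDl.
    exists (modulus (t * ev (lquot f i) (zshift z i t))) => A uA.
    case: (boolP (i \in A)) => iA.
      rewrite (bigD1_seq i)//= eqxx big1 ?addr0// => j /negbTE ->.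
      by rewrite mul0r modulus0.
    rewrite big_seq big1 ?modulus_ge0// => j jA.
    case: eqP => [ji|_]; first by rewrite ji (negbTE iA) in jA.
    by rewrite mul0r modulus0.
  rewrite [X in _ = X + _](eq_csum (y := fun j => z j * ev (lquot f j) (zshift z i t) - z j * ev
    (lquot f j) z
      - t * (z j * ev (zpartial i (lquot f j)) z))); last first.
    by move=> j; rewrite !mulrBr [z j * (t * _)]mulrCA.
  have sB : asummable (fun j => z j * ev (lquot f j) (zshift z i t) - z j * ev (lquot f j) z).
    apply: (@asummable_le _ _ _ (fun j => z j * ev (lquot f j) (zshift z i t) + (-1) * (z j * ev
      (lquot f j) z))).
      by move=> j; rewrite mulN1r.
    by apply: asummableD => //; apply: asummableZ.
  rewrite csumB//; last exact: asummableZ.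
  rewrite csumB// csumZ//; ring.
rewrite (le_trans (modulusD _ _))// [C * _](_ : _ = C * K * r + C * lwt i ^+ 2 * L); last by ring.
rewrite mulrDl lerD//.
  apply: csum_le; rewrite mulrAC; apply: (asummable_weighted hz).
    by rewrite !mulr_ge0 ?exprn_ge0 ?modulus_ge0.
  move=> j; have := IH _ _ t (hq j) t1 => /le_trans; apply.
  by rewrite le_eqVlt; apply/orP; left; apply/eqP; ring.
rewrite modulusM (_ : C * lwt i ^+ 2 * L * modulus t ^+ 2 = modulus t * ((lwt i * C) * (L *
  (modulus t * lwt i)))); last by ring.
rewrite ler_wpM2l ?modulus_ge0//.
have /fbound_unit hu := hq i.
by have := hL _ _ _ _ _ hu hz' hzr hd => /(_ [:: tt] isT); rewrite big_seq1 mul1r.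
Qed.

(** The derivative in one complex coordinate is computed on coefficients: this
    is the link between the analytic definition of the Hamiltonian field and the
    algebra of arrays. *)
Lemma partial_ev H f C e z r i : abd f C e -> zbd z r ->
  (forall z' r', zbd z' r' -> H z' = ev f z') ->
  partial H i z = ev (zpartial i f) z.
Proof.
move=> hf hz hH; have [K K0 hK] := ev_zshift e i hz; have [C0 _ _] := hf.
have r0 := zbound_ge0 hz.
rewrite /partial derive1E /derive.
apply: (@cvg_lim (R[i]^o : normedModType R[i])).
  exact: (@norm_hausdorff R[i] (R[i]^o)).
apply/(@cvgrPdist_le R[i] (R[i]^o)) => eps eps0.
have [q [q0 qe]] : exists q : R, 0 < q /\ q%:C = eps.
  exists (complex.Re eps); move: (eps0); rewrite ltcE/= => /andP[/eqP im re]; split => //.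
  by move: im re; case: eps {eps0} => a b /= ->.
have CK0 : 0 < C * K + 1 by rewrite ltr_wpDl ?mulr_ge0.
near=> t.
have tN : t != 0 by near: t; exact: nbhs_dnbhs_neq.
have tsmall : `|t| < (Num.min 1 (q / (C * K + 1)))%:C.
  near: t; apply: dnbhs0_lt; rewrite (_ : 0 = 0%:C)// ltcR lt_min ltr01/=.
  exact: divr_gt0.
move: tsmall; rewrite modulus_norm ltcR lt_min => /andP[t1 tq].
have hzt : zbd (zshift z i t) (r + lwt i) by case: (zshift_bound i hz (ltW t1)).
rewrite -qe [X in X <= _](modulus_norm _) lecR.
have -> : H (fun j' => z j' + (if j' == i then 0 else 0)) = ev f z.
  rewrite (_ : (fun j' => _) = z); first exact: hH hz.
  by apply/funext => j; case: ifP; rewrite addr0.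
rewrite [X in modulus (_ - _ *: (X - _))](_ : _ = ev f (zshift z i t)); last first.
  rewrite -(hH _ _ hzt) /=; congr H; apply/funext => j.
  by rewrite /zshift addr0 [t%:A]mulr1.
have := hK f C t hf (ltW t1).
set U := _ - ev f z; set P := ev _ z => hU.
have -> : P - t^-1 *: (U : R[i]^o) = - t^-1 * (U - t * P).
  have flip (a b c u : R[i]) : b * c = 1 -> a - b * u = - b * (u - c * a).
    by move=> bc; rewrite mulrBr [_ * (c * a)]mulrA !mulNr bc mul1r opprK addrC.
  by apply: (flip P t^-1 t U); rewrite mulVf.
rewrite modulusM modulusN modulusV.
have t0 : 0 < modulus t by rewrite lt_neqAle modulus_ge0 andbT eq_sym; apply/eqP => /modulus_eq0
  /eqP; exact/negP.
rewrite ler_pdivrMl//; apply: (le_trans hU).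
rewrite expr2 mulrA mulrC ler_pM2l//.
have h2 : (C * K + 1) * modulus t <= q by rewrite mulrC -ler_pdivlMr// ltW.
rewrite (le_trans _ h2)// ler_pM2r// lerDl//.
Unshelve. all: by end_near.
Qed.

End Calculus.

(** * The weighted norm and uniqueness of flows *)

(** Compare [phi] with small multiples of an exponential of slope larger than
    [L]: at the supremum of the times up to which [phi] stays below, the local
    condition allows one to go further. *)
Lemma gronwall_zero (R : realType) (phi : R -> R) (T L : R) : 0 <= T -> 0 <= L ->
  (forall x, 0 <= phi x) -> phi 0 = 0 ->
  (forall tau, 0 <= tau <= T -> forall e, 0 < e -> \forall x \near tau,
    0 <= x <= T -> `|phi x - phi tau| <= (L * phi tau + e) * `|x - tau|) ->
  forall x, 0 <= x <= T -> phi x = 0.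
Proof.
move=> T0 L0 p0 phi0 h.
pose E x := expR ((L + 1) * x).
have E0 x : 0 < E x by apply: expR_gt0.
have L1 : 0 < L + 1 by rewrite ltr_wpDl.
have Emono x y : x <= y -> E x <= E y by move=> xy; rewrite ler_expR ler_pM2l.
suff main eps : 0 < eps -> forall x, 0 <= x <= T -> phi x <= eps * E x.
  move=> x xT; apply/eqP; rewrite eq_le p0 andbT; apply/ler_addgt0Pr => e e0.
  rewrite add0r (le_trans (main (e / E x) _ x xT)) ?divr_gt0//.
  by rewrite divfK// gt_eqF.
move=> eps0.
pose S := [set t | 0 <= t <= T /\ forall x, 0 <= x <= t -> phi x <= eps * E x].
have Sa : S 0.
  split; first by rewrite lexx.
  move=> x /andP[ax xa]; have -> : x = 0 by apply/eqP; rewrite eq_le ax xa.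
  by rewrite phi0 mulr_ge0// ltW.
have hS : has_sup S.
  by split; [exists 0|exists T => t [/andP[_ tb] _]].
set g := sup S.
have ag : 0 <= g by apply: ub_le_sup => //; case: hS.
have gb : g <= T by apply: sup_le_ub => [|t [/andP[]]//]; exists 0.
have near_g e : 0 < e -> exists2 r, 0 < r & forall x, `|x - g| < r -> 0 <= x <= T ->
    `|phi x - phi g| <= (L * phi g + e) * `|x - g|.
  move=> e1; have /nbhs_ballP[r /= r0 hr] := h g (introT andP (conj ag gb)) e e1.
  by exists r => // x xr xab; apply: hr => //; rewrite /ball /= distrC.
have below x : 0 <= x < g -> phi x <= eps * E x.
  move=> /andP[ax xg]; have gx0 : 0 < g - x by rewrite subr_gt0.
  have [t [_ St] xt] := sup_adherent gx0 hS.
  by apply: St; rewrite ax ltW//; move: xt; rewrite -/g opprB addrC subrK.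
have atg : phi g <= eps * E g.
  have [->|gNa] := eqVneq g 0; first by rewrite phi0 mulr_ge0// ltW.
  have ag' : 0 < g by rewrite lt_neqAle eq_sym gNa.
  have [r r0 hr] := near_g 1 ltr01.
  apply/ler_addgt0Pr => e e0.
  have B0 : 0 < L * phi g + 1 by rewrite ltr_wpDl// mulr_ge0.
  pose x := Num.max 0 (g - Num.min (r / 2) (e / (L * phi g + 1))).
  have m0 : 0 < Num.min (r / 2) (e / (L * phi g + 1)) by rewrite lt_min !divr_gt0.
  have xg : x < g by rewrite /x gt_max ag'/= ltrBlDr ltrDl.
  have ax : 0 <= x by rewrite /x le_max lexx.
  have gxm : g - x <= Num.min (r / 2) (e / (L * phi g + 1)).
    by rewrite lerBlDr -lerBlDl /x le_max lexx orbT.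
  have /andP[gxr gxe] : (g - x <= r / 2) && (g - x <= e / (L * phi g + 1)).
    by rewrite -le_min.
  have absE : `|x - g| = g - x by rewrite distrC gtr0_norm// subr_gt0.
  have xr : `|x - g| < r.
    by rewrite absE (le_lt_trans gxr)// ltr_pdivrMr// ltr_pMr// ltr1n.
  have h1 := hr x xr; rewrite ax (le_trans (ltW xg) gb) in h1.
  have h2 : phi x <= eps * E x by apply: below; rewrite ax xg.
  rewrite -(subrK (phi x) (phi g)) addrC lerD//.
    by rewrite (le_trans h2)// ler_pM2l// Emono// ltW.
  rewrite (le_trans (ler_norm _))// distrC (le_trans (h1 isT))// absE.
  by rewrite mulrC -ler_pdivlMr.
move=> z /andP[z0 zT].
have [zg|gz] := ltP z g; first by apply: below; rewrite z0.
have [gEb|gNb] := eqVneq g T.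
  by have -> : z = g by [apply/eqP; rewrite eq_le gz gEb zT]; exact: atg.
have gb' : g < T by rewrite lt_neqAle gNb.
have eE0 : 0 < eps * E g by rewrite mulr_gt0.
have [r r0 hr] := near_g _ eE0.
pose x := Num.min T (g + r / 2).
have gx : g < x by rewrite /x lt_min gb'/= ltrDl divr_gt0.
have xb : x <= T by rewrite /x ge_min lexx.
have Sx : S x.
  split; first by rewrite xb (le_trans ag (ltW gx)).
  move=> y /andP[ay yx]; have [yg|gy] := ltP y g; first by apply: below; rewrite ay.
  have yr : `|y - g| < r.
    rewrite ger0_norm ?subr_ge0// ltrBlDl (le_lt_trans yx)// /x gt_min.
    by apply/orP; right; rewrite ltrD2l ltr_pdivrMr// ltr_pMr// ltr1n.
  have h1 := hr y yr; rewrite ay (le_trans yx xb) in h1.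
  have {}h1 : phi y <= phi g + (L * phi g + eps * E g) * (y - g).
    rewrite -lerBlDl (le_trans (ler_norm _))// (le_trans (h1 isT))//.
    by rewrite ger0_norm// subr_ge0.
  rewrite (le_trans h1)//.
  apply: (@le_trans _ _ (eps * E g * (1 + (L + 1) * (y - g)))).
    have yg0 : 0 <= y - g by rewrite subr_ge0.
    rewrite (_ : eps * E g * _ = eps * E g + (L * (eps * E g) + eps * E g) * (y - g)); last by
      ring.
    by rewrite lerD// ler_wpM2r// lerD2r ler_wpM2l.
  rewrite -mulrA ler_pM2l// (_ : E y = E g * expR ((L + 1) * (y - g))); last first.
    by rewrite /E -expRD; congr expR; ring.
  rewrite ler_pM2l//; exact: expR_ge1Dx.
have : x <= g by apply: ub_le_sup => //; case: hS.
by rewrite leNgt gx.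
Qed.

Section FlowUniqueness.
Variables (R : realType) (nonneg : bool) (d : nat) (s : R).
Hypothesis s0 : 0 <= s.
Local Notation letter := (phase_index nonneg d).
Local Notation lwt := (@lwt R nonneg d s).
Local Notation state := (letter -> R[i]).
Local Notation zbd := (@zbound R nonneg d s).

Lemma l1normP (z : state) B : (l1norm s z <= B%:E)%E <-> zbd z B.
Proof.
rewrite /l1norm /esum; split.
  move=> h A uA; rewrite -lee_fin; apply: le_trans h; apply: ereal_sup_ubound.
  exists [set` A]; first by split; [exact: finite_seq|].
  rewrite -fsbig_seq// sumEFin//.
move=> h; apply: ub_ereal_sup => _ [A [fA _] <-].
rewrite fsbig_finite//= sumEFin lee_fin.
by rewrite -[X in X <= _]/(\sum_(i <- fset_set A) lwt i * modulus (z i)); apply: h; exact: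
  fset_uniq.
Qed.

Lemma l1P (z : state) : l1 s z <-> exists B, zbd z B.
Proof.
rewrite /l1 /=; split=> [h|[B /l1normP h]]; last exact: le_lt_trans h (ltry _).
exists (fine (l1norm s z)); apply/l1normP; rewrite fineK// ge0_fin_numE//.
by apply: esum_ge0 => j _; rewrite lee_fin mulr_ge0 ?powR_ge0 ?modulus_ge0.
Qed.

(** The norm as a real number, meaningful on [l1 s]. *)
Definition nrm (z : state) : R := fine (l1norm s z).

Lemma nrm_zbound z B : zbd z B -> zbd z (nrm z) /\ nrm z <= B.
Proof.
move=> /l1normP h.
have h0 : (0 <= l1norm s z)%E.
  by apply: esum_ge0 => j _; rewrite lee_fin mulr_ge0 ?powR_ge0 ?modulus_ge0.
have hf : l1norm s z \is a fin_num by rewrite ge0_fin_numE// (le_lt_trans h)// ltry.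
by split; [apply/l1normP; rewrite fineK|rewrite -lee_fin fineK].
Qed.

Lemma nrm_ge0 z : 0 <= nrm z.
Proof.
apply: fine_ge0; apply: esum_ge0 => j _.
by rewrite lee_fin mulr_ge0 ?powR_ge0 ?modulus_ge0.
Qed.

Lemma nrm_le z B : zbd z B -> nrm z <= B.
Proof. by case/nrm_zbound. Qed.

Lemma zboundD z z' B B' : zbd z B -> zbd z' B' -> zbd (fun j => z j + z' j) (B + B').
Proof.
move=> h h'; apply: le_sumle (sumleD h h') => // j.
by rewrite -mulrDr ler_wpM2l ?lwt_ge0// modulusD.
Qed.

Lemma zboundZ c z B : zbd z B -> zbd (fun j => c * z j) (modulus c * B).
Proof.
move=> h; apply: le_sumle (sumleZ (modulus_ge0 c) h) => // j.
by rewrite modulusM mulrCA.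
Qed.

Lemma eq_zbound z z' B : z =1 z' -> zbd z B -> zbd z' B.
Proof. by move=> /funext ->. Qed.

Lemma zboundB z z' B B' : zbd z B -> zbd z' B' -> zbd (fun j => z j - z' j) (B + B').
Proof.
move=> h h'; rewrite -[B']mul1r -[1]modulus1 -modulusN.
by apply: eq_zbound (zboundD h (zboundZ (-1) h')) => j; rewrite mulN1r.
Qed.

Lemma zbound_zero z : zbd z 0 -> forall j, z j = 0.
Proof.
move=> h j; apply: modulus_eq0; apply/eqP; rewrite eq_le modulus_ge0 andbT.
by rewrite -(pmulr_rle0 _ (lwt_gt0 s0 j)); have := h [:: j] isT; rewrite big_seq1.
Qed.

Lemma nrm_dist z z' B B' : zbd z B -> zbd z' B' ->
  `|nrm z - nrm z'| <= nrm (fun j => z j - z' j).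
Proof.
have half y y' C C' : zbd y C -> zbd y' C' -> nrm y - nrm y' <= nrm (fun j => y j - y' j).
  move=> hy hy'; rewrite lerBlDr.
  have [hy1 _] := nrm_zbound hy'; have [hy2 _] := nrm_zbound (zboundB hy hy').
  apply: nrm_le; apply: eq_zbound (zboundD hy2 hy1) => j; exact: subrK.
move=> hz hz'; rewrite ler_norml (half _ _ _ _ hz hz') andbT lerNl opprB.
rewrite (le_trans (half _ _ _ _ hz' hz))//.
have [h _] := nrm_zbound (zboundB hz hz').
apply: nrm_le; apply: le_sumle h => // j; by rewrite modulus_distC.
Qed.

Let increment_split (a b c p X Y k : R[i]) :
  (a - b - k * X) - (c - p - k * Y) + k * (X - Y) = (a - c) - (b - p).
Proof. by ring. Qed.

(** The norm of the difference of two solutions satisfies the local growth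
    condition of Gronwall's inequality, both curves being bounded on the time
    interval by continuity. *)
Lemma solves_unique (H : state -> R[i]) (T : R) z u v : 0 <= T ->
  (forall r, 0 <= r -> exists2 L, 0 <= L & forall y y' del, zbd y r -> zbd y' r ->
     zbd (fun j => y j - y' j) del ->
     zbd (fun j => vector_field H y j - vector_field H y' j) (L * del)) ->
  solves s H T z u -> solves s H T z v -> forall x, 0 <= x <= T -> u x = v x.
Proof.
move=> T0 lip [u0 hu] [v0 hv].
have l1u t : 0 <= t <= T -> exists B, zbd (u t) B by move=> /hu[/l1P].
have l1v t : 0 <= t <= T -> exists B, zbd (v t) B by move=> /hv[/l1P].
have bounded (w : R -> state) : solves s H T z w -> exists2 B, 0 <= B & forall t, 0 <= t <= T ->
  zbd (w t) B.
  move=> [w0 hw]; have l1w t : 0 <= t <= T -> exists B, zbd (w t) B by move=> /hw[/l1P].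
  have cw : {within `[0, T], continuous (fun t => nrm (w t))}.
    apply/subspace_continuousP => t; rewrite /= in_itv /= => tT.
    have [_ [/l1P[BX hX] hd]] := hw t tT.
    have [Bt hBt] := l1w t tT; have BX0 := sumle_ge0 hX.
    apply/cvgrPdist_le => e e0.
    have [r r0 hr] : exists2 r, 0 < r & forall x, `|x - t| < r -> 0 <= x <= T ->
        `|nrm (w t) - nrm (w x)| <= (BX + 1) * `|x - t|.
      have /nbhs_ballP[r /= r0 hr] := hd 1 ltr01; exists r => // x xr xT.
      have /l1normP hx : (l1norm s (fun j => (w x j - w t j - (x - t)%:C * vector_field H (w t)
        j)%R)
           <= (1 * `|x - t|)%:E)%E by apply: hr => //; rewrite /ball /= distrC.
      have [Bx hBx] := l1w x xT.
      rewrite distrC (le_trans (nrm_dist hBx hBt))//; apply: nrm_le.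
      rewrite (_ : (BX + 1) * `|x - t| = 1 * `|x - t| + modulus (x - t)%:C * BX).
        by apply: eq_zbound (zboundD hx (zboundZ (x - t)%:C hX)) => j; exact: subrK.
      by rewrite modulus_real; ring.
    have B1 : 0 < BX + 1 by rewrite ltr_wpDl.
    rewrite near_withinE; apply/nbhs_ballP.
    exists (Num.min r (e / (BX + 1))) => /=; first by rewrite lt_min r0 divr_gt0.
    move=> x; rewrite /ball /= distrC lt_min => /andP[xr xe]; rewrite in_itv /= => xT.
    rewrite (le_trans (hr x xr xT))// mulrC -ler_pdivlMr//; exact: ltW.
  have [c _ hc] := EVT_max T0 cw.
  exists (nrm (w c)); first exact: nrm_ge0.
  move=> t tT; have [Bt hBt] := l1w t tT; have [h1 _] := nrm_zbound hBt.
  by apply: le_sumle h1 => //; apply: hc; rewrite in_itv.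
have [Bu Bu0 hBu] := bounded u (conj u0 hu).
have [Bv Bv0 hBv] := bounded v (conj v0 hv).
pose r := Bu + Bv; have r0 : 0 <= r by rewrite addr_ge0.
have hru t : 0 <= t <= T -> zbd (u t) r.
  by move=> /hBu h; apply: le_sumle h => //; rewrite lerDl.
have hrv t : 0 <= t <= T -> zbd (v t) r.
  by move=> /hBv h; apply: le_sumle h => //; rewrite lerDr.
have [L L0 hL] := lip r r0.
pose diff t := fun j => u t j - v t j.
have hdiff t : 0 <= t <= T -> zbd (diff t) (r + r).
  by move=> tT; apply: zboundB; [apply: hru|apply: hrv].
pose phi t := if 0 <= t <= T then nrm (diff t) else 0.
have phi0 : phi 0 = 0.
  rewrite /phi lexx T0 /=; apply/eqP; rewrite eq_le nrm_ge0 andbT; apply: nrm_le => A uA.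
  rewrite big1// => j _; by rewrite /diff u0 v0 subrr modulus0 mulr0.
have phi_ge0 t : 0 <= phi t by rewrite /phi; case: ifP => // _; apply: nrm_ge0.
have zero t : 0 <= t <= T -> phi t = 0.
  apply: (gronwall_zero T0 L0 phi_ge0 phi0) => tau tauT e e0.
  have [_ [_ hdu]] := hu tau tauT; have [_ [_ hdv]] := hv tau tauT.
  have e2 : 0 < e / 2 by rewrite divr_gt0.
  have /nbhs_ballP[ru /= ru0 hu'] := hdu _ e2.
  have /nbhs_ballP[rv /= rv0 hv'] := hdv _ e2.
  apply/nbhs_ballP; exists (Num.min ru rv) => /=; first by rewrite lt_min ru0.
  move=> x; rewrite /ball /= lt_min => /andP[xru xrv] xT.
  have /l1normP hxu := hu' x xru xT; have /l1normP hxv := hv' x xrv xT.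
  rewrite /phi xT tauT (le_trans (nrm_dist (hdiff x xT) (hdiff tau tauT)))//.
  have [hn _] := nrm_zbound (hdiff tau tauT).
  have hX := hL _ _ _ (hru tau tauT) (hrv tau tauT) hn.
  apply: nrm_le.
  rewrite (_ : (_ + e) * _ = (e / 2 * `|x - tau| + e / 2 * `|x - tau|) + modulus (x - tau)%:C *
    (L * nrm (diff tau))).
    apply: eq_zbound (zboundD (zboundB hxu hxv) (zboundZ (x - tau)%:C hX)) => j.
    exact: increment_split.
  by rewrite modulus_real; field.
move=> t tT; apply/funext => j; apply/eqP; rewrite -subr_eq0; apply/eqP.
have [hn _] := nrm_zbound (hdiff t tT).
have := zero t tT; rewrite /phi tT => nE; rewrite nE in hn.
exact: (zbound_zero hn j).
Qed.

End FlowUniqueness.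

(** * Series indexed by the natural numbers *)

Section NatSeries.
Variable R : realType.

Lemma seq_sub_iota (A : seq nat) : exists N, {subset A <= iota 0 N}.
Proof.
exists (\max_(i <- A) i).+1 => i iA; rewrite mem_iota /= add0n ltnS.
by apply: (@leq_bigmax_seq _ A xpredT id i).
Qed.

Lemma sum_iota (V : nmodType) (f : nat -> V) N :
  \sum_(i <- iota 0 N) f i = \sum_(i < N) f i.
Proof. by rewrite -{1}[N]subn0 -/(index_iota 0 N) big_mkord. Qed.

Lemma sumle_nat (f : nat -> R) B : (forall n, 0 <= f n) ->
  (forall N, \sum_(n < N) f n <= B) -> sumle f B.
Proof.
move=> f0 h A uA; have [N AN] := seq_sub_iota A.
by apply: le_trans (h N); rewrite -sum_iota le_sum_subset// iota_uniq.
Qed.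

Lemma sumle_geometric (x K : R) : 0 <= x -> x < 1 -> 0 <= K ->
  sumle (fun n => K * x ^+ n) (K / (1 - x)).
Proof.
move=> x0 x1 K0; apply: sumle_nat => [n|N]; first by rewrite mulr_ge0 ?exprn_ge0.
rewrite -mulr_sumr ler_wpM2l// -[leRHS]mul1r ler_pdivlMr ?subr_gt0//.
elim: N => [|N IH]; first by rewrite big_ord0 mul0r.
suff -> : (\sum_(i < N.+1) x ^+ i) * (1 - x) = 1 - x ^+ N.+1.
  by rewrite gerBl exprn_ge0.
elim: N {IH} => [|N IH]; first by rewrite big_ord1 expr0 expr1 mul1r.
by rewrite big_ord_recr mulrDl IH /= !exprS; ring.
Qed.

Lemma sumle_half (f : nat -> R) K : 0 <= K ->
  (forall n, f n <= K * 2^-1 ^+ n) -> sumle f (2 * K).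
Proof.
move=> K0 h; have h2 : (2^-1 : R) < 1 by rewrite invf_lt1// ltr1n.
apply: le_sumle (sumle_geometric _ h2 K0) => //.
by rewrite le_eqVlt; apply/orP; left; apply/eqP; field.
Qed.

Lemma csum_shift (x : nat -> R[i]) : asummable x ->
  csum x = x 0%N + csum (fun n => x n.+1).
Proof.
move=> sx.
have sx1 : asummable (fun n => x n.+1).
  case: sx => B hB; exists B => A uA; have := hB (map S A).
  rewrite big_map; apply; by rewrite map_inj_uniq// => a b [].
have sd : asummable (fun n => if n == 0%N then x 0%N else 0).
  exists (modulus (x 0%N)) => A uA; case: (boolP (0%N \in A)) => iA.
    rewrite (bigD1_seq 0%N)//= big1 ?addr0// => j /negbTE ->; exact: modulus0.
  rewrite big_seq big1 ?modulus_ge0// => j jA.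
  by case: eqP => [j0|_]; [rewrite j0 (negbTE iA) in jA|rewrite modulus0].
have sx' : asummable (fun n => x n - (if n == 0%N then x 0%N else 0)).
  apply: (@asummable_le _ _ _ (fun n => x n + (-1) * (if n == 0%N then x 0%N else 0))).
    by move=> n; rewrite mulN1r.
  by apply: asummableD => //; apply: asummableZ.
apply/eqP; rewrite addrC -subr_eq; apply/eqP.
have <- : csum (fun n => if n == 0%N then x 0%N else 0) = x 0%N.
  by rewrite (csum_single (i0 := 0%N))// => i /negbTE ->.
rewrite -csumB//; apply: csum_cofinal => // A B uA uB.
have [N1 h1] := seq_sub_iota A; have [N2 h2] := seq_sub_iota B.
exists (iota 0 (N1 + N2).+1), (iota 0 (N1 + N2)); rewrite !iota_uniq; split => //.
- by move=> i /h1; rewrite !mem_iota; lia.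
- by move=> i /h2; rewrite !mem_iota; lia.
- by rewrite !sum_iota big_ord_recl /= subrr add0r; apply: eq_bigr => i _; rewrite subr0.
Qed.

Lemma csum_cauchy (x y : nat -> R[i]) B B' :
  sumle (fun n => modulus (x n)) B -> sumle (fun n => modulus (y n)) B' ->
  csum (fun n => \sum_(a < n.+1) x a * y (n - a)%N) = csum x * csum y.
Proof.
move=> hx hy.
have sx : asummable x by exists B. have sy : asummable y by exists B'.
have hxy : sumle2 (fun a b => x a * y b) (B' * B).
  apply: (sumle2_prod (f := fun a => B' * modulus (x a))).
    move=> a A uA; under eq_bigr => i _ do rewrite modulusM.
    by rewrite -mulr_sumr mulrC ler_wpM2r ?modulus_ge0// hy.
  by apply: sumleZ => //; apply: sumle_ge0 hy.
have -> : csum x * csum y = csum (fun p : nat * nat => x p.1 * y p.2).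
  rewrite (@csum_pair R nat nat _ (fun a b => (a, b)) fst snd (fun p => x p.1 * y p.2) (B' *
    B))//; last by case.
  rewrite mulrC -csumZ//; apply: eq_csum => a; rewrite mulrC -csumZ//.
have sconv : asummable (fun n => \sum_(a < n.+1) x a * y (n - a)%N).
  exists (B' * B); apply: sumle_nat => [n|N]; first exact: modulus_ge0.
  apply: (@le_trans _ _ (\sum_(n < N) \sum_(a < n.+1) modulus (x a * y (n - a)%N))).
    by apply: ler_sum => n _; apply: modulus_sum.
  rewrite (sum_triangle_sub (fun a b => modulus (x a * y b))).
  apply: (@le_trans _ _ (\sum_(a <- iota 0 N) \sum_(b <- iota 0 N) modulus (x a * y b))).
    rewrite sum_iota; apply: ler_sum => a _; rewrite -(sum_iota (fun b => modulus (x a * y b)) (N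
      - a)).
    apply: le_sum_subset; rewrite ?iota_uniq// => b; rewrite ?modulus_ge0//.
    by rewrite !mem_iota; lia.
  by apply: hxy; rewrite iota_uniq.
have sprod : asummable (fun p : nat * nat => x p.1 * y p.2).
  exists (B' * B) => S uS.
  apply: (@le_trans _ _ (\sum_(p <- [seq (a, b) | a <- undup (map fst S), b <- undup (map snd S)])
     modulus (x p.1 * y p.2))).
    apply: le_sum_subset => // [p||p pS]; first exact: modulus_ge0.
      by rewrite allpairs_uniq ?undup_uniq// => -[a b] [a' b'] _ _ /= [-> ->].
    by apply/allpairsP; exists p; split; rewrite ?mem_undup ?map_f//; case: (p).
  by rewrite big_allpairs_dep; apply: hxy; rewrite undup_uniq.
apply: csum_cofinal => // A S uA uS.
have [N1 h1] := seq_sub_iota A.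
have [N2 h2] := seq_sub_iota (map (fun p => p.1 + p.2)%N S).
pose N := (N1 + N2)%N.
exists (iota 0 N), [seq (a, b) | a <- iota 0 N, b <- iota 0 (N - a)].
rewrite iota_uniq; split => //.
- apply: allpairs_uniq_dep; [exact: iota_uniq|by move=> a _; exact: iota_uniq|].
  by move=> [a b] [a' b'] _ _ /= [-> ->].
- by move=> i /h1; rewrite !mem_iota /N; lia.
- move=> [a b] pS; have := h2 (a + b)%N (map_f (fun p => p.1 + p.2)%N pS).
  rewrite mem_iota => hab; apply/allpairsPdep; exists a, b.
  by rewrite !mem_iota /N; split => //; move: hab; lia.
- rewrite big_allpairs_dep !sum_iota (sum_triangle_sub (fun a b => x a * y b)).
  by apply: eq_bigr => a _; rewrite sum_iota.
Qed.

Lemma power_taylor (x t : R) n : 0 <= x <= 1 -> 0 <= t <= 1 ->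
  `|x ^+ n - t ^+ n - (x - t) * (n%:R * t ^+ n.-1)| <= (n ^ 2)%:R * `|x - t| ^+ 2.
Proof.
move=> /andP[x0 x1] /andP[t0 t1]; elim: n => [|n IH].
  by rewrite !expr0 subrr mul0r mulr0 subrr normr0 mul0r.
have -> : x ^+ n.+1 - t ^+ n.+1 - (x - t) * (n.+1%:R * t ^+ n)
   = x * (x ^+ n - t ^+ n - (x - t) * (n%:R * t ^+ n.-1))
     + n%:R * t ^+ n.-1 * (x - t) ^+ 2.
  case: n {IH} => [|n]; first by rewrite !expr0 !expr1; ring.
  by rewrite /= !exprS -[n.+2%:R]natr1; ring.
rewrite (le_trans (ler_normD _ _))// normrM (ger0_norm x0).
rewrite normrM normrX [X in _ + X * _]ger0_norm ?mulr_ge0 ?exprn_ge0//.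
apply: (@le_trans _ _ ((n ^ 2)%:R * `|x - t| ^+ 2 + n%:R * `|x - t| ^+ 2)).
  apply: lerD; first by rewrite (le_trans _ IH)// ler_piMl.
  by rewrite ler_wpM2r ?exprn_ge0// ler_piMr// exprn_ile1.
rewrite -mulrDl ler_wpM2r ?exprn_ge0// -natrD ler_nat.
by rewrite !expnS !expn0; lia.
Qed.

End NatSeries.

(** * Coefficients of Lie series *)

Lemma prod_shift_fact q n : (\prod_(i < n) (q + i).+1 = n`! * 'C(q + n, n))%N.
Proof.
have h : (q`! * \prod_(i < n) (q + i).+1 = (q + n)`!)%N.
  elim: n => [|n IH]; first by rewrite big_ord0 muln1 addn0.
  by rewrite big_ord_recr /= mulnA IH addnS factS mulnC.
apply/eqP; rewrite -(eqn_pmul2l (fact_gt0 q)) h -(bin_fact (leq_addl q n)) addnK.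
by apply/eqP; ring.
Qed.

Lemma bin_le_exp2 n m : ('C(n, m) <= 2 ^ n)%N.
Proof.
elim: n m => [|n IH] [|m]; rewrite ?bin0 ?expn_gt0//.
by rewrite binS expnS mul2n -addnn leq_add.
Qed.

Section LieSeries.
Variables (R : realType) (nonneg : bool) (d : nat) (s rho : R).
Hypothesis s0 : 0 <= s.
Hypothesis rho1 : 1 <= rho.
Local Notation letter := (phase_index nonneg d).
Local Notation mom := (@lmom nonneg d).
Local Notation J := (@letters_of nonneg d).
Local Notation momw := (momw mom).
Local Notation lwt := (@lwt R nonneg d s).
Local Notation wt := (@wt R nonneg d s).
Local Notation array := (seq letter -> R[i]).
Local Notation state := (letter -> R[i]).
Local Notation fbd := (@fbound R nonneg d s _).
Local Notation abd := (@abound R nonneg d s).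
Local Notation zbd := (@zbound R nonneg d s).
(* Majorants of a vector field, indexed by letters, and of a single array. *)
Local Notation vnb := (@nbound R nonneg d s rho _ J lwt).
Local Notation snb f := (@nbound R nonneg d s rho unit (fun=> [:: tt]) (fun=> 1) (fun=> f)).
Local Notation zderiv := (wderiv mom J 0).
Local Notation zstar := (star mom J 0).
Local Notation coord := (@coordinate R[i] letter).

Let rho0 : 0 < rho := lt_le_trans ltr01 rho1.
Let lmomP := @lmom_letters nonneg d.
Let letters_uniqP := @letters_of_uniq nonneg d.

Lemma sum_supported (A : seq letter) (F : letter -> array) w :
  msupp 0 F -> uniq A ->
  \sum_(j <- A) lwt j * modulus (F j w) <= \sum_(j <- J (momw w)) lwt j * modulus (F j w).
Proof.
move=> mF uA; rewrite (bigID (fun j => j \in J (momw w))) /= [X in _ + X]big1 ?addr0; last first.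
  move=> j; rewrite lmomP => jm; case: (eqVneq (F j w) 0) => [->|/mF]; first by rewrite modulus0
    mulr0.
  by rewrite add0r => e; rewrite e eqxx in jm.
rewrite -big_filter; apply: le_sum_subset; rewrite ?filter_uniq ?letters_uniqP//.
  by move=> j; rewrite mulr_ge0 ?lwt_ge0 ?modulus_ge0.
by move=> j; rewrite mem_filter => /andP[].
Qed.

Lemma nonneg_coef_le (b : {poly R}) C l : nonneg_poly b -> b.[rho] <= C -> b`_l <= C.
Proof.
move=> b0; apply: le_trans; case: (ltnP l (size b)) => lb; last first.
  by rewrite nth_default ?nonneg_horner ?ltW.
rewrite horner_coef (bigD1 (Ordinal lb))//= -[leLHS]addr0 lerD//.
  by rewrite ler_peMr// exprn_ege1.
by rewrite sumr_ge0// => i _; rewrite mulr_ge0 ?exprn_ge0// ltW.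
Qed.

Lemma vnb_fbound F C e : vnb F C e -> msupp 0 F -> (forall j, deg_lt (F j) e.+1) ->
  fbd lwt F C e.+1.
Proof.
move=> [b [b0 hb sb Cb]] mF dF; split => //.
  by apply: le_trans Cb; apply: nonneg_horner => //; apply: ltW.
move=> A uA w; rewrite (le_trans (sum_supported w mF uA))// (le_trans (hb w))//.
by rewrite ler_wpM2r ?wt_ge0// nonneg_coef_le.
Qed.

Lemma vnb_deg F C e j : vnb F C e -> msupp 0 F -> deg_lt (F j) e.+1.
Proof.
move=> [b [b0 hb sb Cb]] mF w ew; case: (eqVneq (F j w) 0) => // Fw.
have jw : j \in J (momw w) by rewrite lmomP (mF _ _ Fw) add0r.
have := hb w; rewrite nth_default ?mul0r; last exact: leq_trans ew.
move=> h; apply: modulus_eq0; apply/eqP; rewrite eq_le modulus_ge0 andbT.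
rewrite -(pmulr_rle0 _ (lwt_gt0 s0 j)) (le_trans _ h)//.
rewrite (bigD1_seq j)//= lerDl sumr_ge0// => i _.
by rewrite mulr_ge0 ?lwt_ge0 ?modulus_ge0.
Qed.

Lemma vnb_fbd F C e : vnb F C e -> msupp 0 F -> fbd lwt F C e.+1.
Proof. by move=> h mF; apply: vnb_fbound => // j; apply: vnb_deg h mF. Qed.

Lemma snb_abd f C e : snb f C e -> abd f C e.+1.
Proof.
move=> [b [b0 hb sb Cb]]; split.
- by apply: le_trans Cb; apply: nonneg_horner => //; apply: ltW.
- move=> w; have := hb w; rewrite big_seq1 mul1r => /le_trans; apply.
  by rewrite ler_wpM2r ?wt_ge0// nonneg_coef_le.
- move=> w ew; have := hb w; rewrite big_seq1 mul1r nth_default ?mul0r; last exact: leq_trans ew.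
  by move=> h; apply: modulus_eq0; apply/eqP; rewrite eq_le h modulus_ge0.
Qed.

Lemma vnb_ev F C e z r : vnb F C e -> msupp 0 F -> zbd z r -> r <= rho ->
  zbd (fun j => ev (F j) z) C.
Proof.
move=> hF mF hz rr A uA; have [b [b0 hb sb Cb]] := hF.
have r0 := zbound_ge0 hz.
have hfb := vnb_fbd hF mF; have [C0 _ dF] := hfb.
under eq_bigr => j _ do rewrite (ev_evd _ (dF j)).
apply: (@le_trans _ _ (\sum_(l < e.+1) b`_l * r ^+ l)).
  apply: (@evd_family_le R nonneg d s s0 _ lwt (lwt_gt0 s0) e.+1 A F (fun l => b`_l) (fun j => C
    / lwt j) z r _ _ b0 _ hz).
  - by move=> j w; have [] := fbound_abound (lwt_gt0 s0) j hfb.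
  - by move=> j; rewrite divr_ge0// lwt_ge0.
  - by move=> w; rewrite (le_trans (sum_supported w mF uA)).
apply: le_trans Cb; rewrite (horner_coef_wide _ sb); apply: ler_sum => l _.
by rewrite ler_wpM2l// lerXn2r// ?nnegrE// ltW.
Qed.

Lemma snb_ev f C e z r : snb f C e -> zbd z r -> r <= rho -> modulus (ev f z) <= C.
Proof.
move=> hf hz rr; have [b [b0 hb sb Cb]] := hf.
have r0 := zbound_ge0 hz; have ha := snb_abd hf; have [C0 ha' df] := ha.
rewrite (ev_evd _ df).
have := @evd_family_le R nonneg d s s0 unit (fun=> 1) (fun=> ltr01) e.+1 [:: tt] (fun=> f)
  (fun l => b`_l) (fun=> C) z r (fun=> ha') (fun=> C0) b0 hb hz.
rewrite big_seq1 mul1r => /le_trans; apply.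
apply: le_trans Cb; rewrite (horner_coef_wide _ sb); apply: ler_sum => l _.
by rewrite ler_wpM2l// lerXn2r// ?nnegrE// ltW.
Qed.

Lemma vnb_component F C e j : vnb F C e -> msupp 0 F -> snb (F j) (C / lwt j) e.
Proof.
move=> hF mF; have [b [b0 hb sb Cb]] := hF; exists ((lwt j)^-1 *: b); split.
- by apply: nonneg_polyZ => //; rewrite invr_ge0 lwt_ge0.
- move=> w; rewrite big_seq1 mul1r coefZ -mulrA ler_pdivlMl ?lwt_gt0//.
  rewrite (le_trans _ (hb w))//.
  by have := sum_supported w mF (isT : uniq [:: j]); rewrite big_seq1.
- by rewrite (leq_trans (size_scale_leq _ _)).
- by rewrite hornerZ mulrC ler_wpM2r// invr_ge0 lwt_ge0.
Qed.

Lemma snb_lquot f C e k : snb f C e -> snb (lquot f k) (lwt k * (C / rho)) e.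
Proof.
move=> [b [b0 hb sb Cb]]; exists (lwt k *: \poly_(l < e) b`_l.+1); split.
- by move=> n; rewrite coefZ coef_poly; case: ifP; rewrite ?mulr0// mulr_ge0 ?lwt_ge0.
- move=> w; rewrite big_seq1 mul1r coefZ coef_poly.
  have := hb (k :: w); rewrite big_seq1 mul1r wt_cons /= => h.
  case: ifP => we; first by rewrite [lwt k * _]mulrC -mulrA.
  rewrite mulr0 mul0r (le_trans h)// nth_default ?mul0r//.
  by rewrite (leq_trans sb)// ltnS leqNgt we.
- by rewrite (leq_trans (size_scale_leq _ _))// (leq_trans (size_poly _ _)).
- rewrite hornerZ ler_wpM2l ?lwt_ge0// ler_pdivlMr//.
  apply: le_trans Cb; rewrite horner_poly (horner_coef_wide _ sb) big_ord_recl /=.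
  rewrite -[leLHS]add0r lerD ?mulr_ge0//.
  rewrite mulr_suml; apply: ler_sum => l _; rewrite (_ : bump 0 l = l.+1)//.
  by rewrite exprSr mulrA.
Qed.

Variables (X : letter -> array) (CX : R) (m : nat).
Hypothesis hX : vnb X CX m.
Hypothesis mX : msupp 0 X.

Local Notation D n := (iter n (zderiv X)).
Let kappa := m%:R / rho * CX.

Lemma kappa_ge0 : 0 <= kappa.
Proof. by rewrite !mulr_ge0 ?invr_ge0 ?(ltW rho0)// (nbound_ge0 rho0 hX). Qed.

(** Degrees grow by [m] at each derivation, so the [n]-th one costs
    [(q + n) m / rho] and the total cost is a rising factorial. *)
Lemma nbound_iter (I : Type) (Js : 'rV[int]_d -> seq I) (om : I -> R) F C q n :
  (forall i, 0 <= om i) -> nbound s rho Js om F C (q.+1 * m) ->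
  nbound s rho Js om (fun i => D n (F i))
    (C * kappa ^+ n * (\prod_(i < n) (q + i).+1)%:R) ((q + n).+1 * m).
Proof.
move=> om0 hF; elim: n => [|n IH].
  by rewrite big_ord0 expr0 !mulr1 addn0.
have := nbound_wderiv s0 rho0 om0 hX IH; apply: nbound_le.
  rewrite big_ord_recr /= natrM exprSr -/kappa /kappa natrM.
  by rewrite le_eqVlt; apply/orP; left; apply/eqP; ring.
by rewrite addnS [((q + n).+2 * m)%N]mulSn addnC.
Qed.

Definition lie_coef (n : nat) (f : array) (z : state) : R[i] :=
  invfact R[i] n * ev (D n f) z.

Lemma modulus_invfact n : modulus (invfact R[i] n) = invfact R n.
Proof. by rewrite /invfact modulusV modulus_nat. Qed.

Lemma invfact_ge0 n : 0 <= invfact R n.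
Proof. by rewrite invr_ge0. Qed.

(** The rising factorials are absorbed by the [1 / n!] of the Lie series: the
    quotient is a binomial coefficient, of exponential growth only. *)
Lemma invfact_prod q n : invfact R n * (\prod_(i < n) (q + i).+1)%:R <= 2 ^+ (q + n).
Proof.
rewrite prod_shift_fact natrM mulrA /invfact mulVf ?mul1r ?pnatr_eq0 -?lt0n ?fact_gt0//.
by rewrite -natrX ler_nat bin_le_exp2.
Qed.

Lemma invfact_prod0 n : invfact R n * (\prod_(i < n) (0 + i).+1)%:R = 1.
Proof.
rewrite prod_shift_fact binn muln1 /invfact mulVf// pnatr_eq0 -lt0n fact_gt0//.
Qed.

Lemma lie_coef_le f C q n z r : snb f C (q.+1 * m) -> zbd z r -> r <= rho ->
  modulus (lie_coef n f z) <= C * 2 ^+ q * (2 * kappa) ^+ n.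
Proof.
move=> hf hz rr; have C0 := nbound_ge0 rho0 hf.
have h := snb_ev (nbound_iter n (fun=> ler01) hf) hz rr.
rewrite /lie_coef modulusM modulus_invfact (le_trans (ler_wpM2l (invfact_ge0 n) h))//.
rewrite mulrCA (_ : C * 2 ^+ q * _ = C * kappa ^+ n * 2 ^+ (q + n)); last first.
  by rewrite exprMn exprD; ring.
by rewrite ler_wpM2l ?invfact_prod// mulr_ge0 ?exprn_ge0 ?kappa_ge0.
Qed.

Lemma msupp_coord : msupp 0 (fun j => coord j).
Proof.
move=> j w; rewrite /coordinate add0r; case: (w =P [:: j]) => [->|_]; last by rewrite eqxx.
by rewrite momw_cons momw_nil addr0.
Qed.

Lemma wderiv_supp mu (Y : letter -> array) (f : array) p w :
  (forall v, f v != 0 -> momw v = p) -> wderiv mom J mu Y f w != 0 -> mu + momw w = p.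
Proof.
move=> hf; case: (eqVneq (mu + momw w) p) => // pw.
rewrite (@eq_wderiv _ _ _ mom J mu Y Y f (fun u => (fun q v => if q == p then f v else 0) (momw
  u) u))//.
  rewrite (wderiv_momw lmomP mu Y (fun q v => if q == p then f v else 0)).
  rewrite (_ : (fun v => _) = fun=> 0); first by rewrite wderiv0 eqxx.
  by apply/funext => v; rewrite (negbTE pw).
move=> u; case: (momw u =P p) => // up; apply/eqP/negPn/negP => /hf; exact: up.
Qed.

Lemma wderiv_supported (f : array) (p : 'rV[int]_d) w :
  (forall v, f v != 0 -> p = momw v) -> zderiv X f w != 0 -> p = momw w.
Proof.
by move=> hf h; rewrite -[RHS]add0r; symmetry; apply: wderiv_supp h => v /hf.
Qed.

Lemma msupp_iter F n : msupp 0 F -> msupp 0 (fun j => D n (F j)).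
Proof.
move=> mF; elim: n => [//|n IH] j w /=.
rewrite add0r; apply: wderiv_supported => v /IH; by rewrite add0r.
Qed.

Lemma nbound_coordinate_mul : (0 < m)%N -> vnb (fun j => coord j) rho (1 * m).
Proof.
move=> m0; apply: (nbound_le (lexx rho) _ (nbound_coordinate nonneg d s rho)).
by rewrite mul1n.
Qed.

Hypothesis m0 : (0 < m)%N.

Lemma lie_coord_bound n z r : zbd z r -> r <= rho ->
  zbd (fun j => lie_coef n (coord j) z) (rho * kappa ^+ n).
Proof.
move=> hz rr; have h := nbound_iter n (lwt_ge0 s0) (nbound_coordinate_mul m0).
have := vnb_ev h (@msupp_iter _ n msupp_coord) hz rr.
move=> /(zboundZ (invfact R[i] n)); rewrite modulus_invfact.
rewrite (_ : invfact R n * _ = rho * kappa ^+ n) => [//|].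
by rewrite mulrCA invfact_prod0 mulr1.
Qed.

(** Leibniz formula for an iterated derivation. *)
Lemma iter_star Y g n w :
  D n (zstar Y g) w
    = \sum_(a < n.+1) (zstar (fun j => D a (Y j)) (fun j => D (n - a) (g j)) w) *+ 'C(n, a).
Proof.
elim: n w => [|n IH] w; first by rewrite big_ord1 bin0 mulr1n.
rewrite iterS (@eq_wderiv _ _ _ mom J 0 X X _ _ w (fun _ _ => erefl) IH).
rewrite wderiv_sum (sum_pascal (fun a => zstar (fun j => D a (Y j)) (fun j => D (n.+1 - a) (g j))
  w)).
rewrite addrC -big_split; apply: eq_bigr => a _ /=.
rewrite -mulr_natl -(@eq_wderiv _ _ _ mom J 0 X X (fun u => 'C(n, a)%:R * zstar (fun j => D a (Y
  j)) (fun j => D (n - a) (g j)) u))//;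
  last by move=> u; rewrite mulr_natl.
rewrite wderiv_scale (wderiv_star lmomP) addr0 mulrDr !mulr_natl; congr (_ + _).
by rewrite subSn// -ltnS.
Qed.

Lemma iter_add n f g w : D n (fun u => f u + g u) w = D n f w + D n g w.
Proof.
elim: n w => [//|n IH] w; rewrite !iterS -wderiv_add.
by apply: eq_wderiv => // u; apply: IH.
Qed.

Definition constant_part (f : array) : array := fun w => if w is [::] then f [::] else 0.

Lemma array_split f w : f w = constant_part f w + zstar (fun j => coord j) (lquot f) w.
Proof.
rewrite (star_coordinate lmomP letters_uniqP); case: w => [|k w] /=; first by rewrite addr0.
by rewrite add0r.
Qed.

Lemma iter_constant n f w : D n.+1 (constant_part f) w = 0.
Proof.
elim: n w => [|n IH] w; first by apply: wderiv_const.
rewrite iterS -[RHS](wderiv0 mom J 0 X w); apply: eq_wderiv => // u; exact: IH.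
Qed.

(** Every series is its constant term plus the sum over [j] of the coordinate
    [j] times [lquot f j]; the Leibniz formula then expresses Lie coefficients of
    [f] by those of shorter series. *)
Lemma lie_coef_rec f C q n z r : snb f C (q.+1 * m) -> zbd z r -> r <= rho ->
  lie_coef n f z = (if n == 0%N then f [::] else 0)
    + csum (fun j => \sum_(a < n.+1) lie_coef a (coord j) z * lie_coef (n - a) (lquot f j) z).
Proof.
move=> hf hz rr; have C0 := nbound_ge0 rho0 hf.
have hI a : vnb (fun j => D a (coord j)) _ _ := nbound_iter a (lwt_ge0 s0) (nbound_coordinate_mul
  m0).
have mI a := @msupp_iter _ a msupp_coord.
have fI a := vnb_fbd (hI a) (mI a).
have hg b j : snb (D b (lquot f j)) _ _ := nbound_iter b (fun=> ler01) (snb_lquot j hf).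
have ag b j : abd (D b (lquot f j)) ((C / rho * kappa ^+ b * (\prod_(i < b) (q + i).+1)%:R) * lwt
  j) ((q + b).+1 * m).+1.
  by apply: (abound_weaken s0 _ (leqnn _) (snb_abd (hg b j))); rewrite le_eqVlt; apply/orP; left;
    apply/eqP; ring.
have Dg0 b : 0 <= C / rho * kappa ^+ b * (\prod_(i < b) (q + i).+1)%:R.
  by rewrite !mulr_ge0 ?exprn_ge0 ?kappa_ge0// invr_ge0 ltW.
have evS a b := ev_star s0 (fI a) (Dg0 b) (ag b) (mI a) hz.
have split w : D n f w = (if n == 0%N then constant_part f w else 0)
   + D n (zstar (fun j => coord j) (lquot f)) w.
  rewrite [in LHS](_ : f = fun u => constant_part f u + zstar (fun j => coord j) (lquot f) u).
    rewrite iter_add; congr (_ + _); case: n => [//|n]; exact: iter_constant.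
  by apply/funext => u; exact: array_split.
have aS a b : abd (zstar (fun j => D a (coord j)) (fun j => D b (lquot f j))) _ _ :=
  abound_star s0 0 (fI a) (Dg0 b) (ag b).
pose E := ((n.+1 * m).+1 + ((q + n).+1 * m).+1)%N.
have le (a : 'I_n.+1) : (((0 + a).+1 * m).+1 + ((q + (n - a)).+1 * m).+1 <= E)%N.
  have an : (a <= n)%N by rewrite -ltnS.
  by rewrite /E leq_add// ltnS leq_mul2r ltnS ?an ?leq_add2l ?leq_subr orbT.
have aS' (a : 'I_n.+1) : abd (fun w => 'C(n, a)%:R * zstar (fun j => D a (coord j)) (fun j => D
  (n - a) (lquot f j)) w) _ E
  := aboundZ ('C(n, a)%:R) (abound_weaken s0 (lexx _) (le a) (aS a (n - a)%N)).
have asS a b : asummable (fun j => ev (D a (coord j)) z * ev (D b (lquot f j)) z).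
  eexists; apply: sumle_dual (vnb_ev (hI a) (mI a) hz rr) _ (ev_abound_dual s0 (ag b) hz) => //.
  by rewrite mulr_ge0// geom_ge0// (zbound_ge0 hz).
have evn : ev (D n f) z = (if n == 0%N then f [::] else 0)
   + \sum_(a < n.+1) 'C(n, a)%:R * csum (fun j => ev (D a (coord j)) z * ev (D (n - a) (lquot f
     j)) z).
  rewrite (eq_ev _ split) (evD s0 (f := fun w => if n == 0%N then constant_part f w else 0)
     (g := D n (zstar (fun j => coord j) (lquot f))) (C := modulus (f [::]))
     (D := \sum_(a < n.+1) (modulus ('C(n, a)%:R) * ((((0 + a).+1 * m).+1 + ((q + (n - a)).+1 *
       m).+1)%:R * (rho * kappa ^+ a * (\prod_(i < a) (0 + i).+1)%:R * (C / rho * kappa ^+ (n -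
       a) * (\prod_(i < (n - a)) (q + i).+1)%:R))))) (e := E) _ _ hz); last 2 first.
  - split; first exact: modulus_ge0.
      move=> w; case: ifP => _; last by rewrite modulus0 mulr_ge0 ?modulus_ge0 ?wt_ge0.
      by case: w => [|k w] /=; rewrite ?wt_nil ?mulr1// modulus0 mulr_ge0 ?modulus_ge0 ?wt_ge0.
    by move=> w ew; case: ifP => // _; case: w ew.
  - have := abound_sum (index_enum 'I_n.+1) aS'.
    rewrite (_ : (fun w => _) = D n (zstar (fun j => coord j) (lquot f))) //.
    apply/funext => w; rewrite iter_star; apply: eq_bigr => a _; by rewrite mulr_natl.
  congr (_ + _).
    case: ifP => _; last exact: ev0.
    rewrite (@ev_evd _ _ _ _ 1); last by case.
    by rewrite /= csum0 ?addr0// => j; rewrite mulr0.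
  rewrite (eq_ev z (iter_star _ _ _)).
  transitivity (ev (fun w => \sum_(a < n.+1) 'C(n, a)%:R * zstar (fun j => D a (coord j)) (fun j
    => D (n - a) (lquot f j)) w) z).
    by apply: eq_ev => w; apply: eq_bigr => a _; rewrite mulr_natl.
  rewrite (ev_sum s0 _ aS' hz); apply: eq_bigr => a _.
  by rewrite (evZ s0 _ (aS _ _) hz) evS.
rewrite /lie_coef evn mulrDr; congr (_ + _).
  by case: eqP => [->|_]; rewrite ?mulr0// /invfact fact0 invr1 mul1r.
rewrite csum_sum; last first.
  move=> a; apply: asummable_le (asummableZ (invfact R[i] a * invfact R[i] (n - a)) (asS a (n -
    a)%N)) => j.
  by rewrite mulrACA.
rewrite mulr_sumr; apply: eq_bigr => a _.
have an : (a <= n)%N by rewrite -ltnS.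
have := invfact_bin R[i] a (n - a); rewrite subnKC// => binE.
rewrite mulrA binE -csumZ//; apply: eq_csum => j; by rewrite mulrACA.
Qed.

End LieSeries.

(** * Lie series solve the differential equation *)

Section LieFlow.
Variables (R : realType) (nonneg : bool) (d : nat) (s rho : R).
Hypothesis s0 : 0 <= s.
Hypothesis rho1 : 1 <= rho.
Local Notation letter := (phase_index nonneg d).
Local Notation mom := (@lmom nonneg d).
Local Notation J := (@letters_of nonneg d).
Local Notation momw := (momw mom).
Local Notation lwt := (@lwt R nonneg d s).
Local Notation wt := (@wt R nonneg d s).
Local Notation array := (seq letter -> R[i]).
Local Notation state := (letter -> R[i]).
Local Notation fbd := (@fbound R nonneg d s _).
Local Notation abd := (@abound R nonneg d s).
Local Notation zbd := (@zbound R nonneg d s).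
Local Notation vnb := (@nbound R nonneg d s rho _ J lwt).
Local Notation snb f := (@nbound R nonneg d s rho unit (fun=> [:: tt]) (fun=> 1) (fun=> f)).
Local Notation zderiv := (wderiv mom J 0).
Local Notation coord := (@coordinate R[i] letter).

Let rho0 : 0 < rho := lt_le_trans ltr01 rho1.

Lemma zbound_csum (v : nat -> state) (f : nat -> R) B : (forall n, zbd (v n) (f n)) ->
  sumle f B -> zbd (fun j => csum (fun n => v n j)) B.
Proof.
move=> hv hf.
have hy : sumle2 (fun n j => (lwt j)%:C * v n j) B.
  apply: sumle2_prod hf => n A uA; have := hv n A uA; rewrite (eq_bigr (fun j => modulus ((lwt
    j)%:C * v n j)))//.
  by move=> j _; rewrite modulusM modulus_real ger0_norm ?lwt_ge0.
have vs j : asummable (fun n => v n j).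
  exists B; apply: le_sumle hf => // n; apply: (le_trans _ (sumle_term j (hv n))).
  by rewrite ler_peMl ?modulus_ge0// lwt_ge1.
move=> A uA; have := sumle_csum (sumle2_swap hy) uA; rewrite (eq_bigr (fun j => lwt j * modulus
  (csum (fun n => v n j))))// => j _.
by rewrite csumZ// modulusM modulus_real ger0_norm ?lwt_ge0.
Qed.

Lemma ev_coordinate j z : ev (coord j) z = z j.
Proof.
rewrite (@ev_evd _ _ _ _ 2); last by move=> [|k [|l w]]// _; rewrite /coordinate eqseq_cons andbF.
rewrite /= {1}/coordinate /= add0r (@csum_single _ _ _ j).
  by rewrite csum0 ?addr0/lquot /coordinate ?eqxx ?mulr1// => k; rewrite mulr0.
move=> i ij; rewrite csum0 ?addr0; last by move=> k; rewrite mulr0.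
by rewrite /lquot /coordinate eqseq_cons (negbTE ij) mulr0.
Qed.

Variables (X : letter -> array) (CX : R) (m : nat).
Hypothesis hX : vnb X CX m.
Hypothesis mX : msupp 0 X.
Hypothesis m0 : (0 < m)%N.
Local Notation D n := (iter n (zderiv X)).
Local Notation kappa := (m%:R / rho * CX).
Hypothesis kappa8 : kappa <= 8^-1.

Let k0 : 0 <= kappa := kappa_ge0 rho1 hX.

Let k2 : 0 <= 2 * kappa <= 4^-1.
Proof. by move: k0 kappa8; set k := (m%:R / rho * CX) => *; lra. Qed.

Definition lie_term (t : R) (n : nat) (f : array) (z : state) : R[i] :=
  (t ^+ n)%:C * lie_coef X n f z.

Definition lie_eval (t : R) (f : array) (z : state) : R[i] :=
  csum (fun n => lie_term t n f z).

(** The candidate flow, each coordinate being transported by its Lie series. *)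
Definition lie_flow (t : R) (z : state) : state := fun j => lie_eval t (coord j) z.

Lemma modulus_pow01 (t : R) n : 0 <= t <= 1 -> modulus ((t ^+ n)%:C : R[i]) <= 1.
Proof. by move=> /andP[t0 t1]; rewrite modulus_real ger0_norm ?exprn_ge0// exprn_ile1. Qed.

Section At.
Variables (z : state) (r : R).
Hypothesis hz : zbd z r.
Hypothesis rr : r <= rho.

Lemma lie_term_le f C q t n : 0 <= t <= 1 -> snb f C (q.+1 * m) ->
  modulus (lie_term t n f z) <= C * 2 ^+ q * (2 * kappa) ^+ n.
Proof.
move=> ht hf; rewrite /lie_term modulusM -[leRHS]mul1r.
apply: ler_pM; rewrite ?modulus_ge0 ?modulus_pow01//.
exact: (lie_coef_le s0 rho1 hX n hf hz rr).
Qed.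

Lemma kappa2 n : (2 * kappa) ^+ n <= 2^-1 ^+ n.
Proof.
have [h0 h1] := andP k2; rewrite lerXn2r ?nnegrE ?invr_ge0// (le_trans h1)//; lra.
Qed.

Lemma kappa1 n : kappa ^+ n <= 2^-1 ^+ n.
Proof. by rewrite lerXn2r ?nnegrE ?invr_ge0// (le_trans kappa8)//; lra. Qed.

Lemma asummable_lie_term f C q t : 0 <= t <= 1 -> snb f C (q.+1 * m) ->
  sumle (fun n => modulus (lie_term t n f z)) (2 * (C * 2 ^+ q)).
Proof.
move=> ht hf; have C0 := nbound_ge0 rho0 hf; apply: sumle_half; first by rewrite mulr_ge0
  ?exprn_ge0.
move=> n; rewrite (le_trans (lie_term_le n ht hf))// ler_wpM2l ?kappa2// mulr_ge0 ?exprn_ge0//.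
Qed.

Lemma lie_term_coord t n : 0 <= t <= 1 ->
  zbd (fun j => lie_term t n (coord j) z) (rho * kappa ^+ n).
Proof.
move=> ht; have := zboundZ ((t ^+ n)%:C) (lie_coord_bound s0 rho1 hX m0 n hz rr).
move=> h A uA; apply: le_trans (h A uA) _.
by rewrite -[leRHS]mul1r ler_wpM2r ?modulus_pow01// mulr_ge0 ?exprn_ge0 ?(ltW rho0).
Qed.

Lemma lie_flow_bound t : 0 <= t <= 1 -> zbd (lie_flow t z) (2 * rho).
Proof.
move=> ht; apply: zbound_csum (fun n => lie_term_coord n ht) _.
by apply: sumle_half; [exact: ltW|move=> n; rewrite ler_wpM2l ?kappa1// ltW].
Qed.

Lemma snb_coordinate j : snb (coord j) (rho / lwt j) (1 * m).
Proof. exact: (vnb_component s0 j (nbound_coordinate_mul nonneg d s rho m0) (@msupp_coord R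
  nonneg d)). Qed.

Lemma succ_half n : n.+1%:R * 4^-1 ^+ n <= 2^-1 ^+ n :> R.
Proof.
rewrite (_ : 4^-1 = 2^-1 * 2^-1 :> R); last by field.
rewrite exprMn mulrA ler_piMl ?exprn_ge0 ?invr_ge0//.
rewrite exprVn ler_pdivrMr ?exprn_gt0// mul1r -natrX ler_nat ltn_expl//.
Qed.

(** Lie series are multiplicative, hence act by substitution: the value of
    [f] along the flow is its Lie series.  By induction on the degree of [f],
    through the Cauchy product of the two factors of [lie_coef_rec]. *)
Lemma lie_eval_flow t f C q : 0 <= t <= 1 -> snb f C (q.+1 * m) ->
  lie_eval t f z = ev f (lie_flow t z).
Proof.
move=> ht hf; have [b [_ _ sb _]] := hf; have [_ _ df] := snb_abd s0 rho1 hf.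
move: (q.+1 * m).+1 df => e df.
elim: e f C hf df {b sb} => [|e IH] f C hf df.
  have -> : f = fun=> 0 by apply/funext => w; apply: df.
  rewrite ev0 /lie_eval csum0// => n; rewrite /lie_term /lie_coef (eq_ev (g := fun=> 0)) ?ev0
    ?mulr0//.
  by elim: n => [//|n IHn] w; rewrite iterS -[RHS](wderiv0 mom J 0 X w); apply: eq_wderiv.
have C0 := nbound_ge0 rho0 hf.
have hq j := snb_lquot s0 rho1 j hf.
pose y t n j := \sum_(a < n.+1) lie_term t a (coord j) z * lie_term t (n - a) (lquot f j) z.
(* [2 kappa <= 1/4] beats the [n + 1] terms of the Cauchy product. *)
have hy t' : 0 <= t' <= 1 -> sumle2 (y t') (2 * (C * 2 ^+ q)).
  move=> ht'.
  apply: (@sumle2_prod _ _ _ _ (fun n => C * 2 ^+ q * (n.+1%:R * (2 * kappa) ^+ n))); last first.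
    apply: sumle_half => [|n]; first by rewrite mulr_ge0 ?exprn_ge0.
    rewrite ler_wpM2l ?mulr_ge0 ?exprn_ge0// (le_trans _ (succ_half n))//.
    by have /andP[h0 h1] := k2; rewrite ler_wpM2l// lerXn2r ?nnegrE ?invr_ge0.
  move=> n; rewrite (_ : C * 2 ^+ q * _ = \sum_(a < n.+1) C * 2 ^+ q * (2 * kappa) ^+ n); last
    first.
    by rewrite sumr_const card_ord -[RHS]mulr_natl; ring.
  apply: (@le_sumle _ _ _ (fun j => \sum_(a < n.+1) modulus (lie_term t' a (coord j) z * lie_term
    t' (n - a) (lquot f j) z)) (\sum_(a < n.+1) C * 2 ^+ q * (2 * kappa) ^+ n)) => //.
    by move=> j; apply: modulus_sum.
  apply: sumle_sum => a.
  have an : (a <= n)%N by rewrite -ltnS.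
  have Dp : 0 <= C / rho * 2 ^+ q * (2 * kappa) ^+ (n - a).
    have [/andP[h0 _] r0] := (k2, ltW rho0).
    by rewrite mulr_ge0 ?exprn_ge0// mulr_ge0 ?exprn_ge0// divr_ge0.
  have hg j : modulus (lie_term t' (n - a) (lquot f j) z) <= C / rho * 2 ^+ q * (2 * kappa) ^+ (n
    - a) * lwt j.
    apply: le_trans (lie_term_le (n - a) ht' (hq j)) _.
    by rewrite le_eqVlt; apply/orP; left; apply/eqP; ring.
  apply: (le_sumle (fun=> lexx _) _ (sumle_dual (lie_term_coord a ht') Dp hg)).
  rewrite -[in leRHS](subnKC an) exprD [(2 * _) ^+ a]exprMn.
  rewrite (_ : rho * _ * _ = (kappa ^+ a) * (C * 2 ^+ q * (2 * kappa) ^+ (n - a))); last first.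
    by rewrite mulrAC !mulrA [rho * C]mulrC mulfK ?gt_eqF//; ring.
  rewrite [leRHS](_ : _ = 2 ^+ a * kappa ^+ a * (C * 2 ^+ q * (2 * kappa) ^+ (n - a))); last by
    ring.
  have /andP[h0 _] := k2.
  rewrite ler_wpM2r//; first by rewrite mulr_ge0 ?exprn_ge0// mulr_ge0 ?exprn_ge0.
  by rewrite ler_peMl ?exprn_ge0// exprn_ege1// ler1n.
have tE n : lie_term t n f z = (if n == 0%N then f [::] else 0) + csum (y t n).
  rewrite /lie_term (lie_coef_rec s0 rho1 hX m0 n hf hz rr) mulrDr; congr (_ + _).
    by case: eqP => [->|_]; rewrite ?mulr0// expr0 mul1r.
  rewrite -csumZ; last first.
    have h1 : (0 <= 1 :> R) && (1 <= 1 :> R) by rewrite ler01 lexx.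
    eexists; move: (sumle2_row n (hy 1 h1)); apply: le_sumle (lexx _) => j.
    rewrite le_eqVlt; apply/orP; left; apply/eqP; congr modulus; apply: eq_bigr => a _.
    by rewrite /lie_term !expr1n !mul1r.
  apply: eq_csum => j; rewrite mulr_sumr; apply: eq_bigr => a _.
  have an : (a <= n)%N by rewrite -ltnS.
  have -> : (t ^+ n)%:C = (t ^+ a)%:C * (t ^+ (n - a))%:C :> R[i].
    by rewrite -(rmorphM (real_complex R)) -exprD subnKC.
  by rewrite /lie_term mulrACA.
rewrite /lie_eval (eq_csum tE) csumD; last 2 first.
- exists (modulus (f [::])); apply: sumle_nat => [n|[|N]]; first exact: modulus_ge0.
    by rewrite big_ord0 modulus_ge0.
  by rewrite big_ord_recl/= big1 ?addr0// => i _; rewrite modulus0.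
- exact: asummable_csum (hy t ht).
rewrite (@csum_single _ _ _ 0%N) => [/=|i /negbTE -> //].
rewrite (csum_swap (hy t ht)) (ev_rec _ df); congr (_ + _).
apply: eq_csum => j.
have -> : csum ((y t)^~ j) = lie_eval t (coord j) z * lie_eval t (lquot f j) z.
  exact: csum_cauchy (asummable_lie_term ht (snb_coordinate j)) (asummable_lie_term ht (hq j)).
rewrite (IH _ _ (hq j))// => w ew; apply: df; exact: ew.
Qed.

(** The derivation maps the coordinate [j] to [X j]; this is where the field
    enters the differential equation. *)
Lemma lie_coef_field n j :
  lie_coef X n (X j) z = n.+1%:R * lie_coef X n.+1 (coord j) z.
Proof.
have DE : D n.+1 (coord j) = D n (X j).
  rewrite iterSr; congr (D n); apply/funext => w; rewrite (wderiv_coordinate (@lmom_letters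
    nonneg d) (@letters_of_uniq nonneg d)).
  case: eqP => // jw; case: (eqVneq (X j w) 0) => [->//|/mX]; by move/jw.
by rewrite /lie_coef DE mulrA invfactS.
Qed.

Lemma lie_coef_coord_le n j : modulus (lie_coef X n (coord j) z) <= rho * kappa ^+ n.
Proof.
have := sumle_term j (lie_coord_bound s0 rho1 hX m0 n hz rr); apply: le_trans.
by rewrite ler_peMl ?modulus_ge0// lwt_ge1.
Qed.

Lemma square_half n : (n ^ 2)%:R * kappa ^+ n <= 2^-1 ^+ n.
Proof.
have h : kappa ^+ n <= 4^-1 ^+ n * 2^-1 ^+ n.
  have h4 : kappa <= 4^-1 * 2^-1 by apply: le_trans kappa8 _; lra.
  have p4 : 0 <= 4^-1 * 2^-1 :> R by lra.
  by rewrite -exprMn lerXn2r// nnegrE.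
rewrite (le_trans (ler_wpM2l (ler0n _ _) h))// mulrA ler_piMl ?exprn_ge0 ?invr_ge0//.
rewrite exprVn ler_pdivrMr ?exprn_gt0// mul1r -natrX ler_nat.
by rewrite (_ : 4 = 2 ^ 2)%N// -expnM mulnC expnM leq_exp2r// ltnW// ltn_expl.
Qed.

Lemma asummable_lie_scaled (c : nat -> R) j : (forall n, `|c n| <= (n ^ 2)%:R + 1) ->
  asummable (fun n => (c n)%:C * lie_coef X n (coord j) z).
Proof.
move=> hc; exists (2 * (2 * rho)); apply: sumle_half; first by rewrite mulr_ge0// ltW.
move=> n; rewrite modulusM modulus_real.
rewrite (le_trans (ler_pM _ _ (hc n) (lie_coef_coord_le n j))) ?modulus_ge0//.
rewrite mulrCA mulrDl mul1r [X in _ <= X](_ : _ = rho * (2^-1 ^+ n + 2^-1 ^+ n)); last by ring.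
by rewrite ler_wpM2l ?(ltW rho0)// lerD ?square_half ?kappa1.
Qed.

(** Term by term, the second-order remainder of [t^n] is at most [n^2] times
    the square of the time step, and [n^2 kappa^n] is summable; the first-order
    term is recognised by the substitution property. *)
Lemma lie_flow_taylor x t : 0 <= x <= 1 -> 0 <= t <= 1 ->
  zbd (fun j => lie_flow x z j - lie_flow t z j - (x - t)%:C * ev (X j) (lie_flow t z))
    (2 * (rho * `|x - t| ^+ 2)).
Proof.
move=> hx ht.
pose v n j := (x ^+ n - t ^+ n - (x - t) * (n%:R * t ^+ n.-1))%:C * lie_coef X n (coord j) z.
have le1 (y : R) n : 0 <= y <= 1 -> `|y ^+ n| <= (n ^ 2)%:R + 1.
  by move=> /andP[y0 y1]; rewrite ger0_norm ?exprn_ge0// (le_trans (exprn_ile1 _ y0 y1))// lerDr.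
have le2 n : `|n%:R * t ^+ n.-1| <= (n ^ 2)%:R + 1.
  have /andP[t0 t1] := ht; rewrite normrM normr_nat ger0_norm ?exprn_ge0//.
  rewrite (@le_trans _ _ (n%:R * 1))// ?ler_wpM2l ?exprn_ile1// mulr1.
  apply: le_trans (_ : (n ^ 2)%:R <= _); last by rewrite lerDl.
  by rewrite ler_nat; case: n => // n; rewrite expnS expn1 leq_pmulr.
have vE j : csum (fun n => v n j) = lie_flow x z j - lie_flow t z j - (x - t)%:C * ev (X j)
  (lie_flow t z).
  have hXj := vnb_component s0 j hX mX; rewrite -[m]mul1n in hXj.
  rewrite -(lie_eval_flow ht hXj) /lie_flow /lie_eval.
  have -> : csum (fun n => lie_term t n (X j) z)
     = csum (fun n => (n%:R * t ^+ n.-1)%:C * lie_coef X n (coord j) z).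
    rewrite [RHS]csum_shift; last exact: asummable_lie_scaled.
    rewrite !mul0r add0r; apply: eq_csum => n; rewrite /lie_term lie_coef_field /=.
    by rewrite mulrA [n.+1%:R * _]mulrC rmorphM/= rmorph_nat.
  rewrite -csumZ; last exact: asummable_lie_scaled.
  rewrite -csumB; last 2 first.
  - by apply: asummable_lie_scaled => n; apply: le1.
  - by apply: asummable_lie_scaled => n; apply: le1.
  rewrite -csumB; last 2 first.
  - apply: (asummable_le (y := fun n => (x ^+ n)%:C * lie_coef X n (coord j) z + (-1) * ((t ^+
    n)%:C * lie_coef X n (coord j) z))).
      by move=> n; rewrite mulN1r.
    apply: asummableD; [|apply: asummableZ]; by apply: asummable_lie_scaled => n; apply: le1.
  - apply: asummableZ; exact: asummable_lie_scaled.
  apply: eq_csum => n; rewrite /v /lie_term !rmorphB !rmorphM /=; ring.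
apply: eq_zbound vE _; apply: (@zbound_csum v (fun n => (n ^ 2)%:R * `|x - t| ^+ 2 * (rho * kappa
  ^+ n))).
  move=> n; have := zboundZ (x ^+ n - t ^+ n - (x - t) * (n%:R * t ^+ n.-1))%:C (lie_coord_bound
    s0 rho1 hX m0 n hz rr).
  move=> h A uA; apply: le_trans (h A uA) _.
  by rewrite modulus_real ler_wpM2r ?power_taylor// mulr_ge0 ?exprn_ge0// ltW.
apply: sumle_half; first by rewrite mulr_ge0 ?exprn_ge0// ltW.
move=> n; rewrite [leLHS](_ : _ = rho * `|x - t| ^+ 2 * ((n ^ 2)%:R * kappa ^+ n)); last by ring.
by rewrite ler_wpM2l ?square_half// mulr_ge0 ?exprn_ge0// ltW.
Qed.

Lemma lie_flow0 j : lie_flow 0 z j = z j.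
Proof.
rewrite /lie_flow /lie_eval (@csum_single _ _ _ 0%N).
  by rewrite /lie_term /lie_coef /invfact expr0 fact0 invr1 !mul1r ev_coordinate.
by move=> n n0; rewrite /lie_term expr0n (negbTE n0) mul0r.
Qed.

Lemma lie_flow_near : zbd (lie_flow 1 z) (r + rho / 7).
Proof.
have h1 : (0 <= 1 :> R) && (1 <= 1 :> R) by rewrite ler01 lexx.
pose v n j := lie_term 1 n.+1 (coord j) z.
have E j : z j + csum (fun n => v n j) = lie_flow 1 z j.
  rewrite /lie_flow /lie_eval [RHS]csum_shift; last by eexists; exact: (asummable_lie_term h1
    (snb_coordinate j)).
  by rewrite /lie_term /lie_coef /invfact expr0 fact0 invr1 !mul1r ev_coordinate.
apply: eq_zbound E _; apply: zboundD => //.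
apply: (@zbound_csum v (fun n => rho * kappa ^+ n.+1)); first by move=> n; apply: lie_term_coord.
have k8 : kappa < 1 by apply: le_lt_trans kappa8 _; lra.
have : sumle (fun n => (rho * kappa) * kappa ^+ n) ((rho * kappa) / (1 - kappa)).
  by apply: sumle_geometric => //; rewrite mulr_ge0// ltW.
apply: le_sumle => [n|]; first by rewrite exprS mulrA.
rewrite -mulrA ler_wpM2l ?(ltW rho0)// ler_pdivrMr ?subr_gt0//.
by move: kappa8; set k := (m%:R / rho * CX) => *; lra.
Qed.

Section Flow.
Variables (H : state -> R[i]) (T : R).
Hypothesis T0 : 0 < T.
Hypothesis HX : forall w r', zbd w r' -> forall j, vector_field H w j = (T^-1)%:C * ev (X j) w.

Lemma vector_field_lipschitz r' : 0 <= r' -> exists2 L, 0 <= L & forall y y' del,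
  zbd y r' -> zbd y' r' -> zbd (fun j => y j - y' j) del ->
  zbd (fun j => vector_field H y j - vector_field H y' j) (L * del).
Proof.
move=> r0; have hfX := vnb_fbd s0 rho1 hX mX.
have [L L0 hL] := @fbound_ev_lipschitz R nonneg d s s0 _ lwt (lwt_gt0 s0) m.+1 _ r0.
exists (T^-1 * (CX * L)).
  by rewrite !mulr_ge0 ?invr_ge0 ?(ltW T0)//; have [] := hfX.
move=> y y' del hy hy' hd.
have := zboundZ (T^-1)%:C (hL _ _ _ _ _ hfX hy hy' hd).
rewrite modulus_real ger0_norm ?invr_ge0 ?(ltW T0)// !mulrA.
by apply: eq_zbound => j; rewrite (HX hy) (HX hy') mulrBr.
Qed.

(** The physical time [T] is absorbed in the field: [X] is the field of [H]
    multiplied by [T], and the Lie series runs over the unit interval. *)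
Lemma lie_flow_is_flow : is_flow s H T z (lie_flow 1 z).
Proof.
pose u x := lie_flow (x / T) z.
have iT : 0 < T^-1 by rewrite invr_gt0.
have r01 x : 0 <= x <= T -> 0 <= x / T <= 1.
  by move=> /andP[x0 xT]; rewrite divr_ge0 ?(ltW T0)//= ler_pdivrMr// mul1r.
have hu : solves s H T z u.
  split; first by apply/funext => j; rewrite /u mul0r lie_flow0.
  move=> tau ht; have hb := lie_flow_bound (r01 _ ht).
  have hv : zbd (vector_field H (u tau)) (T^-1 * (CX * geom m.+1 (2 * rho))).
    have := zboundZ (T^-1)%:C (fbound_ev_le s0 (lwt_gt0 s0) (vnb_fbd s0 rho1 hX mX) hb).
    rewrite modulus_real ger0_norm ?(ltW iT)//.
    by apply: eq_zbound => j; rewrite (HX hb).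
  split; first by apply/l1P; eexists; exact: hb.
  split; first by apply/l1P; eexists; exact: hv.
  move=> e e0.
  have d0 : 0 < e * T ^+ 2 / (2 * rho) by rewrite divr_gt0 ?mulr_gt0 ?exprn_gt0.
  apply/nbhs_ballP; exists (e * T ^+ 2 / (2 * rho)) => //= x; rewrite /ball/= => xd hx.
  apply/l1normP.
  have := lie_flow_taylor (r01 _ hx) (r01 _ ht).
  have E j : lie_flow (x / T) z j - lie_flow (tau / T) z j
      - (x / T - tau / T)%:C * ev (X j) (lie_flow (tau / T) z)
     = u x j - u tau j - (x - tau)%:C * vector_field H (u tau) j.
    by rewrite (HX hb) mulrA -(rmorphM (real_complex R)) -mulrBl.
  move/(eq_zbound E) => h A uA; apply: le_trans (h A uA) _.
  rewrite -mulrBl normrM (ger0_norm (ltW iT)) expr2.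
  move: xd; rewrite distrC ltr_pdivlMr ?mulr_gt0// => /ltW xd.
  rewrite [leLHS](_ : _ = (`|x - tau| * (2 * rho)) * T^-1 ^+ 2 * `|x - tau|); last by ring.
  by rewrite ler_wpM2r// exprVn ler_pdivrMr ?exprn_gt0.
split; first by exists u.
move=> v hv; have := solves_unique s0 (ltW T0) vector_field_lipschitz hu hv (x := T).
by rewrite lexx (ltW T0) => /(_ isT) <-; rewrite /u divff ?gt_eqF.
Qed.

End Flow.

End At.

End LieFlow.

(** * Size of the terms of the recursion *)

Section BchBounds.
Variables (R : realType) (nonneg : bool) (d : nat) (s rho : R).
Hypothesis s0 : 0 <= s.
Hypothesis rho1 : 1 <= rho.
Local Notation letter := (phase_index nonneg d).
Local Notation mom := (@lmom nonneg d).
Local Notation J := (@letters_of nonneg d).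
Local Notation lwt := (@lwt R nonneg d s).
Local Notation field := (letter -> seq letter -> R[i]).
Local Notation vnb := (@nbound R nonneg d s rho _ J lwt).
Local Notation zderiv := (wderiv mom J 0).
Local Notation bracket := (@bracket R[i] _ _ mom J).
Local Notation gad := (@gad R[i] _ _ mom J).
Local Notation bch := (@bch R[i] _ _ mom J).
Local Notation fzero := (@fzero R[i] letter).

Let rho0 : 0 < rho := lt_le_trans ltr01 rho1.
Let lwt_ge0' : forall j, 0 <= lwt j := lwt_ge0 s0.

(** A bracket of fields of degrees [e] and [f] costs [(e + f) / rho]; up to
    grade [N] this is at most the constant [c] below, whatever the number of
    brackets already taken. *)
Lemma vnb_bracket X Y C D e f : vnb X C e -> vnb Y D f ->
  vnb (bracket X Y) ((e + f)%:R / rho * (C * D)) (e + f).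
Proof.
move=> hX hY.
have h1 := nbound_wderiv s0 rho0 lwt_ge0' hX hY.
have h2 := nboundZ (-1) (nbound_wderiv s0 rho0 lwt_ge0' hY hX); rewrite addnC in h2.
have := nboundD lwt_ge0' h2 h1; rewrite modulusN modulus1 mul1r.
rewrite [(f + e)%N]addnC => h; apply: nbound_le (leqnn _) _; last first.
  by apply: eq_nbound h => j w; rewrite /bracket mulN1r addrC.
by rewrite natrD; lra.
Qed.

Lemma vnb_fsum n (X : nat -> field) C e : (forall i, (i < n)%N -> vnb (X i) (C i) e) ->
  vnb (fsum n X) (\sum_(i < n) C i) e.
Proof.
move=> h; have h' (i : 'I_n) : vnb (X i) (C i) e by apply: h.
exact: (nbound_sum lwt_ge0' (index_enum 'I_n) h').
Qed.

Variables (N r : nat).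
Hypothesis r0 : (0 < r)%N.
Let c : R := (N * r)%:R / rho.

Let c0 : 0 <= c. Proof. by rewrite divr_ge0// ltW. Qed.

(** Grade [n] has degree at most [n r], each factor [A] or [B] raising the
    degree by [r] at most. *)
Definition graded_bound K (Z : nat -> field) (zeta : {poly R}) :=
  forall n, (n <= K)%N -> vnb (Z n) zeta`_n (n * r).

(** Iterated brackets are bounded by products of the bounding series, with one
    factor [c] for each bracket. *)
Lemma gad_bound K Z W zeta omega k : (K <= N)%N ->
  nonneg_poly zeta -> nonneg_poly omega ->
  graded_bound K Z zeta -> graded_bound K W omega ->
  graded_bound K (gad Z k W) (c ^+ k *: (zeta ^+ k * omega)).
Proof.
move=> KN z0 w0 hZ hW; elim: k => [|k IH] n nN.
  by rewrite !expr0 scale1r mul1r; exact: hW.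
have -> : (c ^+ k.+1 *: (zeta ^+ k.+1 * omega))`_n
   = \sum_(i < n.+1) c * (zeta`_i * (c ^+ k *: (zeta ^+ k * omega))`_(n - i)).
  rewrite exprS [zeta ^+ k.+1]exprS -mulrA -scalerA scalerAr coefZ coefM mulr_sumr.
  by apply: eq_bigr.
apply: (@vnb_fsum n.+1 _ (fun i => c * (zeta`_i * (c ^+ k *: (zeta ^+ k * omega))`_(n - i)))) =>
  i; rewrite ltnS => iN.
have h1 : vnb (Z i) _ _ := hZ i (leq_trans iN nN).
have h2 : vnb (gad Z k W (n - i)) _ _ := IH (n - i)%N (leq_trans (leq_subr _ _) nN).
have := vnb_bracket h1 h2; rewrite -mulnDl subnKC//; apply: nbound_le => //.
rewrite ler_wpM2r//.
  by rewrite mulr_ge0 ?(nbound_ge0 rho0 h1) ?(nbound_ge0 rho0 h2).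
by rewrite /c ler_wpM2r ?invr_ge0 ?(ltW rho0)// ler_nat leq_mul2r (leq_trans nN KN) orbT.
Qed.

Variables (A B : field) (eta : R).
Hypothesis hA : vnb A eta r.
Hypothesis hB : vnb B eta r.

Let eta0 : 0 <= eta := nbound_ge0 rho0 hA.

(** The scalar series obtained from the recursion by replacing every field by
    its bound, every bracket by [c] times a product, and the factorials by one.
    The factor [n] from the grading operator cancels the division by [n]. *)
Definition picard_step (zeta : {poly R}) : {poly R} :=
  eta *: 'X + (\sum_(k < N) c ^+ k *: zeta ^+ k) * (eta *: 'X)
    + \sum_(k < N) c ^+ k.+1 *: zeta ^+ k.+2.

Definition picard (m : nat) : {poly R} := iter m picard_step 0.

Lemma nonneg_polyX a : 0 <= a -> nonneg_poly (a *: 'X : {poly R}).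
Proof. by move=> a0 n; rewrite coefZ coefX mulr_ge0. Qed.

Lemma nonneg_poly_exp (b : {poly R}) n : nonneg_poly b -> nonneg_poly (b ^+ n).
Proof.
move=> b0; elim: n => [|n IH]; last by rewrite exprS; apply: nonneg_polyM.
by move=> n; rewrite expr0 coef1.
Qed.

Lemma nonneg_poly_sum n (b : nat -> {poly R}) : (forall i, nonneg_poly (b i)) ->
  nonneg_poly (\sum_(i < n) b i).
Proof. by move=> h m; rewrite coef_sum sumr_ge0// => i _; apply: h. Qed.

Lemma nonneg_picard m : nonneg_poly (picard m).
Proof.
elim: m => [|m IH]; first by move=> n; rewrite coef0.
have p k l : nonneg_poly (c ^+ k *: picard m ^+ l).
  by apply: nonneg_polyZ; [exact: exprn_ge0|exact: nonneg_poly_exp].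
rewrite /picard /= -/(picard m); apply: nonneg_polyD; first apply: nonneg_polyD.
- exact: nonneg_polyX.
- by apply: nonneg_polyM; [apply: (@nonneg_poly_sum N (fun k => c ^+ k *: picard m ^+ k))|exact:
  nonneg_polyX].
- exact: (@nonneg_poly_sum N (fun k => c ^+ k.+1 *: picard m ^+ k.+2)).
Qed.

Lemma at_grade1_bound X : vnb X eta r -> graded_bound N (at_grade1 X) (eta *: 'X).
Proof.
move=> hX n nN; rewrite /at_grade1 coefZ coefX; case: eqP => [->|_].
  by rewrite mulr1 mul1n.
by rewrite mulr0; apply: nbound0.
Qed.

Lemma bch_bound m : graded_bound N (bch A B m) (picard m).
Proof.
elim: m => [|m IH] n nN; first by rewrite coef0; apply: nbound0.
have [->|n0] := posnP n.
  rewrite bch_at0; by apply: (nbound_le _ (leq0n _) (nbound0 nonneg s rho J lwt 0)); exact: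
    nonneg_picard.
have z0 := nonneg_picard m.
have B1 k : vnb (fscale (invfact R[i] k) (gad (bch A B m) k (at_grade1 B) n))
    (c ^+ k *: (picard m ^+ k * (eta *: 'X)))`_n (n * r).
  have h := gad_bound k (leqnn N) z0 (nonneg_polyX eta0) IH (at_grade1_bound hB) nN.
  apply: (nbound_le _ (leqnn _) (nboundZ (invfact R[i] k) h)).
  rewrite modulus_invfact ler_piMl ?(nbound_ge0 rho0 h)//.
  by rewrite invf_le1 ?ltr0n ?fact_gt0// ler1n fact_gt0.
have hE : graded_bound n (euler (bch A B m)) (n%:R *: picard m).
  move=> i iN; have h := IH i (leq_trans iN nN).
  apply: (nbound_le _ (leqnn _) (nboundZ (i%:R) h)).
  by rewrite modulus_nat coefZ ler_wpM2r ?ler_nat// (nbound_ge0 rho0 h).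
have B2 k : vnb (fscale (invfact R[i] k.+2) (gad (bch A B m) k.+1 (euler (bch A B m)) n))
    (n%:R * (c ^+ k.+1 *: picard m ^+ k.+2)`_n) (n * r).
  have IHn : graded_bound n (bch A B m) (picard m) by move=> i iN; apply/IH/(leq_trans iN).
  have h := gad_bound k.+1 nN z0 (nonneg_polyZ (ler0n _ _) z0) IHn hE (leqnn n).
  apply: (nbound_le _ (leqnn _) (nboundZ (invfact R[i] k.+2) h)).
  rewrite modulus_invfact (le_trans (ler_piMl (nbound_ge0 rho0 h) _))//.
    by rewrite invf_le1 ?ltr0n ?fact_gt0// ler1n fact_gt0.
  by rewrite -scalerAr -exprSr scalerA mulrC -scalerA coefZ.
pose S1 := \sum_(k < n) (c ^+ k *: (picard m ^+ k * (eta *: 'X)))`_n.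
pose S2 := \sum_(k < n.-1) n%:R * (c ^+ k.+1 *: picard m ^+ k.+2)`_n.
have h1 := @vnb_fsum n _ _ _ (fun k _ => B1 k).
have h2 := @vnb_fsum n.-1 _ _ _ (fun k _ => B2 k).
have hb := nboundZ n%:R^-1 (nboundD lwt_ge0' (nboundD lwt_ge0' (at_grade1_bound hA nN) h1)
  (nboundZ (-1) h2)).
apply: (nbound_le _ (leqnn _) hb).
rewrite modulusN modulus1 mul1r modulusV modulus_nat.
have cf k : 0 <= (c ^+ k *: (picard m ^+ k * (eta *: 'X)))`_n.
  by apply: nonneg_polyZ; [exact: exprn_ge0|apply: nonneg_polyM; [exact: nonneg_poly_exp|exact:
    nonneg_polyX]].
have cg k : 0 <= (c ^+ k.+1 *: picard m ^+ k.+2)`_n.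
  by apply: nonneg_polyZ; [exact: exprn_ge0|exact: nonneg_poly_exp].
have widen (F : nat -> R) k : (forall i, 0 <= F i) -> (k <= N)%N -> \sum_(i < k) F i <= \sum_(i <
  N) F i.
  move=> F0 kN; rewrite (big_ord_widen _ _ kN) big_mkcond /=; apply: ler_sum => i _.
  by case: ifP.
rewrite /picard /= -/(picard m) /picard_step mulr_suml !coefD !coef_sum mulrDr lerD//.
  rewrite (le_trans (ler_piMl _ _))//.
  - by rewrite addr_ge0 ?sumr_ge0//; apply: nonneg_polyX.
  - by rewrite invf_le1 ?ltr0n// ler1n.
  rewrite lerD//; under [leRHS]eq_bigr => k _ do rewrite -scalerAl.
  exact: (widen (fun k => (c ^+ k *: (picard m ^+ k * (eta *: 'X)))`_n)).
rewrite -mulr_sumr mulKf ?pnatr_eq0 -?lt0n//.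
by apply: (widen (fun k => (c ^+ k.+1 *: picard m ^+ k.+2)`_n)) => //; lia.
Qed.

(** At the point [tau], one step sends values at most [4 tau eta] into
    themselves: with [u = tau eta] and geometric series of ratio 1/8 the three
    terms add up to at most [u + 8u/7 + 4u/7]. *)
Lemma picard_value m tau : 0 <= tau -> c * (4 * tau * eta) <= 8^-1 ->
  (picard m).[tau] <= 4 * tau * eta.
Proof.
move=> tau0 hc; set y := 4 * tau * eta in hc *.
have y0 : 0 <= y by rewrite !mulr_ge0.
elim: m => [|m IH]; first by rewrite horner0.
have p0 : 0 <= (picard m).[tau] by apply: nonneg_horner => //; exact: nonneg_picard.
set q := (picard m).[tau] in IH p0.
have x0 : 0 <= c * y by rewrite mulr_ge0.
have cq k : c ^+ k * q ^+ k <= 8^-1 ^+ k.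
  have hq : c * q <= 8^-1 by apply: le_trans hc; rewrite ler_wpM2l.
  have q0 : 0 <= c * q by apply: mulr_ge0.
  by rewrite -exprMn lerXn2r// nnegrE invr_ge0.
have gs : \sum_(k < N) 8^-1 ^+ k <= 8 / 7 :> R.
  have := @sumle_geometric R 8^-1 1 _ _ ler01; rewrite invr_ge0 ler0n => /(_ isT).
  have -> : (8^-1 < 1 :> R) by lra.
  move=> /(_ isT) /(_ (iota 0 N)); rewrite iota_uniq sum_iota => /(_ isT).
  under eq_bigr do rewrite mul1r; move=> h; apply: le_trans h _.
  by rewrite (_ : 1 - 8^-1 = 7 / 8 :> R) ?mul1r ?invf_div//; field.
rewrite /picard /= -/(picard m) /picard_step !hornerD hornerM !hornerZ hornerX !horner_sum.
have h1 : \sum_(k < N) (c ^+ k *: picard m ^+ k).[tau] <= 8 / 7.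
  by apply: le_trans gs; apply: ler_sum => k _; rewrite hornerZ horner_exp.
have h2 : \sum_(k < N) (c ^+ k.+1 *: picard m ^+ k.+2).[tau] <= y * 8^-1 * (8 / 7).
  apply: (@le_trans _ _ (y * 8^-1 * \sum_(k < N) 8^-1 ^+ k)); last first.
    by rewrite ler_wpM2l// mulr_ge0// invr_ge0.
  rewrite mulr_sumr; apply: ler_sum => k _; rewrite hornerZ horner_exp -/q.
  rewrite [q ^+ _]exprS mulrCA -mulrA -exprS; apply: ler_pM => //.
  by rewrite mulr_ge0 ?exprn_ge0.
have h3 : (\sum_(k < N) (c ^+ k *: picard m ^+ k).[tau]) * (eta * tau) <= 8 / 7 * (eta * tau).
  by rewrite ler_wpM2r// mulr_ge0.
move: h2 h3; rewrite /y; set u := eta * tau.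
have u0 : 0 <= u by rewrite mulr_ge0.
have -> : 4 * tau * eta = 4 * u by rewrite /u; ring.
move=> *; lra.
Qed.

End BchBounds.

(** * Comparison of the two expansions *)

Lemma le_of_eq (R : porderType ring_display) (x y : R) : x = y -> x <= y.
Proof. by move=> ->. Qed.

Section SplittingError.
Variables (R : realType) (nonneg : bool) (d : nat) (s rho : R).
Hypothesis s0 : 0 <= s.
Hypothesis rho1 : 1 <= rho.
Local Notation letter := (phase_index nonneg d).
Local Notation mom := (@lmom nonneg d).
Local Notation J := (@letters_of nonneg d).
Local Notation lwt := (@lwt R nonneg d s).
Local Notation array := (seq letter -> R[i]).
Local Notation field := (letter -> seq letter -> R[i]).
Local Notation state := (letter -> R[i]).
Local Notation vnb := (@nbound R nonneg d s rho _ J lwt).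
Local Notation zbd := (@zbound R nonneg d s).
Local Notation zderiv := (wderiv mom J 0).
Local Notation bracket := (@bracket R[i] _ _ mom J).
Local Notation gad := (@gad R[i] _ _ mom J).
Local Notation bch := (@bch R[i] _ _ mom J).
Local Notation bch_poly := (@bch_poly R[i] _ _ mom J).
Local Notation op := (@op R[i] _ _ mom J).
Local Notation fzero := (@fzero R[i] letter).
Local Notation coord := (@coordinate R[i] letter).
Local Notation supp0 := (@msupp R nonneg d 0).

Let rho0 : 0 < rho := lt_le_trans ltr01 rho1.
Let lwt_ge0' : forall j, 0 <= lwt j := lwt_ge0 s0.

Lemma msupp_fzero : supp0 fzero.
Proof. by move=> j w; rewrite eqxx. Qed.

Lemma msupp_fadd X Y : supp0 X -> supp0 Y -> supp0 (fadd X Y).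
Proof.
move=> hX hY j w; rewrite /fadd; case: (eqVneq (X j w) 0) => [->|/hX//].
by rewrite add0r; apply: hY.
Qed.

Lemma msupp_fscale a X : supp0 X -> supp0 (fscale a X).
Proof.
by move=> hX j w; rewrite /fscale mulf_eq0 negb_or => /andP[_]; apply: hX.
Qed.

Lemma msupp_fsum n (X : nat -> field) : (forall i, supp0 (X i)) -> supp0 (fsum n X).
Proof.
move=> hX j w; case: (eqVneq (lmom j) (0 + momw mom w)) => // jw.
rewrite /fsum big1 ?eqxx// => i _; apply/eqP/negPn/negP => /hX e.
by rewrite e eqxx in jw.
Qed.

Lemma msupp_bracket X Y : supp0 X -> supp0 Y -> supp0 (bracket X Y).
Proof.
move=> hX hY j w; case: (eqVneq (lmom j) (0 + momw mom w)) => // jw.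
have z U V : supp0 V -> zderiv U (V j) w = 0.
  move=> hV; apply/eqP/negPn/negP => h.
  have e : lmom j = momw mom w by apply: wderiv_supported h => v /hV; rewrite add0r.
  by rewrite e add0r eqxx in jw.
by rewrite /bracket !z// subrr eqxx.
Qed.

Lemma msupp_gad Z k W : (forall n, supp0 (Z n)) -> (forall n, supp0 (W n)) ->
  forall n, supp0 (gad Z k W n).
Proof.
move=> hZ hW; elim: k => [//|k IH] n.
by apply: (@msupp_fsum n.+1 (fun i => bracket (Z i) (gad Z k W (n - i)))) => i; apply:
  msupp_bracket.
Qed.

Variables (A B : field).
Hypothesis mA : supp0 A.
Hypothesis mB : supp0 B.

Lemma msupp_bch m n : supp0 (bch A B m n).
Proof.
have h1 X n' : supp0 X -> supp0 (at_grade1 X n').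
  by rewrite /at_grade1; case: ifP => // _ _; apply: msupp_fzero.
elim: m n => [|m IH] n; first exact: msupp_fzero.
apply: msupp_fscale; apply: msupp_fadd; first apply: msupp_fadd; first exact: h1.
  apply: (@msupp_fsum n (fun k => fscale (invfact R[i] k) (gad (bch A B m) k (at_grade1 B) n)))
    => k.
  by apply: msupp_fscale; apply: msupp_gad => // n'; apply: h1.
apply: msupp_fscale.
apply: (@msupp_fsum n.-1 (fun k => fscale (invfact R[i] k.+2) (gad (bch A B m) k.+1 (euler (bch A
  B m)) n))) => k.
by apply: msupp_fscale; apply: msupp_gad => // n'; apply: msupp_fscale.
Qed.

Variables (N r : nat) (eta tau : R).
Hypothesis N0 : (0 < N)%N.
Hypothesis r0 : (0 < r)%N.
Hypothesis hA : vnb A eta r.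
Hypothesis hB : vnb B eta r.
Hypothesis tau1 : 1 <= tau.
Let c : R := (N * r)%:R / rho.
Hypothesis small : c * (4 * tau * eta) <= 8^-1.

Let c0 : 0 <= c. Proof. by rewrite divr_ge0// ltW. Qed.
Let eta0 : 0 <= eta := nbound_ge0 rho0 hA.
Let tau0 : 0 < tau := lt_le_trans ltr01 tau1.
Local Notation zeta := (picard rho N r eta N).

Definition bch_sum : field := fsum N.+1 (bch A B N).

Lemma msupp_bch_sum : supp0 bch_sum.
Proof. by apply: msupp_fsum => i; apply: msupp_bch. Qed.

Let zetaP : nonneg_poly zeta := nonneg_picard rho1 N hA N.
Let zeta_tau : zeta.[tau] <= 4 * tau * eta.
Proof. exact: (picard_value rho1 hA N (ltW tau0) small). Qed.

Lemma sum_coef_le (p : {poly R}) n x : nonneg_poly p -> 0 <= x ->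
  \sum_(i < n) p`_i * x ^+ i <= p.[x].
Proof.
move=> p0 x0; rewrite (horner_coef_wide _ (leq_maxl (size p) n)).
rewrite (big_ord_widen _ (fun i => p`_i * x ^+ i) (leq_maxr (size p) n)) big_mkcond /=.
by apply: ler_sum => i _; case: ifP => // _; rewrite mulr_ge0 ?exprn_ge0.
Qed.

Lemma vnb_bch_sum : vnb bch_sum (4 * tau * eta) (N * r).
Proof.
have h i : (i < N.+1)%N -> vnb (bch A B N i) zeta`_i (N * r).
  rewrite ltnS => iN; apply: (nbound_le (lexx _) _ (bch_bound s0 rho1 r0 hA hB N iN)).
  by rewrite leq_mul2r iN orbT.
apply: (nbound_le _ (leqnn _) (vnb_fsum s0 h)).
apply: le_trans zeta_tau; apply: le_trans (sum_coef_le N.+1 zetaP (ltW tau0)).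
by apply: ler_sum => i _; rewrite ler_peMr// exprn_ege1.
Qed.

Lemma small_factor : 2 * (r%:R / rho * eta) * tau <= 16^-1.
Proof.
have rc : r%:R / rho <= c by rewrite ler_wpM2r ?invr_ge0 ?(ltW rho0)// ler_nat leq_pmull.
have := ler_wpM2r (mulr_ge0 eta0 (ltW tau0)) rc.
move: small; set u := c * _; set v := c * (eta * tau); set w := r%:R / rho * (eta * tau) => h1 h2.
have e1 : u = 4 * v by rewrite /u /v; ring.
have e2 : 2 * (r%:R / rho * eta) * tau = 2 * w by rewrite /w; ring.
rewrite e2; move: h1 h2; rewrite e1 => *; lra.
Qed.

Lemma small_lie : r%:R / rho * eta <= 8^-1.
Proof.
have k0 : 0 <= r%:R / rho * eta by rewrite !mulr_ge0 ?invr_ge0 ?(ltW rho0).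
have := small_factor; move: k0; set k := r%:R / rho * eta; move: (k) => {}k k0 h.
have : 2 * k <= 2 * k * tau by rewrite ler_peMr// mulr_ge0.
move=> *; lra.
Qed.

(** A power of the truncated series is a sum of words of [k] operators; the
    [i]-th one acts on a series of degree at most [i N r] and costs [i c], so the
    word costs [k! c^k], and the factorial of the exponential series removes the
    [k!]. *)
Lemma bch_power_bound k g :
  vnb (fun j => (bch_poly A B N ^+ k)`_g (coord j))
    ((k`!)%:R * (rho * (c ^+ k *: zeta ^+ k)`_g)) (k.+1 * (N * r)).
Proof.
have Nr0 : (0 < N * r)%N by rewrite muln_gt0 N0.
elim: k g => [|k IH] g.
  rewrite !expr0 scale1r !coef1; case: (g == 0%N); last by rewrite !mulr0; apply: nbound0.
  by rewrite mulr1 mul1r; apply: (nbound_le (lexx _) _ (nbound_coordinate nonneg d s rho));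
    rewrite mul1n.
have h (i : 'I_g.+1) : vnb (fun j => (bch_poly A B N)`_i ((bch_poly A B N ^+ k)`_(g - i) (coord
  j)))
   ((k.+1)%:R * c * ((k`!)%:R * (rho * (c ^+ k *: zeta ^+ k)`_(g - i))) * zeta`_i) (k.+2 * (N *
     r)).
  have hi := IH (g - i)%N.
  rewrite coef_poly; case: ifP => iN; last first.
    apply: (nbound_le _ (leqnn _) (nbound0 nonneg s rho J lwt _)).
    by rewrite mulr_ge0// mulr_ge0 ?(nbound_ge0 rho0 hi)// mulr_ge0.
  have iN' : (i <= N)%N := iN.
  have := nbound_wderiv s0 rho0 lwt_ge0' (bch_bound s0 rho1 r0 hA hB N iN') hi.
  move=> hh; refine (nbound_le _ _ hh).
    by rewrite /c natrM; apply: le_of_eq; ring.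
  by rewrite [(k.+2 * _)%N]mulSn addnC leq_add2r leq_mul2r -ltnS iN orbT.
apply: (nbound_le _ (leqnn _) (eq_nbound _ (nbound_sum lwt_ge0' (index_enum 'I_g.+1) h))).
  rewrite factS natrM [c ^+ k.+1]exprS [zeta ^+ k.+1]exprS -scalerA scalerAr coefZ coefM
    !mulr_sumr.
  apply: le_of_eq; apply: eq_bigr => i _; ring.
by move=> j w; rewrite exprS coefM endo_sumE.
Qed.

Local Notation D X n := (iter n (zderiv X)).

Lemma op_iter X n f : (op X ^+ n) f = D X n f.
Proof. by elim: n => [//|n IH]; rewrite endo_exprS IH. Qed.

Lemma size_bch_power k : (size (bch_poly A B N ^+ k)%R <= (k * N).+1)%N.
Proof.
rewrite (leq_trans (size_poly_exp_leq _ _))// ltnS mulnC leq_mul2l.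
have sz : (size (bch_poly A B N) <= N.+1)%N by apply: size_poly.
by rewrite -subn1 leq_subLR add1n sz orbT.
Qed.

Lemma bch_sum_power k f w :
  D bch_sum k f w = \sum_(g < (k * N).+1) (bch_poly A B N ^+ k)`_g f w.
Proof.
rewrite -op_iter -endo_sumE; congr (endo_fun _ f w).
have -> : op bch_sum = (bch_poly A B N).[1].
  by rewrite /bch_sum op_sum horner_poly; apply: eq_bigr => i _; rewrite expr1n mulr1.
rewrite -horner_exp_comm; last by rewrite /comm_poly mul1r mulr1.
rewrite (horner_coef_wide _ (size_bch_power k)).
by apply: eq_bigr => g _; rewrite expr1n mulr1.
Qed.

Lemma bch_power_low k g : (g < k)%N -> (bch_poly A B N ^+ k)`_g = 0.
Proof.
move=> gk; apply: (low_order_exp _ gk) => n; rewrite ltnS leqn0 => /eqP ->.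
by rewrite coef_poly bch_at0 op0.
Qed.

(** Operators that keep the momentum of a power series.  Bounds on families
    only see the letters compatible with the momentum of a word, so this support
    property is needed before values can be estimated. *)
Definition momentum_op (a : endo R[i] letter) := forall f p,
  (forall v, f v != 0 -> p = momw mom v) -> forall w, a f w != 0 -> p = momw mom w.

Lemma momentum_op_sum n (a : nat -> endo R[i] letter) : (forall i, momentum_op (a i)) ->
  momentum_op (\sum_(i < n) a i).
Proof.
move=> h f p hf w; case: (eqVneq p (momw mom w)) => // pw.
rewrite endo_sumE big1 ?eqxx// => i _; apply/eqP/negPn/negP => /h - /(_ _ hf) e.
by rewrite e eqxx in pw.
Qed.

Lemma momentum_op_field X : momentum_op (op X).
Proof. by move=> f p hf w; apply: wderiv_supported. Qed.

Lemma momentum_op_bch k g : momentum_op (bch_poly A B N ^+ k)`_g.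
Proof.
elim: k g => [|k IH] g.
  rewrite expr0 coef1; case: (g == 0%N); first by move=> f p hf w; exact: hf.
  by move=> f p _ w; rewrite eqxx.
rewrite exprS coefM.
apply: (@momentum_op_sum g.+1 (fun i => (bch_poly A B N)`_i * (bch_poly A B N ^+ k)`_(g - i))) =>
  i f p hf w.
rewrite endoME coef_poly; case: ifP => _; last by rewrite eqxx.
by apply: momentum_op_field; apply: IH.
Qed.

Lemma momentum_op_iter X n : momentum_op (op X ^+ n).
Proof.
elim: n => [|n IH] f p hf w; first exact: hf.
by rewrite endo_exprS; apply: momentum_op_field; apply: IH.
Qed.

Lemma momentum_op_coord a : momentum_op a -> supp0 (fun j => a (coord j)).
Proof.
by move=> ha j w; rewrite add0r; apply: ha => v; have := @msupp_coord R nonneg d j v; rewrite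
  add0r.
Qed.

Definition bounded_array (f : array) := exists C e, @abound R nonneg d s f C e.

Lemma ev_lincomb (T : Type) (l : seq T) (a : T -> R[i]) (F : T -> array) z q :
  (forall t, bounded_array (F t)) -> zbd z q ->
  ev (fun w => \sum_(t <- l) a t * F t w) z = \sum_(t <- l) a t * ev (F t) z.
Proof.
move=> hF hz.
suff [_ ->] : bounded_array (fun w => \sum_(t <- l) a t * F t w) /\
    ev (fun w => \sum_(t <- l) a t * F t w) z = \sum_(t <- l) a t * ev (F t) z by [].
elim: l => [|t l [[C [e IHt]] IHe]].
  have E : (fun w => \sum_(t <- [::]) a t * F t w) = fun=> 0.
    by apply/funext => w; rewrite big_nil.
  by rewrite E big_nil ev0; split=> //; exists 0, 0%N; apply: abound0.
have E : (fun w => \sum_(t <- t :: l) a t * F t w) = fun w => a t * F t w + \sum_(t <- l) a t * F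
  t w.
  by apply/funext => w; rewrite big_cons.
have [D [f hD]] := hF t.
have h1 := abound_weaken s0 (lexx _) (leq_maxl e f) IHt.
have h2 := abound_weaken s0 (lexx _) (leq_maxr e f) (aboundZ (a t) hD).
rewrite E big_cons (evD s0 h2 h1 hz) (evZ s0 _ hD hz) IHe; split=> //.
by eexists; eexists; exact: (aboundD h2 h1).
Qed.

Lemma bounded_array_vnb F C e j : vnb F C e -> supp0 F -> bounded_array (F j).
Proof.
move=> hF mF; eexists; eexists; exact: (snb_abd s0 rho1 (vnb_component s0 j hF mF)).
Qed.

Local Notation kappa := (r%:R / rho * eta).

(** The counterpart of [bch_power_bound] for words in [A] and [B] only. *)
Lemma word_vnb m n : vnb (fun j => (op A ^+ m * op B ^+ n) (coord j))
  ((rho * kappa ^+ n * (\prod_(i < n) (0 + i).+1)%:R) * kappa ^+ m * (\prod_(i < m) (n +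
    i).+1)%:R)
  ((n + m).+1 * r).
Proof.
have h1 := nbound_iter s0 rho1 hB n lwt_ge0' (nbound_coordinate_mul nonneg d s rho r0).
have h2 := nbound_iter s0 rho1 hA m lwt_ge0' h1.
by refine (eq_nbound _ h2) => j w; rewrite endoME !op_iter.
Qed.

Section At.
Variable z : state.
Hypothesis hz : zbd z (rho / 2).

Let hz1 : rho / 2 <= rho.
Proof. by rewrite ler_pdivrMr// ler_peMr ?(ltW rho0)//; lra. Qed.

Definition word_term m n : state := fun j =>
  invfact R[i] n * (invfact R[i] m * ev ((op A ^+ m * op B ^+ n) (coord j)) z).

Definition bch_term k g : state := fun j =>
  invfact R[i] k * ev ((bch_poly A B N ^+ k)`_g (coord j)) z.

Lemma bounded_array_word m n j : bounded_array ((op A ^+ m * op B ^+ n) (coord j)).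
Proof.
apply: (bounded_array_vnb j (word_vnb m n)); apply: momentum_op_coord => f p hf w.
by rewrite endoME; apply: momentum_op_iter; apply: momentum_op_iter.
Qed.

Lemma bounded_array_bch k g j : bounded_array ((bch_poly A B N ^+ k)`_g (coord j)).
Proof.
by apply: (bounded_array_vnb j (bch_power_bound k g)); apply: momentum_op_coord; apply:
  momentum_op_bch.
Qed.

Lemma word_term_bound m n : zbd (word_term m n) (rho * (2 * kappa) ^+ (m + n)).
Proof.
have ms : supp0 (fun j => (op A ^+ m * op B ^+ n) (coord j)).
  apply: momentum_op_coord => f p hf w.
  by rewrite endoME; apply: momentum_op_iter; apply: momentum_op_iter.
have := vnb_ev s0 rho1 (word_vnb m n) ms hz hz1.
move=> /(zboundZ (invfact R[i] m)) /(zboundZ (invfact R[i] n)) h U uU.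
apply: le_trans (h U uU) _; rewrite !modulus_invfact.
have e0 := invfact_prod0 R n; have e1 := invfact_prod R n m.
have k0 : 0 <= kappa by rewrite !mulr_ge0 ?invr_ge0 ?(ltW rho0).
set x := invfact R m * _ in e1; set y := invfact R n * _ in e0.
rewrite [leLHS](_ : _ = y * x * (rho * kappa ^+ (n + m))); last by rewrite /x /y exprD; ring.
rewrite e0 mul1r [(2 * kappa) ^+ _]exprMn [(m + n)%N]addnC [leRHS](_ : _ = 2 ^+ (n + m) * (rho *
  kappa ^+ (n + m))); last by ring.
by rewrite ler_wpM2r// mulr_ge0 ?(ltW rho0)// exprn_ge0.
Qed.

Lemma bch_term_bound k g : zbd (bch_term k g) (rho * (c ^+ k *: zeta ^+ k)`_g).
Proof.
have := vnb_ev s0 rho1 (bch_power_bound k g) (momentum_op_coord (@momentum_op_bch k g)) hz hz1.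
move=> /(zboundZ (invfact R[i] k)) h U uU.
apply: le_trans (h U uU) _; rewrite modulus_invfact mulrA /invfact mulVf ?mul1r//.
Qed.

Lemma bch_term0 k g j : (bch_poly A B N ^+ k)`_g = 0 -> bch_term k g j = 0.
Proof. by move=> e; rewrite /bch_term e (eq_ev (g := fun=> 0)) ?ev0 ?mulr0. Qed.

Definition split_step : state := lie_flow A 1 z.

Lemma split_step_bound : zbd split_step rho.
Proof.
have h := lie_flow_near s0 rho1 hA r0 small_lie hz hz1.
move=> U uU; apply: le_trans (h U uU) _; move: rho0 => p; lra.
Qed.

Lemma one_in_unit_interval : (0 <= 1 :> R) && (1 <= 1 :> R). Proof. by rewrite ler01 lexx. Qed.

Lemma split_flowE j : lie_flow B 1 split_step j = csum (fun n => csum (fun m => word_term m n j)).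
Proof.
rewrite /lie_flow /lie_eval; apply: eq_csum => n.
rewrite /lie_term expr1n mul1r /lie_coef /split_step.
have h1 := nbound_iter s0 rho1 hB n lwt_ge0' (nbound_coordinate_mul nonneg d s rho r0).
have h2 := vnb_component s0 j h1 (@msupp_iter R nonneg d B _ n (@msupp_coord R nonneg d)).
rewrite -(lie_eval_flow s0 rho1 hA r0 small_lie hz hz1 one_in_unit_interval h2).
rewrite -csumZ; last first.
  by eexists; exact: (asummable_lie_term s0 rho1 hA small_lie hz hz1 one_in_unit_interval h2).
apply: eq_csum => m; rewrite /word_term /lie_term expr1n mul1r /lie_coef.
by rewrite endoME !op_iter.
Qed.

Lemma bch_flowE j : lie_flow bch_sum 1 z j = csum (fun k => \sum_(g < (k * N).+1) bch_term k g j).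
Proof.
rewrite /lie_flow /lie_eval; apply: eq_csum => k.
rewrite /lie_term expr1n mul1r /lie_coef /bch_term -mulr_sumr; congr (_ * _).
rewrite (eq_ev z (bch_sum_power k (coord j))).
have := ev_lincomb (index_enum 'I_(k * N).+1) (fun=> 1) (fun g => bounded_array_bch k g j) hz.
rewrite (eq_bigr (fun g : 'I_(k * N).+1 => ev ((bch_poly A B N ^+ k)`_g (coord j)) z)) => [<-|g
  _]; last by rewrite mul1r.
by apply: eq_ev => w; apply: eq_bigr => g _; rewrite mul1r.
Qed.

(** Applied to coordinates and evaluated, this is [bch_exp]. *)
Lemma low_grades g j : (g <= N)%N ->
  \sum_(k < N.+1) bch_term k g j = \sum_(m < g.+1) word_term m (g - m) j.
Proof.
move=> gN; have gN' : (g.+1 <= N.+1)%N by [].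
rewrite -(big_mkord xpredT (fun k => bch_term k g j)) (@big_cat_nat _ _ _ g.+1)//=.
rewrite [X in _ + X]big_nat [X in _ + X]big1 ?addr0; last first.
  by move=> k /andP[gk _]; rewrite bch_term0 ?bch_power_low.
rewrite big_mkord.
have h : (\sum_(k < g.+1) invfact R[i] k *: (bch_poly A B N ^+ k)`_g) (coord j) = _ :=
   congr1 (fun a : endo _ _ => a (coord j)) (bch_exp (@lmom_letters nonneg d) A B gN).
have h1 := ev_lincomb (index_enum 'I_g.+1) (fun k => invfact R[i] k) (fun k => bounded_array_bch
  k g j) hz.
have h2 := ev_lincomb (index_enum 'I_g.+1) (fun m => invfact R[i] m * invfact R[i] (g - m)) (fun
  m => bounded_array_word m (g - m) j) hz.
rewrite /bch_term -h1 (_ : \sum_(m < g.+1) _ = \sum_(m < g.+1) (invfact R[i] m * invfact R[i] (g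
  - m)) * ev ((op A ^+ m * op B ^+ (g - m)) (coord j)) z); last first.
  by apply: eq_bigr => m _; rewrite /word_term mulrA [invfact _ (g - m) * _]mulrC.
rewrite -h2; apply: eq_ev => w; have := congr1 (fun f : array => f w) h.
by rewrite !endo_sumE.
Qed.

Let delta := tau^-1 ^+ N.+1.

Let delta0 : 0 <= delta. Proof. by rewrite exprn_ge0// invr_ge0 ltW. Qed.

Lemma zbound_sum0 n (v : nat -> state) (f : nat -> R) : (forall i, zbd (v i) (f i)) ->
  zbd (fun j => \sum_(i < n) v i j) (\sum_(i < n) f i).
Proof.
move=> h; elim: n => [|n IH].
  by move=> U _; rewrite big_ord0 big1// => j _; rewrite big_ord0 modulus0 mulr0.
rewrite [X in zbound _ _ X]big_ord_recr; move: (zboundD s0 IH (h n)); apply: eq_zbound => j.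
by rewrite big_ord_recr.
Qed.

Lemma asummable_zbound (v : nat -> state) (f : nat -> R) K j : (forall n, zbd (v n) (f n)) ->
  sumle f K -> asummable (fun n => v n j).
Proof.
move=> hv hf; exists K; apply: le_sumle hf => // n.
by apply: (le_trans _ (sumle_term j (hv n))); rewrite ler_peMl ?modulus_ge0// lwt_ge1.
Qed.

Lemma asummable_finite_nat (x : nat -> R[i]) K : (forall n, (K <= n)%N -> x n = 0) -> asummable x.
Proof.
move=> h; exists (\sum_(n < K) modulus (x n)); apply: sumle_nat => [n|M]; first exact:
  modulus_ge0.
case: (leqP M K) => MK.
  rewrite (big_ord_widen _ (fun n => modulus (x n)) MK) big_mkcond /=; apply: ler_sum => n _.
  by case: ifP => // _; apply: modulus_ge0.
rewrite (big_ord_widen _ (fun n => modulus (x n)) (ltnW MK)) [leRHS]big_mkcond /=; apply: ler_sum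
  => n _.
by case: ltnP => // /h ->; rewrite modulus0.
Qed.

Lemma csum_finite_nat (x : nat -> R[i]) K : (forall n, (K <= n)%N -> x n = 0) ->
  csum x = \sum_(n < K) x n.
Proof.
move=> h; rewrite (csum_finite (s := iota 0 K)) ?iota_uniq ?sum_iota// => n.
by rewrite mem_iota add0n -leqNgt; apply: h.
Qed.

(** Grades above [N] gain the factor [tau^-(N+1)] by comparing values at
    [tau] and at 1. *)
Lemma tail_factor p x : (N < p)%N -> 0 <= x -> x * tau <= 2^-1 -> x ^+ p <= delta * 2^-1 ^+ p.
Proof.
move=> Np x0 hx; have t0 : 0 <= tau^-1 by rewrite invr_ge0 ltW.
have -> : x ^+ p = tau^-1 ^+ p * (x * tau) ^+ p.
  by rewrite -exprMn mulrCA mulVf ?mulr1// gt_eqF.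
apply: ler_pM; rewrite ?exprn_ge0 ?mulr_ge0 ?(ltW tau0)//.
  by rewrite /delta ler_wiXn2l// invf_le1.
by rewrite lerXn2r// nnegrE ?mulr_ge0 ?(ltW tau0)// invr_ge0.
Qed.

(** The composition of the two flows is the double series of the words in [A]
    and [B], the flow of the truncated field is the series of its powers.  Grades
    at most [N] cancel; in both expansions the remaining grades are summable with
    the factor [tau^-(N+1)]. *)
Lemma flow_difference : zbd (fun j => lie_flow B 1 split_step j - lie_flow bch_sum 1 z j)
  (6 * rho * tau^-1 ^+ N.+1).
Proof.
(* High grades are [a] and [b], low grades of the first expansion are [a0]. *)
pose a m n : state := fun j => if (N < m + n)%N then word_term m n j else 0.
pose b k g : state := fun j => if (N < g)%N then bch_term k g j else 0.
pose a0 m n j := if (N < m + n)%N then 0 else word_term m n j.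
have rd0 : 0 <= rho * delta by rewrite mulr_ge0// ltW.
have ha m n : zbd (a m n) (rho * delta * 2^-1 ^+ n * 2^-1 ^+ m).
  rewrite /a; case: ltnP => Nmn; last first.
    move=> U _; rewrite big1 => [|j _]; last by rewrite modulus0 mulr0.
    by rewrite mulr_ge0 ?exprn_ge0 ?invr_ge0// mulr_ge0// exprn_ge0 ?invr_ge0.
  move=> U uU; apply: le_trans (word_term_bound m n uU) _.
  rewrite [leRHS](_ : _ = rho * (delta * 2^-1 ^+ (m + n))); last by rewrite exprD; ring.
  rewrite ler_wpM2l ?(ltW rho0)//.
  apply: tail_factor => //; first by rewrite mulr_ge0// !mulr_ge0 ?invr_ge0 ?(ltW rho0).
  by apply: le_trans small_factor _; lra.
have hn n : zbd (fun j => csum (fun m => a m n j)) (2 * (rho * delta) * 2^-1 ^+ n).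
  rewrite -mulrA; apply: (zbound_csum s0 (fun m => ha m n)).
  by apply: sumle_half => //; rewrite mulr_ge0// exprn_ge0 ?invr_ge0.
have s1 : sumle (fun n => 2 * (rho * delta) * 2^-1 ^+ n) (2 * (2 * (rho * delta))).
  by apply: sumle_half => //; rewrite mulr_ge0.
have hb k : zbd (fun j => \sum_(g < (k * N).+1) b k g j) (rho * delta * 2^-1 ^+ k).
  have h g : zbd (b k g) (rho * delta * ((c ^+ k *: zeta ^+ k)`_g * tau ^+ g)).
    have p0 : nonneg_poly (c ^+ k *: zeta ^+ k).
      by apply: nonneg_polyZ; [exact: exprn_ge0|exact: nonneg_poly_exp].
    rewrite /b; case: ltnP => Ng; last first.
      move=> U _; rewrite big1 => [|j _]; last by rewrite modulus0 mulr0.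
      by rewrite mulr_ge0// mulr_ge0 ?p0// exprn_ge0// ltW.
    move=> U uU; apply: le_trans (bch_term_bound k g uU) _.
    rewrite -mulrA ler_wpM2l ?(ltW rho0)// mulrCA -[leLHS]mulr1 ler_wpM2l ?p0//.
    have t0 : 0 < tau ^+ N.+1 by rewrite exprn_gt0.
    by rewrite /delta exprVn mulrC ler_pdivlMr// mul1r ler_weXn2l.
  move=> U uU; apply: le_trans (zbound_sum0 (k * N).+1 h uU) _.
  have p0 : nonneg_poly (c ^+ k *: zeta ^+ k).
    by apply: nonneg_polyZ; [exact: exprn_ge0|exact: nonneg_poly_exp].
  rewrite -mulr_sumr ler_wpM2l//; apply: le_trans (sum_coef_le _ p0 (ltW tau0)) _.
  rewrite hornerZ horner_exp -exprMn; have z0 : 0 <= zeta.[tau] by apply: nonneg_horner => //;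
    apply: ltW.
  have cz : c * zeta.[tau] <= 8^-1 by apply: le_trans small; rewrite ler_wpM2l.
  have cz0 : 0 <= c * zeta.[tau] by apply: mulr_ge0.
  by rewrite lerXn2r// ?nnegrE ?invr_ge0// (le_trans cz)//; lra.
have s2 : sumle (fun k => rho * delta * 2^-1 ^+ k) (2 * (rho * delta)).
  exact: sumle_half.
have h1 := zbound_csum s0 hn s1.
have h2 := zbound_csum s0 hb s2.
have := zboundB s0 h1 h2; rewrite (_ : _ + _ = 6 * rho * delta); last by ring.
apply: eq_zbound => j.
have a00 m n : (N.+1 <= m)%N || (N.+1 <= n)%N -> a0 m n j = 0.
  by move=> h; rewrite /a0 ifT//; case/orP: h => h; apply: leq_trans h _; rewrite ?leq_addr
    ?leq_addl.
have E1 n : csum (fun m => word_term m n j) = \sum_(m < N.+1) a0 m n j + csum (fun m => a m n j).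
  rewrite -(@csum_finite_nat (fun m => a0 m n j)) => [|m Nm]; last by rewrite a00// Nm.
  rewrite -csumD.
  - by apply: eq_csum => m; rewrite /a0 /a; case: ifP; rewrite ?add0r ?addr0.
  - by apply: (@asummable_finite_nat _ N.+1) => m Nm; rewrite a00// Nm.
  - apply: (asummable_zbound j (fun m => ha m n)).
    apply: (@sumle_half R _ (rho * delta * 2^-1 ^+ n)) => //.
    by rewrite mulr_ge0// exprn_ge0 ?invr_ge0.
(* The sum over [g] may be extended beyond the degree [k N] of the power. *)
have E2 k : \sum_(g < (k * N).+1) bch_term k g j
    = \sum_(g < N.+1) bch_term k g j + \sum_(g < (k * N).+1) b k g j.
  pose x g := if (N < g)%N then 0 else bch_term k g j.
  have z1 g : ((k * N).+1 <= g)%N -> bch_term k g j = 0.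
    by move=> h; rewrite bch_term0// nth_default// (leq_trans (size_bch_power k)).
  have z2 g : (N.+1 <= g)%N -> x g = 0 by rewrite /x => ->.
  have z3 g : ((k * N).+1 <= g)%N -> b k g j = 0.
    by move=> h; rewrite /b; case: ifP => // _; apply: z1.
  rewrite -(csum_finite_nat z1) -(csum_finite_nat z3).
  transitivity (csum x + csum (fun g => b k g j)).
    rewrite -csumD; [|exact: asummable_finite_nat z2|exact: asummable_finite_nat z3].
    by apply: eq_csum => g; rewrite /x /b; case: ifP; rewrite ?add0r ?addr0.
  rewrite (csum_finite_nat z2); congr (_ + _); apply: eq_bigr => g _.
  by rewrite /x ifN// -leqNgt -ltnS.
rewrite split_flowE bch_flowE (eq_csum E1) (eq_csum E2).
rewrite csumD; last 2 first.
- apply: (@asummable_finite_nat _ N.+1) => n Nn; rewrite big1// => m _.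
  by rewrite a00// Nn orbT.
- exact: (asummable_zbound j hn s1).
rewrite csumD; last 2 first.
- apply: (@asummable_finite_nat _ N.+1) => k Nk; rewrite big1// => g _.
  by rewrite bch_term0 ?bch_power_low ?(leq_trans (ltn_ord g)).
- exact: (asummable_zbound j hb s2).
rewrite [X in _ = X + _ - _](@csum_finite_nat _ N.+1); last first.
  by move=> n Nn; rewrite big1// => m _; rewrite a00// Nn orbT.
rewrite [X in _ = _ - (X + _)](@csum_finite_nat _ N.+1); last first.
  by move=> k Nk; rewrite big1// => g _; rewrite bch_term0 ?bch_power_low ?(leq_trans (ltn_ord
    g)).
have -> : \sum_(n < N.+1) \sum_(m < N.+1) a0 m n j = \sum_(k < N.+1) \sum_(g < N.+1) bch_term k g
  j.
  rewrite exchange_big [RHS]exchange_big /=.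
  rewrite -(sum_triangle (G := fun m n => a0 m n j)); last first.
    by move=> m n mn; rewrite /a0 mn.
  apply: eq_bigr => g _; have gN : (g <= N)%N by rewrite -ltnS.
  rewrite low_grades//; apply: eq_bigr => m _; rewrite /a0 subnKC ?ifN// -?leqNgt//.
  by rewrite -ltnS.
by rewrite opprD addrACA subrr add0r.
Qed.

End At.

End SplittingError.

(** * Fields of polynomial Hamiltonians *)

Section HamiltonianFields.
Variables (R : realType) (nonneg : bool) (d : nat) (s : R).
Hypothesis s0 : 0 <= s.
Local Notation letter := (phase_index nonneg d).
Local Notation mom := (@lmom nonneg d).
Local Notation J := (@letters_of nonneg d).
Local Notation momw := (momw mom).
Local Notation lwt := (@lwt R nonneg d s).
Local Notation wt := (@wt R nonneg d s).
Local Notation array := (seq letter -> R[i]).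
Local Notation field := (letter -> seq letter -> R[i]).
Local Notation state := (letter -> R[i]).
Local Notation fbd := (@fbound R nonneg d s _).
Local Notation abd := (@abound R nonneg d s).
Local Notation zbd := (@zbound R nonneg d s).
Local Notation zstar := (star mom J).
Local Notation zderiv := (wderiv mom J).
Local Notation zpartial := (partial_word mom J).
Local Notation bracket := (@bracket R[i] _ _ mom J).
Local Notation gad := (@gad R[i] _ _ mom J).
Local Notation bch := (@bch R[i] _ _ mom J).
Local Notation fzero := (@fzero R[i] letter).
Local Notation supp0 := (@msupp R nonneg d 0).
Local Notation lconj := (@index_conj nonneg d).
Local Notation wconj := (map lconj).

Let lmomP := @lmom_letters nonneg d.
Let letters_uniqP := @letters_of_uniq nonneg d.

(** The factor of the symplectic form: -i for the variables xi, i for eta. *)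
Definition sympl (j : letter) : R[i] := if j.2 then - 'i%C else 'i%C.

(** Noncommutative coefficients of a real, momentum preserving polynomial with
    a zero of order two at the origin.  Boundedness without weights is the bound
    [abound] for the exponent zero. *)
Definition hampoly (P : array) := [/\ (exists C e, @abound R nonneg d 0 P C e),
  (forall w, P w != 0 -> momw w = 0), (forall w, P w != 0 -> (2 <= size w)%N) &
  (forall w, P (wconj w) = (P w)^*)].

Definition hamfield (P : array) : field := fun j w => sympl j * zpartial (lconj j) P w.

Lemma sympl_conj j : sympl (lconj j) = - sympl j.
Proof. by rewrite /sympl; case: j => a [] /=; rewrite ?opprK. Qed.

Lemma sympl_conjc j : (sympl j)^* = sympl (lconj j).
Proof. by rewrite sympl_conj /sympl; case: j => a [] /=; apply/eqP; rewrite eq_complex /= ?oppr0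
  ?opprK !eqxx. Qed.

Lemma modulus_sympl j : modulus (sympl j) = 1.
Proof. by rewrite /sympl; case: ifP; rewrite ?modulusN modulus_i. Qed.

Lemma symplE j : sympl j = if j.2 then - 'i%C else 'i%C. Proof. by []. Qed.

Lemma abound_unweighted f C e : @abound R nonneg d 0 f C e -> abd f C e.
Proof.
move=> [C0 hf df]; split=> // w; have := hf w; rewrite wt0 mulr1 => /le_trans; apply.
by rewrite ler_peMr// wt_ge1.
Qed.

Lemma msupp_hamfield P : hampoly P -> supp0 (hamfield P).
Proof.
move=> [_ hm _ _] j w; rewrite /hamfield mulf_eq0 negb_or => /andP[_].
move/(wderiv_supp hm); rewrite lmom_conj => /eqP; rewrite addrC subr_eq0 => /eqP ->.
by rewrite add0r.
Qed.

Lemma hamfield_bound P C e : hampoly P -> @abound R nonneg d 0 P C e ->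
  forall j w, modulus (hamfield P j w) <= e%:R * C.
Proof.
move=> hP hb j w; have [_ h _] := abound_partial (lexx 0) (lconj j) hb.
rewrite /hamfield modulusM modulus_sympl mul1r; have := h w.
by rewrite lwt0 wt0 !mulr1.
Qed.

Lemma partial_order k (f : array) n : (forall w, f w != 0 -> (n < size w)%N) ->
  forall w, zpartial k f w != 0 -> (n <= size w)%N.
Proof.
move=> hf w; elim: w f n hf => [|i w IH] f n hf.
  by rewrite (partial_word_nil lmomP letters_uniqP) => /hf.
rewrite (partial_word_cons lmomP letters_uniqP).
case: (eqVneq (f [:: k, i & w]) 0) => [->|/hf]; last by rewrite /= ltnS.
rewrite add0r; case: n hf => // n hf h; rewrite /= ltnS.
by apply: (IH (lquot f i)) h => v /hf.
Qed.

Lemma hamfield_nil P j : hampoly P -> hamfield P j [::] = 0.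
Proof.
move=> [_ _ hs _]; apply/eqP/negPn/negP; rewrite /hamfield mulf_eq0 negb_or => /andP[_].
by move/(partial_order (n := 1) hs).
Qed.

Lemma hamfield_deg P C e j : @abound R nonneg d 0 P C e -> deg_lt (hamfield P j) e.
Proof.
move=> hb w ew; rewrite /hamfield; have -> : zpartial (lconj j) P w = 0; last by rewrite mulr0.
have [_ _ dP] := hb; move: ew; elim: w (P) (e) dP => [|i w IH] {hb}f n dP ew.
  rewrite (partial_word_nil lmomP letters_uniqP) dP//=.
  by move: ew; rewrite leqn0 => /eqP ->.
rewrite (partial_word_cons lmomP letters_uniqP) dP ?add0r; last by rewrite /= (leq_trans ew).
case: n dP ew => [|n] dP ew; first by apply: (IH _ 0%N) => // v _; apply: dP.
by apply: (IH _ n) => // v vn; apply: dP.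
Qed.

(** For a given word at most two components of the field have a nonzero
    coefficient, and their weight is controlled by the weight of the word: bounded
    coefficients suffice for a field continuous in the weighted norm. *)
Lemma hamfield_weighted P C e w : hampoly P -> @abound R nonneg d 0 P C e ->
  \sum_(j <- J (momw w)) lwt j * modulus (hamfield P j w) <= 2 * (2 `^ (s * e%:R) * (e%:R * C)) *
    wt w.
Proof.
move=> hP hb; have [C0 _ _] := hb.
have K0 : 0 <= 2 `^ (s * e%:R) * (e%:R * C) by rewrite mulr_ge0 ?powR_ge0// mulr_ge0.
have hj j : j \in J (momw w) -> lwt j * modulus (hamfield P j w) <= 2 `^ (s * e%:R) * (e%:R * C)
  * wt w.
  rewrite lmomP => /eqP jw; case: (eqVneq w [::]) => [->|w0].
    by rewrite hamfield_nil// modulus0 mulr0 mulr_ge0// wt_ge0.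
  case: (leqP e (size w)) => ew.
    by rewrite (hamfield_deg j hb ew) modulus0 mulr0 mulr_ge0// wt_ge0.
  rewrite mulrAC; apply: ler_pM; rewrite ?lwt_ge0 ?modulus_ge0 ?(hamfield_bound hP hb)//.
  apply: le_trans (lwt_momw s0 w0 jw) _; rewrite ler_wpM2r ?wt_ge0//.
  rewrite ler_powR ?ler1n// ler_wpM2l// ler_nat; lia.
rewrite big_seq (le_trans (ler_sum _ hj))// -big_seq big_const_seq count_predT iter_addr addr0.
rewrite -[_ *+ size _]mulr_natl -!mulrA ler_wpM2r ?mulr_ge0 ?wt_ge0 ?powR_ge0//.
by rewrite (ler_nat _ _ 2) size_letters_of.
Qed.

Lemma fbound_supported (F : field) C e : 0 <= C -> supp0 F -> (forall j, deg_lt (F j) e) ->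
  (forall w, \sum_(j <- J (momw w)) lwt j * modulus (F j w) <= C * wt w) ->
  fbd lwt F C e.
Proof.
move=> C0 mF dF hF; split=> // A uA w.
exact: le_trans (sum_supported s0 w mF uA) (hF w).
Qed.

Lemma fbound_hamfield P C e : hampoly P -> @abound R nonneg d 0 P C e ->
  fbd lwt (hamfield P) (2 * (2 `^ (s * e%:R) * (e%:R * C))) e.
Proof.
move=> hP hb; have [C0 _ _] := hb; apply: fbound_supported.
- by rewrite !mulr_ge0 ?powR_ge0.
- exact: msupp_hamfield.
- by move=> j; apply: hamfield_deg hb.
- by move=> w; apply: hamfield_weighted.
Qed.

Lemma vnb_hamfield rho P C e : 0 < rho -> hampoly P -> @abound R nonneg d 0 P C e.+1 ->
  nbound s rho J lwt (hamfield P) (2 * (2 `^ (s * e.+1%:R) * (e.+1%:R * C)) * geom e.+1 rho) e.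
Proof.
move=> rho0 hP hb; have [C0 _ _] := hb.
have K0 : 0 <= 2 * (2 `^ (s * e.+1%:R) * (e.+1%:R * C)) by rewrite !mulr_ge0 ?powR_ge0.
set K := 2 * _ in K0 *; exists (\poly_(l < e.+1) K); split.
- by move=> n; rewrite coef_poly; case: ifP.
- move=> w; rewrite coef_poly; case: ifP => ew; first exact: hamfield_weighted.
  rewrite mul0r big1// => j _; rewrite (hamfield_deg j hb) ?modulus0 ?mulr0//.
  by rewrite leqNgt ew.
- exact: size_poly.
- by rewrite horner_poly /geom mulr_sumr.
Qed.

End HamiltonianFields.

(** * The Lie algebra of Hamiltonian fields *)

Section HamiltonianAlgebra.
Variables (R : realType) (nonneg : bool) (d : nat) (s : R).
Hypothesis s0 : 0 <= s.
Local Notation letter := (phase_index nonneg d).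
Local Notation mom := (@lmom nonneg d).
Local Notation J := (@letters_of nonneg d).
Local Notation momw := (momw mom).
Local Notation lwt := (@lwt R nonneg d s).
Local Notation wt := (@wt R nonneg d s).
Local Notation array := (seq letter -> R[i]).
Local Notation field := (letter -> seq letter -> R[i]).
Local Notation state := (letter -> R[i]).
Local Notation fbd := (@fbound R nonneg d s _).
Local Notation abd := (@abound R nonneg d s).
Local Notation zbd := (@zbound R nonneg d s).
Local Notation zstar := (star mom J).
Local Notation zderiv := (wderiv mom J).
Local Notation zpartial := (partial_word mom J).
Local Notation bracket := (@bracket R[i] _ _ mom J).
Local Notation gad := (@gad R[i] _ _ mom J).
Local Notation bch := (@bch R[i] _ _ mom J).
Local Notation fzero := (@fzero R[i] letter).
Local Notation supp0 := (@msupp R nonneg d 0).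
Local Notation lconj := (@index_conj nonneg d).
Local Notation wconj := (map lconj).

Let lmomP := @lmom_letters nonneg d.
Let letters_uniqP := @letters_of_uniq nonneg d.

Local Notation sympl := (@sympl R nonneg d).
Local Notation hampoly := (@hampoly R nonneg d).
Local Notation hamfield := (@hamfield R nonneg d).
Local Notation abd0 := (@abound R nonneg d 0).

Lemma momw_wconj w : momw (wconj w) = - momw w.
Proof.
elim: w => [|j w IH]; first by rewrite !momw_nil oppr0.
by rewrite /= !momw_cons IH lmom_conj opprD.
Qed.

Lemma perm_letters_conj m : perm_eq (J (- m)) (map lconj (J m)).
Proof.
apply: uniq_perm; rewrite ?letters_uniqP//.
  rewrite map_inj_uniq ?letters_uniqP//; exact: (can_inj (@index_conjK nonneg d)).
move=> j; rewrite lmomP; apply/eqP/mapP => [jm|[k km ->]].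
  exists (lconj j); last by rewrite index_conjK.
  by rewrite lmomP lmom_conj jm opprK.
by move: km; rewrite lmomP lmom_conj => /eqP ->.
Qed.

(** [f] and [g] are exchanged by complex conjugation of the coefficients and
    of the letters; fields of real Hamiltonians are self-conjugate in this sense. *)
Definition conj_array (f g : array) := forall w, f (wconj w) = (g w)^*.

Lemma conjcM (x y : R[i]) : (x * y)^* = x^* * y^*. Proof. exact: rmorphM. Qed.
Lemma conjcD (x y : R[i]) : (x + y)^* = x^* + y^*. Proof. exact: rmorphD. Qed.
Lemma conjc_sum (T : Type) (l : seq T) (f : T -> R[i]) :
  (\sum_(i <- l) f i)^* = \sum_(i <- l) (f i)^*.
Proof. exact: rmorph_sum. Qed.

Lemma conj_partial k f g : conj_array f g -> conj_array (zpartial (lconj k) f) (zpartial k g).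
Proof.
move=> h w; elim: w f g h => [|i w IH] f g h.
  by rewrite !(partial_word_nil lmomP letters_uniqP); exact (h [:: k]).
rewrite /= !(partial_word_cons lmomP letters_uniqP) conjcD; congr (_ + _); first exact (h [:: k,
  i & w]).
by apply: IH => v; exact (h (i :: v)).
Qed.

Lemma conj_star X X' g g' : (forall j, conj_array (X (lconj j)) (X' j)) ->
  (forall j, conj_array (g (lconj j)) (g' j)) -> conj_array (zstar 0 X g) (zstar 0 X' g').
Proof.
move=> hX hg w; rewrite /star /conv size_map.
apply: etrans (esym (conjc_sum _ _)); apply: eq_bigr => p _.
rewrite -map_take -map_drop !add0r momw_wconj (perm_big _ (perm_letters_conj _)) big_map.
apply: etrans (esym (conjc_sum _ _)); apply: eq_bigr => j _.
by apply: etrans (esym (conjcM _ _)); congr (_ * _); [exact: hX|exact: hg].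
Qed.

Lemma conj_wderiv X X' f f' : (forall j, conj_array (X (lconj j)) (X' j)) ->
  conj_array f f' -> conj_array (zderiv 0 X f) (zderiv 0 X' f').
Proof.
move=> hX hf w; elim: w f f' hf => [|k w IH] f f' hf; rewrite wderiv_split [in RHS]wderiv_split
  conjcD.
  congr (_ + _); last exact: esym (rmorph0 _).
  by apply: (conj_star hX) => j v; exact (hf (j :: v)).
congr (_ + _); last by apply: IH => v; exact (hf (k :: v)).
by apply: (conj_star hX) => j v; exact (hf (j :: v)).
Qed.

(** A letter is replaced by a nonempty word, so words do not get shorter. *)
Lemma wderiv_order (X : field) (f : array) n : (forall j, X j [::] = 0) ->
  (forall w, f w != 0 -> (n <= size w)%N) -> forall w, zderiv 0 X f w != 0 -> (n <= size w)%N.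
Proof.
move=> hX hf w; elim: w f n hf => [|k w IH] f n hf.
  by rewrite wderiv_nil big1 ?eqxx// => j _; rewrite hX mul0r.
rewrite wderiv_cons; case: (leqP n (size (k :: w))) => // hn.
have -> : zderiv 0 X (lquot f k) w = 0.
  apply/eqP/negPn/negP => /(IH (lquot f k) n.-1) h.
  have : (n.-1 <= size w)%N by apply: h => v /hf /=; lia.
  by move: hn => /=; lia.
rewrite addr0 /star /conv big1 ?eqxx// => p _; rewrite big1// => j _.
case: p => -[|p] pw /=; first by rewrite hX mul0r.
rewrite /lquot (_ : f _ = 0) ?mulr0//; apply/eqP/negPn/negP => /hf.
by rewrite /= size_drop; move: hn => /=; lia.
Qed.

Lemma hampoly_bracket P Q : hampoly P -> hampoly Q -> hampoly (zderiv 0 (hamfield P) Q).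
Proof.
move=> hP hQ; have [[C [e hb]] mP sP rP] := hP; have [[D [f hc]] mQ sQ rQ] := hQ.
split.
- eexists; eexists; exact: (abound_wderiv (lexx 0) 0 (fbound_hamfield (lexx 0) hP hb) hc).
- by move=> w /(wderiv_supp mQ); rewrite add0r.
- by apply: wderiv_order => // j; apply: hamfield_nil.
- apply: conj_wderiv => // j w; rewrite /hamfield.
  apply: etrans (esym (conjcM _ _)); congr (_ * _); first exact: esym (sympl_conjc _ j).
  exact: conj_partial.
Qed.

Lemma hampoly0 : hampoly (fun=> 0).
Proof.
split=> [|w|w|w]; rewrite ?eqxx//; first by exists 0, 0%N; apply: abound0.
exact: esym (rmorph0 _).
Qed.

Lemma hampoly_add P Q : hampoly P -> hampoly Q -> hampoly (fun w => P w + Q w).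
Proof.
move=> [[C [e hb]] mP sP rP] [[D [f hc]] mQ sQ rQ].
have nz w : P w + Q w != 0 -> P w != 0 \/ Q w != 0.
  by case: (eqVneq (P w) 0) => [->|]; [rewrite add0r; right|left].
split=> [|w /nz[/mP|/mQ]|w /nz[/sP|/sQ]|w]//; last by rewrite rP rQ; exact: esym (conjcD _ _).
exists (C + D), (maxn e f); apply: aboundD.
- exact: (abound_weaken (lexx 0) (lexx C) (leq_maxl e f) hb).
- exact: (abound_weaken (lexx 0) (lexx D) (leq_maxr e f) hc).
Qed.

Lemma hampoly_scale (a : R) P : hampoly P -> hampoly (fun w => a%:C * P w).
Proof.
move=> [[C [e hb]] mP sP rP].
have nz w : a%:C * P w != 0 -> P w != 0 by rewrite mulf_eq0 negb_or => /andP[].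
split=> [|w /nz/mP|w /nz/sP|w]//.
  by eexists; eexists; exact: (aboundZ a%:C hb).
rewrite rP; apply: etrans (esym (conjcM _ _)); congr (_ * _).
by apply/eqP; rewrite eq_complex /= oppr0 !eqxx.
Qed.

Definition bounded_field (X : field) := supp0 X /\ exists C e, fbd lwt X C e.

(** Only values matter: a bracket of Hamiltonian fields is Hamiltonian as a
    function, but its noncommutative coefficients are in general not those
    derived from a Hamiltonian. *)
Definition hamiltonian (X : field) := bounded_field X /\ exists P, hampoly P /\
  forall z r, zbd z r -> forall j, ev (X j) z = ev (hamfield P j) z.

Lemma bounded_hamfield P : hampoly P -> bounded_field (hamfield P).
Proof.
move=> hP; have [[C [e hb]] _ _ _] := hP; split; first exact: msupp_hamfield.
by eexists; eexists; exact: (fbound_hamfield s0 hP hb).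
Qed.

Lemma bounded_field_component X : bounded_field X -> forall j, bounded_array s (X j).
Proof.
move=> [_ [C [e h]]] j; eexists; eexists; exact: (fbound_abound (lwt_gt0 s0) j h).
Qed.

Lemma hampoly_bounded_array P : hampoly P -> bounded_array s P.
Proof. by move=> [[C [e hb]] _ _ _]; exists C, e; apply: abound_unweighted. Qed.

Lemma bounded_array_partial k f : bounded_array s f -> bounded_array s (zpartial k f).
Proof. by move=> [C [e h]]; eexists; eexists; exact: (abound_partial s0 k h). Qed.

Lemma evD_bounded f g z r : bounded_array s f -> bounded_array s g -> zbd z r ->
  ev (fun w => f w + g w) z = ev f z + ev g z.
Proof.
move=> [C [e hf]] [D [e' hg]] hz.
exact: (evD s0 (abound_weaken s0 (lexx _) (leq_maxl e e') hf) (abound_weaken s0 (lexx _)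
  (leq_maxr e e') hg) hz).
Qed.

Lemma evZ_bounded c f z r : bounded_array s f -> zbd z r -> ev (fun w => c * f w) z = c * ev f z.
Proof. by move=> [C [e hf]] hz; exact: (evZ s0 c hf hz). Qed.

(** Partial derivatives depend on the values only, by [partial_ev]; this
    allows replacing an array by another one with the same values inside
    brackets. *)
Lemma ev_partial_ext f g k z r : bounded_array s f -> bounded_array s g -> zbd z r ->
  (forall z' r', zbd z' r' -> ev f z' = ev g z') ->
  ev (zpartial k f) z = ev (zpartial k g) z.
Proof.
move=> [C [e hf]] [D [e' hg]] hz h.
rewrite -(partial_ev s0 k hf hz (H := ev f))// -(partial_ev s0 k hg hz (H := ev f))//.
Qed.

Lemma ev_chain X f z r : bounded_field X -> bounded_array s f -> zbd z r ->
  ev (zderiv 0 X f) z = csum (fun k => ev (X k) z * ev (zpartial k f) z).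
Proof. by move=> [mX [C [e hX]]] [D [e' hf]] hz; exact: (ev_wderiv s0 hX mX hf hz). Qed.

Lemma csum_conj (x : letter -> R[i]) : asummable x ->
  asummable (fun j => x (lconj j)) /\ csum x = csum (fun j => x (lconj j)).
Proof.
have cI : injective lconj := can_inj (@index_conjK nonneg d).
move=> [B hB]; have h' : sumle (fun j => modulus (x (lconj j))) B.
  move=> A uA; have := hB (map lconj A); rewrite map_inj_uniq// => /(_ uA).
  by rewrite big_map.
split; first by exists B.
apply: csum_cofinal; [by exists B|by exists B|].
move=> A B' uA uB'; exists (undup (A ++ map lconj B')), (map lconj (undup (A ++ map lconj B'))).
split.
- exact: undup_uniq.
- by rewrite map_inj_uniq// undup_uniq.
- exact: subset_undup_catl.
- move=> k kB; apply/mapP; exists (lconj k); last by rewrite index_conjK.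
  by rewrite mem_undup mem_cat (map_f lconj kB) orbT.
- by rewrite big_map; apply: eq_bigr => j _; rewrite index_conjK.
Qed.

Lemma asummable_chain X f z r : bounded_field X -> bounded_array s f -> zbd z r ->
  asummable (fun k => ev (X k) z * ev (zpartial k f) z).
Proof.
move=> [mX [C [e hX]]] [D [e' hf]] hz; have [D0 _ _] := hf.
eexists; apply: (sumle_dual (fbound_ev_le s0 (lwt_gt0 s0) hX hz)); last first.
  exact: (ev_abound_dual s0 (fun k => abound_partial s0 k hf) hz).
by rewrite mulr_ge0 ?geom_ge0 ?(zbound_ge0 hz)// mulr_ge0.
Qed.

Lemma fbound_comb (a b : R[i]) F G C D e f : fbd lwt F C e -> fbd lwt G D f ->
  fbd lwt (fun j w => a * F j w + b * G j w) (modulus a * C + modulus b * D) (maxn e f).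
Proof.
move=> [C0 hF dF] [D0 hG dG]; split; first by rewrite addr_ge0// mulr_ge0// modulus_ge0.
  move=> A uA w; rewrite mulrDl -!mulrA.
  apply: le_trans (lerD (ler_wpM2l (modulus_ge0 a) (hF A uA w)) (ler_wpM2l (modulus_ge0 b) (hG A
    uA w))).
  rewrite !mulr_sumr -big_split /=; apply: ler_sum => j _.
  rewrite mulrCA [modulus b * _]mulrCA -mulrDr ler_wpM2l ?lwt_ge0// -!modulusM.
  exact: modulusD.
by move=> j w; rewrite geq_max => /andP[ew fw]; rewrite dF// dG// !mulr0 addr0.
Qed.

Lemma bounded_field_add X Y : bounded_field X -> bounded_field Y -> bounded_field (fadd X Y).
Proof.
move=> [mX [C [e hX]]] [mY [D [f hY]]]; split; first exact: msupp_fadd.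
exists (modulus (1 : R[i]) * C + modulus (1 : R[i]) * D), (maxn e f).
have := fbound_comb 1 1 hX hY; rewrite (_ : (fun j w => _) = fadd X Y)//.
by apply/funext => j; apply/funext => w; rewrite !mul1r.
Qed.

Lemma bounded_field_scale a X : bounded_field X -> bounded_field (fscale a X).
Proof.
move=> [mX [C [e hX]]]; split; first exact: msupp_fscale.
exists (modulus a * C + modulus (0 : R[i]) * C), (maxn e e).
have := fbound_comb a 0 hX hX; rewrite (_ : (fun j w => _) = fscale a X)//.
by apply/funext => j; apply/funext => w; rewrite mul0r addr0.
Qed.

Lemma bounded_field_bracket X Y : bounded_field X -> bounded_field Y -> bounded_field (bracket X
  Y).
Proof.
move=> [mX [C [e hX]]] [mY [D [f hY]]]; split; first exact: msupp_bracket.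
have h1 := fbound_wderiv s0 (lwt_gt0 s0) 0 hX hY.
have h2 := fbound_wderiv s0 (lwt_gt0 s0) 0 hY hX.
have := fbound_comb 1 (-1) h1 h2; rewrite (_ : (fun j w => _) = bracket X Y).
  by move=> h; eexists; eexists; exact: h.
by apply/funext => j; apply/funext => w; rewrite mul1r mulN1r.
Qed.

Lemma bounded_array_wderiv X f : bounded_field X -> bounded_array s f -> bounded_array s (zderiv
  0 X f).
Proof.
move=> [mX [C [e hX]]] [D [e' hf]]; eexists; eexists; exact: (abound_wderiv s0 0 hX hf).
Qed.

Lemma ev_bracket X Y j z r : bounded_field X -> bounded_field Y -> zbd z r ->
  ev (bracket X Y j) z = csum (fun k => ev (X k) z * ev (zpartial k (Y j)) z)
                       - csum (fun k => ev (Y k) z * ev (zpartial k (X j)) z).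
Proof.
move=> gX gY hz; have [tX tY] := (bounded_field_component gX j, bounded_field_component gY j).
rewrite -(ev_chain gX tY hz) -(ev_chain gY tX hz).
have t2 : bounded_array s (fun w => -1 * zderiv 0 Y (X j) w).
  have [C [e h]] := bounded_array_wderiv gY tX; eexists; eexists; exact: (aboundZ (-1) h).
rewrite -[X in _ = _ + X]mulN1r -(evZ_bounded (-1) (bounded_array_wderiv gY tX) hz).
rewrite -(evD_bounded (bounded_array_wderiv gX tY) t2 hz); apply: eq_ev => w.
by rewrite /bracket mulN1r.
Qed.

Lemma partialC i k (f : array) w :
  zpartial i (zpartial k f) w = zpartial k (zpartial i f) w.
Proof. by rewrite (partial_wordC lmomP). Qed.

Lemma cancel_factor (x y p q E1 E2 E3 : R[i]) : x != 0 ->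
  E1 = y * p -> E2 = x * p -> E3 = - y * q -> x^-1 * - (E3 * E2) = E1 * q.
Proof. by move=> x0 -> -> ->; field. Qed.

(** The bracket of the fields of [P] and [Q] is the field of the derivative of
    [Q] along the field of [P].  Differentiating that derivative gives two terms;
    one is the first half of the bracket, the other one is the second half after
    exchanging conjugate letters, which changes the sign of the symplectic factor. *)
Lemma ev_poisson P Q j z r : hampoly P -> hampoly Q -> zbd z r ->
  ev (bracket (hamfield P) (hamfield Q) j) z
    = ev (hamfield (zderiv 0 (hamfield P) Q) j) z.
Proof.
move=> hP hQ hz; have [gP gQ] := (bounded_hamfield hP, bounded_hamfield hQ).
have [tP tQ] := (hampoly_bounded_array hP, hampoly_bounded_array hQ).
rewrite (ev_bracket j gP gQ hz) -(ev_chain gP (bounded_field_component gQ j) hz).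
pose c := lconj j.
have pE k f i w : zpartial k (hamfield f i) w = sympl i * zpartial k (zpartial (lconj i) f) w.
  by rewrite /hamfield; apply: wderiv_scale.
have [[B [e hPb]] _ _ _] := hP.
have hXc := fbound_partial s0 c (lwt_gt0 s0) (fbound_hamfield s0 hP hPb).
have mXc : msupp (mom c) (fun k => zpartial c (hamfield P k)).
  move=> k w h; symmetry; apply: wderiv_supp h => v /(msupp_hamfield hP).
  by rewrite add0r.
have [D [f hQb]] := tQ.
have tc : bounded_array s (zderiv (mom c) (fun k => zpartial c (hamfield P k)) Q).
  by eexists; eexists; exact: (abound_wderiv s0 (mom c) hXc hQb).
have R1 : ev (hamfield (zderiv 0 (hamfield P) Q) j) z
  = sympl j * (ev (zderiv 0 (hamfield P) (zpartial c Q)) z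
     + csum (fun k => ev (zpartial c (hamfield P k)) z * ev (zpartial k Q) z)).
  rewrite /hamfield (evZ_bounded _ (bounded_array_partial _ (bounded_array_wderiv gP tQ)) hz);
    congr (_ * _).
  rewrite -(ev_wderiv s0 hXc mXc hQb hz) -(evD_bounded (bounded_array_wderiv gP
    (bounded_array_partial c tQ)) tc hz).
  by apply: eq_ev => w; exact (partial_wderiv lmomP c (hamfield P) Q w).
rewrite R1 mulrDr; congr (_ + _).
  rewrite -(evZ_bounded _ (bounded_array_wderiv gP (bounded_array_partial c tQ)) hz); apply:
    eq_ev => w.
  exact: wderiv_scale.
have sj : sympl j != 0.
  by apply/eqP => e0; have := modulus_sympl R j; rewrite e0 modulus0 => /eqP; rewrite eq_sym
    oner_eq0.
(* Exchange conjugate letters in the second half of the bracket. *)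
have [as' ->] := csum_conj (asummable_chain gQ (bounded_field_component gP j) hz).
rewrite -(csumN as') -[LHS](mulVKf sj); congr (_ * _).
rewrite -csumZ; last by apply: asummable_le (as') => k; rewrite modulusN.
apply: eq_csum => k.
have e1 : ev (zpartial c (hamfield P k)) z = sympl k * ev (zpartial c (zpartial (lconj k) P)) z.
  by rewrite -(evZ_bounded _ (bounded_array_partial _ (bounded_array_partial _ tP)) hz); apply:
    eq_ev => w; apply: pE.
have e2 : ev (zpartial (lconj k) (hamfield P j)) z = sympl j * ev (zpartial c (zpartial (lconj k)
  P)) z.
  rewrite -(evZ_bounded _ (bounded_array_partial _ (bounded_array_partial _ tP)) hz); apply:
    eq_ev => w; rewrite pE.
  by rewrite (partialC (lconj k) c P w).
have e3 : ev (hamfield Q (lconj k)) z = - sympl k * ev (zpartial k Q) z.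
  rewrite -sympl_conj -(evZ_bounded _ (bounded_array_partial _ tQ) hz); apply: eq_ev => w.
  by rewrite /hamfield index_conjK.
exact (cancel_factor sj e1 e2 e3).
Qed.

Lemma hamiltonian_bracket X Y : hamiltonian X -> hamiltonian Y -> hamiltonian (bracket X Y).
Proof.
move=> [gX [P [hP eP]]] [gY [Q [hQ eQ]]]; split; first exact: bounded_field_bracket.
exists (zderiv 0 (hamfield P) Q); split; first exact: hampoly_bracket.
move=> z r hz j; rewrite -(ev_poisson j hP hQ hz).
have [gP gQ] := (bounded_hamfield hP, bounded_hamfield hQ).
rewrite (ev_bracket j gX gY hz) (ev_bracket j gP gQ hz); congr (_ - _); apply: eq_csum => k.
  rewrite (eP z r hz); congr (_ * _); apply: (ev_partial_ext k (bounded_field_component gY j)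
    (bounded_field_component gQ j) hz).
  by move=> z' r' hz'; apply: eQ hz' j.
rewrite (eQ z r hz); congr (_ * _); apply: (ev_partial_ext k (bounded_field_component gX j)
  (bounded_field_component gP j) hz).
by move=> z' r' hz'; apply: eP hz' j.
Qed.

Lemma hamiltonian_add X Y : hamiltonian X -> hamiltonian Y -> hamiltonian (fadd X Y).
Proof.
move=> [gX [P [hP eP]]] [gY [Q [hQ eQ]]]; split; first exact: bounded_field_add.
exists (fun w => P w + Q w); split; first exact: hampoly_add.
move=> z r hz j; rewrite (evD_bounded (bounded_field_component gX j) (bounded_field_component gY
  j) hz) (eP z r hz) (eQ z r hz).
rewrite -(evD_bounded (bounded_field_component (bounded_hamfield hP) j) (bounded_field_component
  (bounded_hamfield hQ) j) hz).
by apply: eq_ev => w; rewrite /hamfield -mulrDr; congr (_ * _); rewrite -wderiv_add.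
Qed.

Lemma hamiltonian_scale (a : R) X : hamiltonian X -> hamiltonian (fscale a%:C X).
Proof.
move=> [gX [P [hP eP]]]; split; first exact: bounded_field_scale.
exists (fun w => a%:C * P w); split; first exact: hampoly_scale.
move=> z r hz j; rewrite (evZ_bounded _ (bounded_field_component gX j) hz) (eP z r hz).
rewrite -(evZ_bounded _ (bounded_field_component (bounded_hamfield hP) j) hz).
by apply: eq_ev => w; rewrite /hamfield mulrCA; congr (_ * _); rewrite -wderiv_scale.
Qed.

Lemma hamiltonian_zero : hamiltonian fzero.
Proof.
split; last first.
  exists (fun=> 0); split; first exact: hampoly0.
  move=> z r hz j; apply: eq_ev => w; rewrite /hamfield.
  by rewrite [zpartial _ _ _](wderiv0 mom J) mulr0.
split; first by move=> j w; rewrite eqxx.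
by exists 0, 0%N; split=> // A uA w; rewrite mul0r big1// => j _; rewrite modulus0 mulr0.
Qed.

Lemma hamiltonian_sum n (X : nat -> field) : (forall i, hamiltonian (X i)) -> hamiltonian (fsum n
  X).
Proof.
move=> h; elim: n => [|n IH].
  rewrite (_ : fsum 0 X = fzero); first exact: hamiltonian_zero.
  by apply/funext => j; apply/funext => w; rewrite /fsum big_ord0.
rewrite (_ : fsum n.+1 X = fadd (fsum n X) (X n)); first exact: hamiltonian_add.
by apply/funext => j; apply/funext => w; rewrite /fsum big_ord_recr.
Qed.

Lemma hamiltonian_gad Z k W : (forall n, hamiltonian (Z n)) -> (forall n, hamiltonian (W n)) ->
  forall n, hamiltonian (gad Z k W n).
Proof.
move=> hZ hW; elim: k => [//|k IH] n.
by apply: (@hamiltonian_sum n.+1 (fun i => bracket (Z i) (gad Z k W (n - i)))) => i; apply: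
  hamiltonian_bracket.
Qed.

(** The recursion uses only sums, brackets and real multiples. *)
Lemma hamiltonian_bch A B : hamiltonian A -> hamiltonian B -> forall m n, hamiltonian (bch A B m
  n).
Proof.
move=> hA hB; elim=> [|m IH] n; first exact: hamiltonian_zero.
have rE k : (k%:R : R[i])^-1 = ((k%:R : R)^-1)%:C by rewrite -(rmorph_nat (real_complex R))
  fmorphV.
have h1 X n' : hamiltonian X -> hamiltonian (at_grade1 X n').
  by rewrite /at_grade1; case: ifP => // _ _; apply: hamiltonian_zero.
have sc k X : hamiltonian X -> hamiltonian (fscale (k%:R)^-1 X).
  by rewrite rE; apply: hamiltonian_scale.
apply: (sc); apply: hamiltonian_add; first apply: hamiltonian_add; first exact: h1.
  apply: (@hamiltonian_sum n (fun k => fscale (invfact R[i] k) (gad (bch A B m) k (at_grade1 B)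
    n))) => k.
  by apply: (sc); apply: hamiltonian_gad => // n'; apply: h1.
rewrite (_ : -1 = (-1 : R)%:C); last by rewrite (rmorphN (real_complex R)) rmorph1.
apply: hamiltonian_scale.
apply: (@hamiltonian_sum n.-1 (fun k => fscale (invfact R[i] k.+2) (gad (bch A B m) k.+1 (euler
  (bch A B m)) n))) => k.
apply: (sc); apply: hamiltonian_gad => // n'; rewrite /euler -(rmorph_nat (real_complex R)).
exact: hamiltonian_scale.
Qed.

End HamiltonianAlgebra.

(** * Polynomial Hamiltonians as power series *)

Section IndexedSums.
Variable R : realType.

Lemma csum_sub (T : choiceType) (P : pred T) (x : T -> R[i]) : asummable x ->
  (forall t, ~~ P t -> x t = 0) -> csum x = csum (fun j : {t | P t} => x (val j)).
Proof.
move=> sx hx; have [B hB] := sx.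
have vI : injective (val : {t | P t} -> T) := val_inj.
apply: csum_cofinal => //.
  exists B => A uA; have := hB (map val A); rewrite map_inj_uniq// => /(_ uA).
  by rewrite big_map.
move=> A K uA uK; pose K' := undup (pmap insub A ++ K) : seq {t | P t}.
exists (undup (A ++ map val K')), K'; split; rewrite ?undup_uniq//.
- exact: subset_undup_catl.
- exact: subset_undup_catr.
rewrite (bigID P) /= [X in _ + X]big1 ?addr0; last by move=> t /hx.
rewrite -big_filter -(big_map val xpredT x); apply: perm_big; apply: uniq_perm.
- by rewrite filter_uniq// undup_uniq.
- by rewrite map_inj_uniq// undup_uniq.
move=> t; rewrite mem_filter mem_undup mem_cat; apply/andP/mapP.
  move=> [Pt /orP[tA|/mapP[k kK ->]]]; last by exists k.
  exists (Sub t Pt) => //; rewrite mem_undup mem_cat; apply/orP; left.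
  by rewrite mem_pmap; apply/mapP; exists t => //; rewrite insubT.
move=> [k kK ->]; split; first exact: valP.
by apply/orP; right; apply: map_f.
Qed.

Lemma sumle2_pairs (I J T : choiceType) (phi : I -> J -> T) (x : T -> R[i]) B :
  (forall i j i' j', phi i j = phi i' j' -> (i, j) = (i', j')) ->
  sumle (fun t => modulus (x t)) B -> sumle2 (fun i j => x (phi i j)) B.
Proof.
move=> inj hB A K uA uK.
have := hB [seq phi i j | i <- A, j <- K]; rewrite big_allpairs_dep; apply.
apply: allpairs_uniq => // -[i j] [i' j'] _ _ /=; exact: inj.
Qed.

End IndexedSums.

Section PolynomialEvaluation.
Variables (R : realType) (nonneg : bool) (d : nat) (s : R).
Hypothesis s0 : 0 <= s.
Local Notation letter := (phase_index nonneg d).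
Local Notation mom := (@lmom nonneg d).
Local Notation J := (@letters_of nonneg d).
Local Notation momw := (momw mom).
Local Notation lwt := (@lwt R nonneg d s).
Local Notation wt := (@wt R nonneg d s).
Local Notation array := (seq letter -> R[i]).
Local Notation field := (letter -> seq letter -> R[i]).
Local Notation state := (letter -> R[i]).
Local Notation fbd := (@fbound R nonneg d s _).
Local Notation abd := (@abound R nonneg d s).
Local Notation zbd := (@zbound R nonneg d s).
Local Notation zstar := (star mom J).
Local Notation zderiv := (wderiv mom J).
Local Notation zpartial := (partial_word mom J).
Local Notation bracket := (@bracket R[i] _ _ mom J).
Local Notation gad := (@gad R[i] _ _ mom J).
Local Notation bch := (@bch R[i] _ _ mom J).
Local Notation fzero := (@fzero R[i] letter).
Local Notation supp0 := (@msupp R nonneg d 0).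
Local Notation lconj := (@index_conj nonneg d).
Local Notation wconj := (map lconj).

Let lmomP := @lmom_letters nonneg d.
Let letters_uniqP := @letters_of_uniq nonneg d.

Local Notation sympl := (@sympl R nonneg d).
Local Notation hampoly := (@hampoly R nonneg d).
Local Notation hamfield := (@hamfield R nonneg d).

Definition mono (w : seq letter) (z : state) : R[i] := \prod_(j <- w) z j.

(** The product of [l] weighted l1 norms, expanded. *)
Lemma sumle_mono (l : nat) z r : zbd z r ->
  sumle (fun t : l.-tuple letter => wt t * modulus (mono t z)) (r ^+ l).
Proof.
move=> hz; have r0 := zbound_ge0 hz.
elim: l => [|l IH] A uA.
  rewrite expr0; case: A uA => [|t [|t' A]] uA; first by rewrite big_nil.
    by rewrite big_seq1 (tuple0 t) /mono big_nil modulus1 mulr1 wt_nil.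
  by move: uA; rewrite /= inE (tuple0 t) (tuple0 t') eqxx.
pose H := undup (map (fun t : l.+1.-tuple letter => thead t) A).
pose K := undup (map (fun t : l.+1.-tuple letter => behead_tuple t) A).
pose phi (j : letter) (t : l.-tuple letter) : l.+1.-tuple letter := [tuple of j :: t].
pose g (t : l.+1.-tuple letter) := wt t * modulus (mono t z).
have g0 t : 0 <= g t by rewrite mulr_ge0 ?wt_ge0 ?modulus_ge0.
apply: (@le_trans _ _ (\sum_(t <- [seq phi j t | j <- H, t <- K]) g t)).
  apply: le_sum_subset => //.
    apply: allpairs_uniq; rewrite ?undup_uniq// => -[i t] [i' t'] _ _ /= [-> e].
    by congr (_, _); apply: val_inj.
  move=> t tA; apply/allpairsP; exists (thead t, behead_tuple t); split=> /=.
  - by rewrite mem_undup (map_f (fun t : l.+1.-tuple letter => thead t) tA).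
  - by rewrite mem_undup (map_f (fun t : l.+1.-tuple letter => behead_tuple t) tA).
  - by apply: val_inj; rewrite /= [in LHS](tuple_eta t).
rewrite big_allpairs_dep exprS.
apply: (@le_trans _ _ (\sum_(j <- H) (lwt j * modulus (z j)) * \sum_(t <- K) wt t * modulus (mono
  t z))).
  apply: ler_sum => j _; rewrite mulr_sumr; apply: ler_sum => t _.
  by rewrite /g /mono /= big_cons modulusM wt_cons mulrACA.
rewrite -mulr_suml; apply: ler_pM.
- by rewrite sumr_ge0// => j _; rewrite mulr_ge0 ?lwt_ge0 ?modulus_ge0.
- by rewrite sumr_ge0// => t _; rewrite mulr_ge0 ?wt_ge0 ?modulus_ge0.
- exact: hz (undup_uniq _).
- exact: IH (undup_uniq _).
Qed.

Lemma asummable_mono (f : array) C l z r : 0 <= C -> (forall w, modulus (f w) <= C * wt w) ->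
  zbd z r -> sumle (fun t : l.-tuple letter => modulus (f t * mono t z)) (C * r ^+ l).
Proof.
move=> C0 hf hz; apply: (le_sumle _ (lexx _) (sumleZ C0 (@sumle_mono l _ _ hz))) => t.
by rewrite modulusM mulrA ler_wpM2r ?modulus_ge0.
Qed.

(** Unfolding the sums over the successive letters, with Fubini at each step. *)
Lemma evd_tuples e (f : array) C z r : 0 <= C -> (forall w, modulus (f w) <= C * wt w) ->
  zbd z r -> evd e f z = \sum_(l < e) csum (fun t : l.-tuple letter => f t * mono t z).
Proof.
move=> C0 hf hz; elim: e f C C0 hf => [|e IH] f C C0 hf; first by rewrite big_ord0.
rewrite big_ord_recl /=; congr (_ + _).
  rewrite (@csum_single _ _ _ [tuple]) => [|t]; first by rewrite /mono big_nil mulr1.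
  by rewrite (tuple0 t) eqxx.
have hq j : forall w, modulus (lquot f j w) <= (C * lwt j) * wt w.
  by move=> w; rewrite (le_trans (hf _))// wt_cons mulrA.
have Cq j : 0 <= C * lwt j by rewrite mulr_ge0// lwt_ge0.
pose x (l : nat) (t : l.+1.-tuple letter) := f t * mono t z.
pose phi l (j : letter) (t : l.-tuple letter) : l.+1.-tuple letter := [tuple of j :: t].
have xE l j t : x l (phi l j t) = z j * (lquot f j t * mono t z).
  by rewrite /x /mono /= big_cons mulrCA.
have sx l : sumle2 (fun j t => x l (phi l j t)) (C * r ^+ l.+1).
  apply: sumle2_pairs; last exact: asummable_mono.
  by move=> i t i' t' [-> e']; congr (_, _); apply: val_inj.
have zE j : z j * evd e (lquot f j) z = \sum_(l < e) csum (fun t => x l (phi l j t)).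
  rewrite (IH _ _ (Cq j) (hq j)) mulr_sumr; apply: eq_bigr => l _.
  rewrite -csumZ; first by apply: eq_csum => t; rewrite xE.
  by eexists; exact: (asummable_mono (Cq j) (hq j) hz).
rewrite (eq_csum zE) csum_sum; last by move=> l; apply: asummable_csum (sx l).
apply: eq_bigr => l _; symmetry.
apply: (csum_pair (phi := phi l) (p1 := fun t => thead t) (p2 := fun t => behead_tuple t)
  (x := x l) _ _ _ (sx l)) => //.
- by move=> t; apply: val_inj; rewrite /= [in RHS](tuple_eta t).
- by move=> j t; apply: val_inj.
Qed.

Lemma momentum_momw l (t : l.-tuple letter) : momentum t = momw t.
Proof. by rewrite /momentum momwE big_tuple. Qed.

Lemma monomial_mono l (t : l.-tuple letter) z : monomial t z = mono t z.
Proof. by rewrite /monomial /mono big_tuple. Qed.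

(** Coefficients outside of zero momentum or of the degrees 2 to [k] do not
    enter the polynomial and are set to zero. *)
Definition poly_array (k : nat) (a : coeffs R nonneg d) : array := fun w =>
  if (2 <= size w <= k)%N && (momw w == 0) then a (size w) (in_tuple w) else 0.

Lemma poly_array0 k a w : ~~ (2 <= size w <= k)%N -> poly_array k a w = 0.
Proof. by rewrite /poly_array => /negbTE ->. Qed.

Lemma poly_array_tuple k a l (t : l.-tuple letter) : (2 <= l <= k)%N -> momentum t = 0 ->
  poly_array k a t = a l t.
Proof.
rewrite momentum_momw => lk mt; case: t mt => w sw /= mt; have e := eqP sw; subst l.
by rewrite /poly_array lk mt eqxx; congr (a _ _); apply: val_inj.
Qed.

Lemma poly_eval_ev k a C z r : 0 <= C ->
  (forall l (t : l.-tuple letter), (2 <= l <= k)%N -> momentum t = 0 -> modulus (a l t) <= C) ->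
  zbd z r -> poly_eval k a z = ev (poly_array k a) z.
Proof.
move=> C0 ha hz.
have hP w : modulus (poly_array k a w) <= C * wt w.
  rewrite /poly_array; case: ifP => [/andP[sw /eqP mw]|_]; last by rewrite modulus0 mulr_ge0
    ?wt_ge0.
  rewrite (le_trans (ha _ _ sw _)) ?ler_peMr ?wt_ge1//.
  by rewrite momentum_momw.
have dP : deg_lt (poly_array k a) k.+1.
  by move=> w kw; rewrite /poly_array [(_ <= k)%N]leqNgt kw andbF.
rewrite (ev_evd _ dP) (evd_tuples _ C0 hP hz) /poly_eval.
have lE l : csum (fun t : l.-tuple letter => poly_array k a t * mono t z)
    = if (2 <= l < k.+1)%N then csum (fun j : {j : l.-tuple letter | momentum j == 0} =>
        a l (val j) * monomial (val j) z) else 0.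
  case: ifP => [lk|lk].
    rewrite (@csum_sub _ _ (fun t => momentum t == 0)); last 2 first.
    - by eexists; exact: (asummable_mono C0 hP hz).
    - by move=> t; rewrite momentum_momw /poly_array => /negbTE ->; rewrite andbF mul0r.
    apply: eq_csum => -[t /= /eqP mt]; rewrite poly_array_tuple// monomial_mono//.
  by apply: csum0 => t; rewrite poly_array0 ?mul0r// size_tuple; apply/negbT; exact: lk.
rewrite (eq_bigr _ (fun l _ => lE (nat_of_ord l))).
rewrite -(big_mkord xpredT (fun l => if (2 <= l < k.+1)%N then csum (fun j : {j : l.-tuple letter
  | momentum j == 0} =>
  a l (val j) * monomial (val j) z) else 0)) -big_mkcond.
case: (leqP 2 k.+1) => k2.
  rewrite (@big_cat_nat _ _ _ 2)//= [X in _ = X + _]big1_seq ?add0r; last first.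
    by move=> l /=; rewrite mem_index_iota => /andP[/andP[l2 _] /andP[_]]; rewrite ltnNge l2.
  by rewrite big_nat [RHS]big_nat_cond; apply: eq_bigl => l; rewrite andbb.
rewrite [LHS]big_geq ?(ltnW k2)// big1_seq// => l; rewrite mem_index_iota => /andP[/andP[l2 lk]
  _].
by have := leq_trans l2 (ltnW lk); lia.
Qed.

Lemma poly_array_hampoly k a C : 0 <= C -> in_P k a ->
  (forall l (t : l.-tuple letter), (2 <= l <= k)%N -> momentum t = 0 -> modulus (a l t) <= C) ->
  hampoly (poly_array k a) /\ @abound R nonneg d 0 (poly_array k a) C k.+1.
Proof.
move=> C0 haP ha; have hb : @abound R nonneg d 0 (poly_array k a) C k.+1.
  split=> // w.
    rewrite wt0 mulr1 /poly_array; case: ifP => [/andP[sw /eqP mw]|_]; last by rewrite modulus0.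
    by rewrite ha// momentum_momw.
  by move=> kw; rewrite /poly_array [(_ <= k)%N]leqNgt kw andbF.
split=> //; split; first by exists C, k.+1.
- by move=> w; rewrite /poly_array; case: ifP => [/andP[_ /eqP]//|_]; rewrite eqxx.
- by move=> w; rewrite /poly_array; case: ifP => [/andP[/andP[]]//|_]; rewrite eqxx.
move=> w; case E: ((2 <= size w <= k)%N && (momw w == 0)).
  move/andP: E => [sw /eqP mw]; have [_ h] := haP _ sw.
  have m1 : momentum (in_tuple w) = 0 by rewrite momentum_momw.
  have m2 : momentum (tuple_conj (in_tuple w)) = 0 by rewrite momentum_momw /= momw_wconj mw
    oppr0.
  have e1 := poly_array_tuple a sw m1; have e2 := poly_array_tuple a sw m2.
  rewrite (h _ m1) in e2; exact: etrans e2 (congr1 _ (esym e1)).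
have E' : (2 <= size (wconj w) <= k)%N && (momw (wconj w) == 0) = false.
  by rewrite size_map momw_wconj oppr_eq0.
have z w' : (2 <= size w' <= k)%N && (momw w' == 0) = false -> poly_array k a w' = 0.
  by rewrite /poly_array => ->.
rewrite (z _ E) (z _ E'); exact: esym (rmorph0 _).
Qed.

Definition array_coeffs (P : array) : coeffs R nonneg d := fun l t => P t.

Lemma poly_eval_array P C k z r : hampoly P -> @abound R nonneg d 0 P C k.+1 -> zbd z r ->
  poly_eval k (array_coeffs P) z = ev P z.
Proof.
move=> [_ mP sP _] [C0 hP dP] hz.
rewrite (poly_eval_ev C0 _ hz) => [|l t _ _].
  apply: eq_ev => w; rewrite /poly_array /array_coeffs /=; case: ifP => // h.
  apply/esym/eqP/negPn/negP => Pw; move: h; rewrite (sP _ Pw) (mP _ Pw) eqxx andbT /=.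
  by rewrite leqNgt => /negbFE kw; rewrite dP ?eqxx// in Pw.
by have := hP t; rewrite wt0 mulr1.
Qed.

Lemma array_in_P P C k : hampoly P -> @abound R nonneg d 0 P C k.+1 -> in_P k (array_coeffs P).
Proof.
move=> [_ mP sP rP] [C0 hP dP] l lk; split; last by move=> t _; exact: (rP t).
by exists C => _ [j _ <-]; have := hP (val j); rewrite wt0 mulr1.
Qed.

(** The diagonal quadratic form, symmetrised: half of [lambda a] on each of the
    two words with the letters [(a, true)] and [(a, false)]. *)
Definition quadratic_array (lambda : mode nonneg d -> R) : array := fun w =>
  if w is j :: v then (lambda j.1 / 2)%:C * coordinate R[i] (lconj j) v else 0.

Lemma quadratic_hampoly lambda C : (forall a, `|lambda a| <= C) ->
  0 <= C -> hampoly (quadratic_array lambda) /\ @abound R nonneg d 0 (quadratic_array lambda) C 3.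
Proof.
move=> hl C0.
have nz w : quadratic_array lambda w != 0 -> exists j, w = [:: j; lconj j].
  case: w => [|j v] /=; first by rewrite eqxx.
  rewrite /coordinate; case: (v =P [:: lconj j]) => [-> _|_]; first by exists j.
  by rewrite mulr0 eqxx.
have hb : @abound R nonneg d 0 (quadratic_array lambda) C 3.
  split=> // w; last first.
    move=> sw; apply/eqP/negPn/negP => /nz[j e]; by move: sw; rewrite e.
  rewrite wt0 mulr1; case: w => [|j v] /=; first by rewrite modulus0.
  rewrite modulusM modulus_real /coordinate modulus_nat normrM normfV [X in _ / X]ger0_norm//.
  have h1 : `|lambda j.1| / 2 <= C.
    by rewrite ler_pdivrMr// (le_trans (hl _))// ler_peMr//; lra.
  by apply: le_trans h1; rewrite ler_piMr ?mulr_ge0 ?invr_ge0// lern1 leq_b1.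
split=> //; split.
- by exists C, 3%N.
- by move=> w /nz[j ->]; rewrite !momw_cons momw_nil addr0 lmom_conj subrr.
- by move=> w /nz[j ->].
- case=> [|j v]; first exact (esym (rmorph0 _)).
  change ((lambda j.1 / 2)%:C * coordinate R[i] (lconj (lconj j)) (wconj v)
    = ((lambda j.1 / 2)%:C * coordinate R[i] (lconj j) v)^*).
  apply: etrans (esym (conjcM _ _)); congr (_ * _).
    by apply/eqP; rewrite eq_complex /= oppr0 !eqxx.
  rewrite /coordinate -[[:: lconj (lconj j)]]/(wconj [:: lconj j]).
  rewrite (inj_eq (inj_map (can_inj (@index_conjK nonneg d)))).
  exact: esym (rmorph_nat _ _).
Qed.

Lemma linear_ham_ev lambda C z r : 0 <= C -> (forall a, `|lambda a| <= C) -> zbd z r ->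
  linear_ham lambda z = ev (quadratic_array lambda) z.
Proof.
move=> C0 hl hz; have [_ hb] := quadratic_hampoly hl C0.
have hb' := abound_unweighted s0 hb; have [_ _ dA] := hb'.
rewrite (ev_rec z dA) add0r.
have qE j : z j * ev (lquot (quadratic_array lambda) j) z = z j * ((lambda j.1 / 2)%:C * z (lconj
  j)).
  congr (_ * _); rewrite -(ev_coordinate (lconj j) z).
  have [D [e h]] : exists D e, abd (coordinate R[i] (lconj j)) D e.
    have h1 := vnb_component s0 (lconj j) (nbound_coordinate nonneg d s 1) (@msupp_coord R nonneg
      d).
    by eexists; eexists; exact: (snb_abd s0 (lexx 1) h1).
  by rewrite -(evZ s0 _ h hz).
rewrite (eq_csum qE).
have [B hB] : asummable (fun j => z j * ((lambda j.1 / 2)%:C * z (lconj j))).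
  by apply: asummable_le (asummable_ev s0 hb' hz) => j; rewrite qE.
have h2 := @sumle2_pairs _ _ _ _ (fun (a : mode nonneg d) (b : bool) => (a, b)) _ B (fun a b a'
  b' e => e) hB.
rewrite (csum_pair (phi := fun a b => (a, b)) (p1 := fst) (p2 := snd) _ _ _ h2)//; last by case.
apply: eq_csum => a; rewrite (csum_finite (s := [:: true; false]))//; last by case.
rewrite big_cons big_seq1 /index_conj /=.
set x := z (a, true); set y := z (a, false).
have e2 : (lambda a)%:C = (lambda a / 2)%:C + (lambda a / 2)%:C :> R[i].
  by rewrite -(rmorphD (real_complex R)) -splitr.
by rewrite e2; ring.
Qed.

Lemma vector_field_ev H P z r : hampoly P -> zbd z r ->
  (forall z' r', zbd z' r' -> H z' = ev P z') ->
  forall j, vector_field H z j = ev (hamfield P j) z.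
Proof.
move=> hP hz hH j; have [[C [e hb]] _ _ _] := hP.
have hb' := abound_unweighted s0 hb.
rewrite /hamfield (evZ s0 _ (abound_partial s0 (lconj j) hb') hz).
rewrite /vector_field symplE (partial_ev s0 (lconj j) hb' hz hH).
by case: j => a [].
Qed.

End PolynomialEvaluation.

(** * Choice of the constants and conclusion *)

(** The truncation order [N] is proportional to [h^-beta], as large as the
    convergence of the recursion allows, so that [tau^-N] is exponentially small
    in [h^-beta].  Half of the exponent absorbs the prefactor [rho / h], the other
    half is the announced bound. *)
Lemma truncation_order (R : realType) (rho kappa beta : R) (r : nat) :
  1 <= rho -> 0 < kappa -> 0 < beta < 1 -> (0 < r)%N ->
  exists2 h0 : R, 0 < h0 <= 1 & forall h, 0 < h <= h0 -> exists N tau,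
    [/\ (0 < N)%N, 1 <= tau, (N * r)%:R / rho * (4 * tau * (kappa * h `^ beta)) <= 8^-1
      & 6 * rho * tau^-1 ^+ N.+1 <= h * expR (- ((h0 / h) `^ beta))].
Proof.
move=> rho1 k0 /andP[b0 b1] r0; have rho0 : 0 < rho := lt_le_trans ltr01 rho1.
have rr0 : 0 < r%:R :> R by rewrite ltr0n.
pose tau : R := expR 2; have tau0 : 0 < tau := expR_gt0 _.
(* With [N <= sigma h^-beta] the recursion converges: [N r / rho * 4 tau kappa h^beta <= 1/8]. *)
pose sigma := rho / (32 * r%:R * tau * kappa).
have sg0 : 0 < sigma by rewrite divr_gt0// !mulr_gt0.
(* [exp x >= (x/k)^k], and [k] is so large that [h^(beta k) <= h^2]. *)
have [k k0' kb] : exists2 k : nat, (0 < k)%N & 2 <= beta * k%:R.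
  have hb : 0 <= 2 / beta by rewrite divr_ge0// ltW.
  have [_ h] := andP (truncn_itv hb); eexists; last first.
    by move: h => /ltW; rewrite ler_pdivrMr// mulrC; apply.
  by [].
have kk0 : 0 < k%:R :> R by rewrite ltr0n.
(* [h2] ensures [N >= 1] and compares the exponents; [h3] absorbs the prefactor. *)
pose h2 := sigma `^ beta^-1; pose h3 := (sigma / k%:R) ^+ k / (6 * rho).
have h20 : 0 < h2 by rewrite powR_gt0.
have sk : 0 < sigma / k%:R by apply: divr_gt0.
have r6 : 0 < 6 * rho by apply: mulr_gt0.
have h30 : 0 < h3 by apply: divr_gt0 => //; apply: exprn_gt0.
exists (Num.min 1 (Num.min h2 h3)).
  by rewrite !lt_min ltr01 h20 h30 /= ge_min lexx.
move=> h /andP[hp]; set h0 := Num.min _ _; rewrite /h0 !le_min => /and3P[h1 hh2 hh3].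
have h0p : 0 < h0 by rewrite /h0 !lt_min ltr01 h20 h30.
pose u := h `^ beta; have u0 : 0 < u by rewrite powR_gt0.
have pw2 : h2 `^ beta = sigma by rewrite /h2 -powRrM mulVf ?gt_eqF// powRr1// ltW.
have h0u : (h0 / h) `^ beta <= sigma / u.
  rewrite ler_pdivlMr// /u -powRM ?divr_ge0 ?(ltW hp) ?(ltW h0p)// divfK ?gt_eqF//.
  rewrite -pw2 ge0_ler_powR ?nnegrE ?(ltW b0) ?(ltW h0p) ?(ltW h20)//.
  by rewrite /h0 ge_min ge_min lexx orbT.
have us : u <= sigma.
  by rewrite -pw2 ge0_ler_powR ?nnegrE ?(ltW b0) ?(ltW hp) ?(ltW h20).
pose x := sigma / u; have x0 : 0 < x by apply: divr_gt0.
have [N /andP[N1 N2]] : exists N : nat, N%:R <= x < N.+1%:R.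
  by eexists; exact: truncn_itv (ltW x0).
exists N, tau; split.
- have : 1 < N.+1%:R :> R by apply: le_lt_trans N2; rewrite ler_pdivlMr// mul1r.
  by rewrite ltr1n ltnS.
- by rewrite /tau ltW// expR_gt1.
- rewrite natrM [leLHS](_ : _ = N%:R * (4 * r%:R * tau * kappa * u / rho)); last by rewrite -/u;
  ring.
  apply: le_trans (ler_wpM2r _ N1) _.
    by rewrite !mulr_ge0 ?invr_ge0 ?ler0n ?(ltW tau0) ?(ltW k0) ?(ltW u0) ?(ltW rho0).
  rewrite /x /sigma le_eqVlt; apply/orP; left; apply/eqP; field.
  by rewrite !gt_eqF.
have tE : tau^-1 ^+ N.+1 <= expR (- (2 * x)).
  rewrite /tau -expRN -expRM_natl mulrN ler_expR lerN2 mulrC ler_wpM2r//.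
  exact: ltW.
have hx : expR (- x) <= expR (- ((h0 / h) `^ beta)) by rewrite ler_expR lerN2.
have key : 6 * rho * expR (- x) <= h.
  rewrite expRN ler_pdivrMr ?expR_gt0//.
  have e1 : (x / k%:R) ^+ k <= expR x.
    have -> : expR x = expR (x / k%:R) ^+ k by rewrite -expRM_natr divfK ?gt_eqF.
    have xk : 0 <= x / k%:R by apply: divr_ge0 => //; apply: ltW.
    rewrite lerXn2r ?nnegrE ?expR_ge0//.
    by apply: le_trans (expR_ge1Dx _); rewrite lerDr.
  apply: le_trans (ler_wpM2l (ltW hp) e1).
  have uk : u ^+ k <= h ^+ 2.
    rewrite -!powR_mulrn ?(ltW u0) ?(ltW hp)// /u -powRrM.
    by rewrite ger_powR ?hp//.
  have -> : (x / k%:R) ^+ k = (sigma / k%:R) ^+ k / u ^+ k.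
    by rewrite /x -expr_div_n; congr (_ ^+ k); rewrite mulrAC.
  rewrite mulrA ler_pdivlMr ?exprn_gt0//.
  apply: le_trans (ler_wpM2l _ uk) _; first by rewrite mulr_ge0// ltW.
  rewrite expr2 mulrCA ler_wpM2l ?(ltW hp)//.
  by move: hh3; rewrite /h3 ler_pdivlMr ?mulr_gt0// mulrC.
apply: le_trans (ler_wpM2l _ tE) _; first by rewrite mulr_ge0// ltW.
rewrite (_ : - (2 * x) = - x + - x); last by ring.
rewrite expRD mulrA; apply: ler_pM => //.
  by rewrite mulr_ge0 ?expR_ge0// mulr_ge0// ltW.
Qed.

Lemma coefficient_le_norm (R : realType) nonneg d (k : nat) (a : coeffs R nonneg d) l (t :
  l.-tuple _) :
  in_P k a -> (2 <= l <= k)%N -> momentum t = 0 -> modulus (a l t) <= poly_norm k a.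
Proof.
move=> hP lk mt.
have sup_ge l' : (2 <= l' <= k)%N -> 0 <= sup (coeff_moduli a l').
  move=> lk'; have [ub _] := hP l' lk'.
  have [[x [j _ xE]]|ne] := pselect (exists x, coeff_moduli a l' x).
    apply: (@le_trans _ _ x); first by rewrite -xE modulus_ge0.
    by apply: (ub_le_sup ub); exists j.
  rewrite (_ : coeff_moduli a l' = set0) ?sup0//.
  by apply/seteqP; split=> // x hx; case: ne; exists x.
have [ub _] := hP l lk.
have h1 : modulus (a l t) <= sup (coeff_moduli a l).
  by apply: (ub_le_sup ub); exists (Sub t (introT eqP mt)).
apply: le_trans h1 _; rewrite /poly_norm (bigD1_seq l) ?iota_uniq//=; last first.
  by rewrite mem_index_iota ltnS.
rewrite lerDl big_seq_cond sumr_ge0// => l' /andP[]; rewrite mem_index_iota ltnS => lk' _.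
exact: sup_ge.
Qed.

Lemma ev_hamfield_scale (R : realType) nonneg d (s : R) (c : R[i]) P j z r :
  0 <= s -> hampoly P -> @zbound R nonneg d s z r ->
  ev (hamfield (fun w => c * P w) j) z = c * ev (hamfield P j) z.
Proof.
move=> s0 hP hz; have [C [e hb]] := bounded_field_component s0 (bounded_hamfield s0 hP) j.
rewrite -(evZ s0 c hb hz); apply: eq_ev => w.
by rewrite /hamfield mulrCA; congr (_ * _); rewrite -wderiv_scale.
Qed.

Theorem theorem5p1 (R : realType) (r0 : nat) (s M gamma beta p : R) :
  (3 <= r0)%N -> 0 <= s -> 1 <= M -> 0 < gamma -> 0 < beta < 1 ->
  exists h0 : R, 0 < h0 /\
  forall (nonneg : bool) (d : nat), (0 < d)%N ->
  forall (omega : mode nonneg d -> R) (C m : R), 0 < C -> 0 < m ->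
  (forall a, `|omega a| <= C * mode_abs R a `^ m) ->
  forall P : coeffs R nonneg d, in_P r0 P -> poly_norm r0 P = p ->
  forall alpha : R -> R -> R,
  (forall h, 0 < h -> alpha h 0 = 0) ->
  (forall h, 0 < h -> alpha h x / x @[x --> 0^'] --> (1 : R)) ->
  (forall h, 0 < h -> forall x, `|alpha h x| <= gamma * h `^ beta) ->
  forall h : R, 0 < h <= h0 ->
  exists (k : nat) (H : coeffs R nonneg d), in_P k H /\
  forall z, l1ball s M z ->
  exists w0 w1 w2 : phase_index nonneg d -> R[i],
    is_flow s (linear_ham (fun a => alpha h (h * omega a))) 1 z w0 /\
    is_flow s (poly_eval r0 P) h w0 w1 /\
    is_flow s (poly_eval k H) h z w2 /\
    (l1norm s (fun j => (w1 j - w2 j)%R)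
       <= (h * expR (- ((h0 / h) `^ beta)))%:E)%E.
Proof.
move=> r3 s0 M1 g0 b01; have rpos : (0 < r0)%N by apply: leq_trans r3.
(* Twice the radius of the data: the intermediate point of the splitting step stays in the ball. *)
pose rho := 2 * M; have rho1 : 1 <= rho by rewrite /rho; lra.
have rho0 : 0 < rho := lt_le_trans ltr01 rho1.
have Mrho : M = rho / 2 by rewrite /rho mulrC mulKf.
(* The norm of a Hamiltonian field is [K] times the bound on its coefficients. *)
pose K := 2 * (2 `^ (s * r0.+1%:R) * r0.+1%:R) * geom r0.+1 rho.
have gm : 0 < geom r0.+1 rho.
  by rewrite geomS ltr_pwDl// mulr_ge0 ?geom_ge0// ltW.
have K0 : 0 < K by rewrite !mulr_gt0 ?powR_gt0.
pose kappa := K * (gamma + `|p|).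
have kp : 0 < kappa by rewrite mulr_gt0// ltr_pwDl.
have [h0 /andP[h00 h01] hh0] := truncation_order rho1 kp b01 rpos.
exists h0; split=> // nonneg d _ omega _ _ _ _ _ P hP pP alpha _ _ halpha h hh.
have [N [tau [N0 tau1 small err]]] := hh0 h hh.
have /andP[hp hle] := hh; have h1 : h <= 1 := le_trans hle h01.
have /andP[b0 b1] := b01.
(* As [beta < 1], the field of [h P] is at most of the size of that of the linear part. *)
have hb : h <= h `^ beta.
  by rewrite -[leLHS]powRr1 ?(ltW hp)// ger_powR ?hp// ltW.
have u0 : 0 <= h `^ beta := powR_ge0 _ _.
have n0 : 0 <= `|p| := normr_ge0 p.
set lambda := fun a => alpha h (h * omega a).
have hl a : `|lambda a| <= gamma * h `^ beta by apply: halpha.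
have gu0 : 0 <= gamma * h `^ beta by rewrite mulr_ge0// ltW.
have [hA bA] := quadratic_hampoly hl gu0.
have hPc l (t : l.-tuple _) : (2 <= l <= r0)%N -> momentum t = 0 -> modulus (P l t) <= `|p|.
  by move=> lr mt; rewrite -pP; apply: le_trans (coefficient_le_norm hP lr mt) (ler_norm _).
have [hB0 bB0] := poly_array_hampoly n0 hP hPc.
have hB := hampoly_scale h hB0; have bB := aboundZ h%:C bB0.
set A := hamfield (quadratic_array lambda); set B := hamfield (fun w => h%:C * poly_array r0 P w)
  in hB *.
pose eta := kappa * h `^ beta.
have etaE : eta = K * ((gamma + `|p|) * h `^ beta) by rewrite mulrA.
have vA : nbound s rho (@letters_of nonneg d) (lwt s) A eta r0.
  have h3 := abound_weaken (lexx 0) (lexx _) (leqW r3) bA.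
  apply: (nbound_le _ (leqnn _) (vnb_hamfield s0 rho0 hA h3)).
  rewrite [leLHS](_ : _ = K * (gamma * h `^ beta)); last by rewrite /K; ring.
  by rewrite etaE ler_wpM2l ?(ltW K0)// ler_wpM2r// lerDl.
have vB : nbound s rho (@letters_of nonneg d) (lwt s) B eta r0.
  apply: (nbound_le _ (leqnn _) (vnb_hamfield s0 rho0 hB bB)).
  rewrite modulus_real gtr0_norm// [leLHS](_ : _ = K * (h * `|p|)); last by rewrite /K; ring.
  rewrite etaE ler_wpM2l ?(ltW K0)// mulrC mulrDl.
  by rewrite (@le_trans _ _ (`|p| * h `^ beta)) ?ler_wpM2l// lerDr.
have mA : msupp 0 A := msupp_hamfield hA.
have mB : msupp 0 B := msupp_hamfield hB.
have Ah : hamiltonian s A by split; [exact: bounded_hamfield|exists (quadratic_array lambda)].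
have Bh : hamiltonian s B by split; [exact: bounded_hamfield|eexists; split; first exact: hB].
have [gS [Q [hQ eQ]]] : hamiltonian s (bch_sum A B N).
  by apply: hamiltonian_sum => // i; apply: hamiltonian_bch.
have [[D [k bQ]] _ _ _] := hQ.
(* The truncated field is the time-[h] field of the modified Hamiltonian. *)
pose QH w := (h^-1)%:C * Q w.
have hQH : hampoly QH := hampoly_scale h^-1 hQ.
have bQH : abound 0 QH (modulus (h^-1)%:C * D) k.+1.
  exact: (abound_weaken (lexx 0) (lexx _) (leqnSn k) (aboundZ (h^-1)%:C bQ)).
exists k, (array_coeffs QH); split; first exact: array_in_P hQH bQH.
move=> z [_ /l1normP hz]; rewrite Mrho in hz.
have hz1 : rho / 2 <= rho by rewrite -Mrho /rho; lra.
have hw0 := split_step_bound s0 rho1 N0 rpos vA tau1 small hz.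
have k8 := small_lie rho1 N0 vA tau1 small.
exists (split_step A z), (lie_flow B 1 (split_step A z)), (lie_flow (bch_sum A B N) 1 z).
split.
  apply: (lie_flow_is_flow s0 rho1 vA mA rpos k8 hz hz1 ltr01) => w r' hw j.
  rewrite invr1 mul1r (vector_field_ev s0 hA hw)// => z' r'' hz'.
  exact: (linear_ham_ev s0 gu0 hl hz').
split.
  apply: (lie_flow_is_flow s0 rho1 vB mB rpos _ hw0 (lexx _) hp) => [|w r' hw j].
    exact: k8.
  rewrite (ev_hamfield_scale _ j s0 hB0 hw) mulrA -(rmorphM (real_complex R)) mulVf ?gt_eqF//.
  rewrite mul1r (vector_field_ev s0 hB0 hw)// => z' r'' hz'.
  exact: (poly_eval_ev s0 n0 hPc hz').
split.
  have Nr : (0 < N * r0)%N by rewrite muln_gt0 N0.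
  have HX w r' : zbound s w r' -> forall j, vector_field (poly_eval k (array_coeffs QH)) w j
      = (h^-1)%:C * ev (bch_sum A B N j) w.
    move=> hw j; rewrite (eQ _ _ hw) -(ev_hamfield_scale _ j s0 hQ hw).
    apply: (vector_field_ev s0 hQH hw) => z' r'' hz'.
    exact: (poly_eval_array s0 hQH bQH hz').
  exact: (lie_flow_is_flow s0 rho1 (vnb_bch_sum s0 rho1 rpos vA vB tau1 small) (msupp_bch_sum mA
    mB (N:=N)) Nr small hz hz1 hp HX).
apply/l1normP => U uU.
apply: le_trans (flow_difference s0 rho1 N0 rpos vA vB tau1 small hz uU) err.
Qed.
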